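(* Let $d\ge 1$. For any $t^*>0$, there exist a negative initial condition $u_0\in C^\infty(\mathbb{T}^d)$, $u_0<0$, and a classical solution $u$ on $[0,t^* )$ to $$u_t - u\,|\nabla| u + |\nabla|(u^2) = 0,\qquad u(\cdot,0)=u_0,$$ that develops into a discontinuous solution at time $t^*$, i.e. $u(t^* )\in L^\infty(\mathbb{T}^d)\setminus C(\mathbb{T}^d)$.
   Context: $\mathbb{T}^d=(\mathbb{R}/2\pi\mathbb{Z})^d$. $|\nabla|=(-\Delta)^{1/2}$ is the Fourier multiplier with symbol $|\xi|$. The value $u(t^* )$ is understood as the limit of $u(t)$ as $t\to t^{*-}$, in the weak$^*$ topology of $L^\infty(\mathbb{T}^d)$ and strongly in $L^2(\mathbb{T}^d)$. $u(t^* )\notin C(\mathbb{T}^d)$ means that $u(t^* )$ does not agree almost everywhere with a continuous function. *)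

(* Defs.v *)
From HB Require Import structures.
From mathcomp Require Import all_boot all_order all_algebra.
From mathcomp Require Import all_classical all_reals all_analysis.
From mathcomp Require Import complex.

Set Implicit Arguments.
Unset Strict Implicit.
Unset Printing Implicit Defensive.

Import Order.TTheory GRing.Theory Num.Theory.
Import numFieldNormedType.Exports.

Local Open Scope classical_set_scope.
Local Open Scope ring_scope.

(* A function on T^d = (R/2piZ)^d is a function on 'rV[R]_d satisfying
   [torus_periodic]; its integral over T^d is taken over the fundamental domain
   [0, 2pi]^d against [torus_measure].  MathComp-Analysis has no Lebesgue
   measure on row vectors, but it makes d.-tuple R a measurable type, hence the
   passage through [torus_pt]. *)

Section TorusMeasure.
Context {R : realType}.

Definition circle_measure : {measure set (measurableTypeR R) -> \bar R} :=
  mrestr (@lebesgue_measure R) (measurable_itv `[0, 2 * pi]).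

Lemma circle_measure_lty : (circle_measure setT < +oo)%E.
Proof.
rewrite /circle_measure /= /mrestr setTI lebesgue_measure_itv /=.
by case: ifP => _; rewrite ?ltry // -EFinB ltry.
Qed.

Definition tuple_cons n (p : measurableTypeR R * n.-tuple (measurableTypeR R)) :
  n.+1.-tuple (measurableTypeR R) := [tuple of p.1 :: p.2].

Lemma measurable_tuple_cons n : measurable_fun setT (@tuple_cons n).
Proof. exact: measurable_cons. Qed.

HB.instance Definition _ n :=
  isMeasurableFun.Build _ _ _ _ (@tuple_cons n) (@measurable_tuple_cons n).

Section Step.
Variables (n : nat).
Variable m : {finite_measure set (n.-tuple (measurableTypeR R)) -> \bar R}.

Definition torus_step : set (n.+1.-tuple (measurableTypeR R)) -> \bar R :=
  pushforward (circle_measure \x m)%E (@tuple_cons n).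

Let torus_step0 : torus_step set0 = 0%E.
Proof. exact: measure0. Qed.

Let torus_step_ge0 A : (0 <= torus_step A)%E.
Proof. exact: measure_ge0. Qed.

Let torus_step_sigma_additive : semi_sigma_additive torus_step.
Proof. exact: measure_semi_sigma_additive. Qed.

HB.instance Definition _ := isMeasure.Build _ _ _ torus_step
  torus_step0 torus_step_ge0 torus_step_sigma_additive.

Lemma torus_step_fin : fin_num_fun torus_step.
Proof.
apply: lty_fin_num_fun => /=; rewrite /torus_step /pushforward preimage_setT.
rewrite -setXTT product_measure1E // lte_mul_pinfty //.
  by rewrite ge0_fin_numE // circle_measure_lty.
by rewrite -ge0_fin_numE // fin_num_measure.
Qed.

HB.instance Definition _ :=
  Measure_isFinite.Build _ _ _ torus_step torus_step_fin.
End Step.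

(* d-dimensional Lebesgue measure on [0, 2pi]^d, as an iterated product. *)
Fixpoint torus_measure (d : nat) :
    {finite_measure set (d.-tuple (measurableTypeR R)) -> \bar R} :=
  match d with
  | 0 => \d_ [tuple]
  | n.+1 => torus_step (torus_measure n)
  end.

End TorusMeasure.

Section Torus.
Context {R : realType} {d : nat}.
Implicit Types (f g : 'rV[R]_d -> R) (xi : 'rV[int]_d).

Definition torus_pt (x : d.-tuple (measurableTypeR R)) : 'rV[R]_d :=
  \row_i tnth x i.

Definition freq xi : 'rV[R]_d := map_mx intr xi.

Definition torus_periodic f := forall (k : 'rV[int]_d) (x : 'rV[R]_d),
  f (x + (2 * pi) *: freq k) = f x.

Definition partials (s : seq 'I_d) f : 'rV[R]_d -> R :=
  foldr (fun i g x => 'D_(delta_mx 0 i) g x) f s.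

Definition smooth f := forall s : seq 'I_d,
  continuous (partials s f) /\
  forall i x, derivable (partials s f) x (delta_mx 0 i).

Definition dotv (x y : 'rV[R]_d) : R := \sum_(i < d) x 0 i * y 0 i.

(* The norm `|x| of 'rV[R]_d is the sup norm; the symbol of |nabla| is the
   Euclidean one. *)
Definition euclid (x : 'rV[R]_d) : R := Num.sqrt (dotv x x).

Definition torus_int f : R := (\int[torus_measure d]_x f (torus_pt x))%R.

(* (2 pi)^-d \int f(x) exp(- i xi.x) dx *)
Definition fourier_coef f xi : R[i] :=
  (((2 * pi) ^- d)%:C *
   (torus_int (fun x => f x * cos (dotv (freq xi) x)) -i*
    torus_int (fun x => f x * sin (dotv (freq xi) x))))%C.

(* g = m(D) f, the Fourier multiplier with symbol m. *)
Definition fourier_multiplier (m : 'rV[R]_d -> R) f g :=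
  forall xi, fourier_coef g xi = ((m (freq xi))%:C)%C * fourier_coef f xi.

Definition is_absgrad f g := fourier_multiplier euclid f g.

Definition continuous_on_slab (T : R) (F : R -> 'rV[R]_d -> R) :=
  {within [set p : R * 'rV[R]_d | 0 <= p.1 < T],
    continuous (fun p => F p.1 p.2)}.

(* At t = 0 the derivative is one-sided. *)
Definition is_time_derivative (T : R) (u v : R -> 'rV[R]_d -> R) :=
  forall (t : R) (x : 'rV[R]_d), 0 <= t < T ->
    (s - t)^-1 * (u s x - u t x) @[s --> within `[0, T[ t^'] --> v t x.

(* Classical solution on [0,T) x T^d of  u_t - u |nabla| u + |nabla|(u^2) = 0:
   u is C^1 in (t, x) up to t = 0, the nonlocal terms are continuous functions,
   and the equation holds at every point.  Values u t for t outside [0, T) are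
   irrelevant. *)
Definition classical_solution (T : R) (u0 : 'rV[R]_d -> R)
    (u : R -> 'rV[R]_d -> R) :=
  [/\ forall t : R, 0 <= t < T -> torus_periodic (u t),
      continuous_on_slab T u,
      forall i : 'I_d,
        (forall (t : R) x, 0 <= t < T -> derivable (u t) x (delta_mx 0 i)) /\
        continuous_on_slab T (fun t x => 'D_(delta_mx 0 i) (u t) x),
      (exists ut Lu Lu2 : R -> 'rV[R]_d -> R,
        [/\ is_time_derivative T u ut,
            (forall t : R, 0 <= t < T ->
               [/\ torus_periodic (Lu t), torus_periodic (Lu2 t),
                   is_absgrad (u t) (Lu t)
                 & is_absgrad (fun x => u t x ^+ 2) (Lu2 t)]),
            continuous_on_slab T ut,
            continuous_on_slab T Lu /\ continuous_on_slab T Lu2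
          & forall (t : R) x, 0 <= t < T ->
              ut t x - u t x * Lu t x + Lu2 t x = 0])
    & u 0 = u0].

Definition in_Lp (p : \bar R) f := (f \o torus_pt) \in Lfun (torus_measure d) p.

Definition L2_limit_left (u : R -> 'rV[R]_d -> R) (T : R) f :=
  ('N[torus_measure d]_2%:E[(fun x => (u t (torus_pt x) - f (torus_pt x))%:E)]
     @[t --> T^'-] --> 0)%E.

(* L^oo is the dual of L^1; test functions need only be given on the
   fundamental domain. *)
Definition weakstar_limit_left (u : R -> 'rV[R]_d -> R) (T : R) f :=
  forall phi : d.-tuple (measurableTypeR R) -> R,
    phi \in Lfun (torus_measure d) 1%E ->
    (\int[torus_measure d]_x (u t (torus_pt x) * phi x))%R @[t --> T^'-] -->
    (\int[torus_measure d]_x (f (torus_pt x) * phi x))%R.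

Definition ae_continuous f := exists g,
  [/\ torus_periodic g, continuous g &
      {ae torus_measure d, forall x, f (torus_pt x) = g (torus_pt x)}].

End Torus.

(* Main.v *)
Require Import Defs.
From mathcomp Require Import all_boot all_order all_algebra.
From mathcomp Require Import all_classical all_reals all_analysis.
From mathcomp Require Import complex ess_sup_inf measurable_realfun ring lra zify.
Set Implicit Arguments.
Unset Strict Implicit.
Unset Printing Implicit Defensive.
Import Order.TTheory GRing.Theory Num.Theory.
Import numFieldNormedType.Exports.
Local Open Scope classical_set_scope.
Local Open Scope ring_scope.

(* The equation is run backwards: u(t) = - U(t* - t), where U > 0 solves
   U_t = U |nabla| U - |nabla| (U^2).  With k >= 0 the kernel of |nabla|, the
   right-hand side is \int k(y) U(x+y) (U(x+y) - U(x)) dy, so this is a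
   parabolic equation with a maximum principle.  Hence it suffices to start U
   from a discontinuous datum close to 1 and to show that U is smooth at every
   positive time and tends to the datum in L^2 as the time tends to 0.

   The datum is 1 + sin(F(x_0)) / 100, where F is unbounded near x_0 = 0 but has
   finite H^{1/2} energy, so that the datum oscillates at 0.  U is a limit, along
   an ultrafilter, of explicit Euler schemes on lattices, in which |nabla| is
   replaced by a convolution operator whose square is minus the second
   difference.  The H^{1/2} energy of v = U - 1 decreases and controls the
   time integral of ||v'||^2; this gives the L^2 continuity at time 0 and, by
   bootstrapping with weights in time, bounds on all derivatives which are
   uniform in the mesh. *)

(** * The lattice half-Laplacian *)

(** The energy is critical: in one dimension H^{1/2} just fails to embed into the continuous
    functions, so a discontinuous datum can have finite energy. The solution depends on x_0 only, so
    that the problem is one-dimensional for every d. Smallness of v closes the estimates: the worst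
    terms of the nonlinearity, those with all derivatives on one factor, are at most 3 sup|v| times
    the norm whose square is dissipated, and sup|v| <= 1/100 persists by the maximum principle.
    Lattices are used because an explicit scheme needs no existence theory and because the discrete
    operator keeps both structures that the argument rests on: a kernel of constant sign off the
    diagonal, which gives the maximum principle and the Gagliardo form of the energy, and the
    isometry ||labs f|| = ||dif f||. Along an ultrafilter every bounded sequence converges, so
    values, differences and nonlocal terms converge together without extraction of subsequences. *)

Section Trigonometry.
Context {R : realType}.
Implicit Types (a b x y : R).

Lemma cosD2pin a n : cos (a + 2 * pi * n%:R) = cos a.
Proof.
rewrite (_ : 2 * pi * n%:R = (pi *+ 2) *+ n :> R); last by rewrite -[RHS]mulr_natr -[pi *+ 2]mulr_natl.
by rewrite (periodicn (@cosD2pi R)).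
Qed.

Lemma sinD2pin a n : sin (a + 2 * pi * n%:R) = sin a.
Proof.
rewrite (_ : 2 * pi * n%:R = (pi *+ 2) *+ n :> R); last by rewrite -[RHS]mulr_natr -[pi *+ 2]mulr_natl.
by rewrite (periodicn (@sinD2pi R)).
Qed.

Lemma cos_mulC a b : 2 * (cos a * cos b) = cos (a - b) + cos (a + b).
Proof. by rewrite cosB cosD; ring. Qed.

Lemma sin_mul_cos a b : 2 * (sin a * cos b) = sin (a + b) + sin (a - b).
Proof. by rewrite sinB sinD; ring. Qed.

Lemma cos_half a : 2 * sin (a / 2) ^+ 2 = 1 - cos a.
Proof.
have -> : cos a = cos ((a / 2) *+ 2) by rewrite -mulr_natr divfK.
by rewrite cos_mulr2n cos2sin2 -mulr_natr; ring.
Qed.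

Lemma sum_cos_arith a x n :
  2 * sin (x / 2) * \sum_(i < n) cos (a + x * i%:R) =
  sin (a + x * n%:R - x / 2) - sin (a - x / 2).
Proof.
elim: n => [|n IHn]; first by rewrite big_ord0 mulr0 mulr0 addr0 subrr.
rewrite big_ord_recr /= mulrDr IHn -mulrA sin_mul_cos.
have -> : x / 2 + (a + x * n%:R) = a + x * n.+1%:R - x / 2.
  by rewrite -natr1; field.
rewrite (_ : x / 2 - (a + x * n%:R) = - (a + x * n%:R - x / 2)); last by ring.
by rewrite sinN; ring.
Qed.

Lemma sum_sin_arith x n :
  2 * sin (x / 2) * \sum_(i < n) sin (x * i%:R) =
  cos (x / 2) - cos (x * n%:R - x / 2).
Proof.
have := sum_cos_arith (- (pi / 2)) x n.
rewrite (eq_bigr (fun i : 'I_n => sin (x * i%:R))); last first.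
  by move=> i _; rewrite addrC cosBpihalf.
move=> ->.
rewrite (_ : - (pi / 2) + x * n%:R - x / 2 = (x * n%:R - x / 2) - pi / 2); last by ring.
by rewrite sinBpihalf (_ : - (pi / 2) - x / 2 = - (x/2) - pi / 2) ?sinBpihalf ?cosN; ring.
Qed.

End Trigonometry.

Section Orthogonality.
Context {R : realType} (p : nat).
Local Notation N := (p.+2).
Local Notation G := 'I_p.+2.

(** The lattice has p+2 points, so that its index type carries the ring structure of Z/N: addition
    of indices wraps around and periodicity is built in. *)
Definition mesh : R := 2 * pi / N%:R.
Local Notation h := mesh.

Lemma mesh_gt0 : 0 < h.
Proof. by rewrite divr_gt0 ?mulr_gt0 ?pi_gt0 ?ltr0n. Qed.

Lemma two_mesh_ge0 : 0 <= 2 / h.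
Proof. by apply: divr_ge0 => //; apply/ltW/mesh_gt0. Qed.

Lemma mesh_neq0 : h != 0.
Proof. by rewrite gt_eqF ?mesh_gt0. Qed.

Lemma mesh_period : h * N%:R = 2 * pi.
Proof. by rewrite /mesh divfK // pnatr_eq0. Qed.

Lemma cos_meshDN a (k : nat) : cos (a + h * (N * k)%:R) = cos a.
Proof. by rewrite natrM mulrA mesh_period cosD2pin. Qed.

Lemma sin_meshDN a (k : nat) : sin (a + h * (N * k)%:R) = sin a.
Proof. by rewrite natrM mulrA mesh_period sinD2pin. Qed.

Lemma sin_half_mesh_gt0 (k : nat) : (0 < k < N)%N -> 0 < sin (h * k%:R / 2).
Proof.
move=> /andP[k0 kN]; apply: sin_gt0_pi.
have -> : h * k%:R / 2 = pi * (k%:R / N%:R).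
    have : N%:R != 0 :> R by rewrite pnatr_eq0.
    by rewrite /mesh; move: (N%:R : R) => n n0; field.
rewrite mulr_gt0 ?pi_gt0 ?divr_gt0 ?ltr0n //=.
by rewrite gtr_pMr ?pi_gt0 // ltr_pdivrMr ?ltr0n // mul1r ltr_nat.
Qed.

Lemma sum_cos_mesh a (k : nat) : (0 < k < N)%N ->
  \sum_(y < N) cos (a + h * (k * y)%:R) = 0.
Proof.
move=> kN; have s0 := sin_half_mesh_gt0 kN.
have := sum_cos_arith a (h * k%:R) N.
under eq_bigr do rewrite -mulrA -natrM.
rewrite -(mulrA h k%:R N%:R) -natrM (mulnC k).
rewrite (addrAC a) sin_meshDN subrr => /eqP.
by rewrite !mulf_eq0 pnatr_eq0 (gt_eqF s0) /= => /eqP.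
Qed.

Lemma sum_cos_meshN a (k : nat) : (0 < k < N)%N ->
  \sum_(y < N) cos (a - h * (k * y)%:R) = 0.
Proof.
move=> kN; rewrite -[RHS](sum_cos_mesh (- a) kN).
by apply: eq_bigr => y _; rewrite -cosN; congr cos; ring.
Qed.

Lemma sum_cos_diff a (k l : nat) : (k < N)%N -> (l < N)%N ->
  \sum_(y < N) cos (a + h * (l * y)%:R - h * (k * y)%:R) =
  if k == l then N%:R * cos a else 0.
Proof.
move=> kN lN; have [->|kl] := eqVneq.
  under eq_bigr do rewrite addrK.
  by rewrite sumr_const card_ord mulr_natl.
have [lk|lk] := leqP k l.
  rewrite -[RHS](@sum_cos_mesh a (l - k)) //; last by lia.
  by apply: eq_bigr => y _; rewrite mulnBl natrB ?leq_mul2r ?lk ?orbT //; congr cos; ring.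
rewrite -[RHS](@sum_cos_meshN a (k - l)) //; last by lia.
by apply: eq_bigr => y _; rewrite mulnBl natrB ?leq_mul2r ?(ltnW lk) ?orbT //; congr cos; ring.
Qed.

Lemma sum_cos_add a (k l : nat) : (k < N)%N -> (l < N)%N ->
  \sum_(y < N) cos (a + h * (l * y)%:R + h * (k * y)%:R) =
  if (k + l == 0)%N || (k + l == N)%N then N%:R * cos a else 0.
Proof.
move=> kN lN.
have E (y : 'I_N) : a + h * (l * y)%:R + h * (k * y)%:R = a + h * ((k + l) * y)%:R.
  by rewrite mulnDl natrD; ring.
under eq_bigr do rewrite E.
have [kl0|kl0] := eqVneq (k + l)%N 0%N.
  under eq_bigr do rewrite kl0 mul0n mulr0 addr0.
  by rewrite sumr_const card_ord mulr_natl.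
have [klN|klN] := eqVneq (k + l)%N N.
  under eq_bigr do rewrite klN cos_meshDN.
  by rewrite sumr_const card_ord mulr_natl.
have [lt|ge] := ltnP (k + l) N; first by rewrite sum_cos_mesh //; lia.
rewrite /= -[RHS](@sum_cos_mesh a (k + l - N)) //; last by lia.
apply: eq_bigr => y _; rewrite -[RHS](cos_meshDN _ y); congr cos.
by rewrite -addrA -mulrDr -natrD -mulnDl subnK.
Qed.

(* The square of [symb] is the symbol of minus the second difference; [kap] is
   the kernel of the convolution operator [labs] with symbol [symb]. *)
Definition symb (k : nat) : R := 2 / h * sin (h * k%:R / 2).

Lemma symb0 : symb 0 = 0.
Proof. by rewrite /symb mulr0 mul0r sin0 mulr0. Qed.

Lemma symb_rev (k : nat) : (k <= N)%N -> symb (N - k) = symb k.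
Proof.
move=> kN; rewrite /symb natrB // mulrBr mesh_period; congr (_ * _).
rewrite (_ : (2 * pi - h * k%:R) / 2 = - (h * k%:R / 2) + pi); last by field.
by rewrite sinDpi sinN opprK.
Qed.

Lemma symb_sqr (k : nat) : symb k ^+ 2 = 2 / h ^+ 2 * (1 - cos (h * k%:R)).
Proof. by rewrite -cos_half /symb; field; exact: mesh_neq0. Qed.

Lemma symb_le (k : nat) : symb k <= 2 / h.
Proof. by rewrite /symb ler_piMr ?two_mesh_ge0 // sin_le1. Qed.

Definition kap (y : G) : R :=
  N%:R^-1 * \sum_(k < N) symb k * cos (h * (k * y)%:R).

(** On the lattice the frequencies k and N - k give the same cosines. Orthogonality therefore picks
    out both k = m and k = N - m, each with weight 1/2, and [symb] takes the same value at the
    two. *)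
Lemma kap_symbol a (m : nat) : (m < N)%N ->
  \sum_(y : G) kap y * cos (a + h * (m * y)%:R) = symb m * cos a.
Proof.
move=> mN; rewrite /kap.
have N0 : N%:R != 0 :> R by rewrite pnatr_eq0.
have Nk (k : 'I_N) : \sum_(y < N) cos (h * (k * y)%:R) * cos (a + h * (m * y)%:R) =
    2^-1 * ((if k == m :> nat then N%:R * cos a else 0)
    + (if (k + m == 0)%N || (k + m == N)%N then N%:R * cos a else 0)).
  rewrite -sum_cos_diff // -sum_cos_add // -big_split mulr_sumr /=.
  apply: eq_bigr => y _; rewrite [_ * cos (a + _)]mulrC -cos_mulC; by field.
transitivity (N%:R^-1 * \sum_(k < N) symb k * (2^-1 * ((if k == m :> nat then N%:R * cos a else 0)
    + (if (k + m == 0)%N || (k + m == N)%N then N%:R * cos a else 0)))).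
  under [in RHS]eq_bigr do rewrite -Nk mulr_sumr.
  rewrite exchange_big /= mulr_sumr; apply: eq_bigr => y _.
  by rewrite -mulrA mulr_suml; congr (_ * _); apply: eq_bigr => k _; rewrite mulrA.
have -> : \sum_(k < N) symb k * (2^-1 * ((if k == m :> nat then N%:R * cos a else 0)
    + (if (k + m == 0)%N || (k + m == N)%N then N%:R * cos a else 0))) =
  \sum_(k < N) (if k == Ordinal mN then 2^-1 * symb m * (N%:R * cos a) else 0) +
  \sum_(k < N) (if (k + m == 0)%N || (k + m == N)%N then 2^-1 * symb m * (N%:R * cos a) else 0).
  rewrite -big_split; apply: eq_bigr => k _ /=.
  have Ek : (k == Ordinal mN) = (k == m :> nat) by [].
  rewrite Ek mulrDr mulrDr; congr (_ + _).
    by case: eqVneq => [->|_]; rewrite ?mulr0 //; ring.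
  case: ifP => [|_]; last by rewrite !mulr0.
  case/orP => /eqP km.
    have [-> ->] : nat_of_ord k = 0%N /\ m = 0%N by lia.
    by ring.
  have -> : nat_of_ord k = (N - m)%N by lia.
  by rewrite symb_rev ?(ltnW mN) //; ring.
rewrite -big_mkcond big_pred1_eq.
(* For m = 0 there is no partner frequency N - m below N; the term counted twice is harmless because
   [symb 0] vanishes. *)
have [m0|m0] := posnP m.
  rewrite m0 symb0 mulr0 !mul0r big1 ?addr0 ?mulr0 ?mul0r// => k _.
  by case: ifP.
have mN' : (N - m < N)%N by lia.
rewrite (eq_bigr (fun k : 'I_N => if k == Ordinal mN' then 2^-1 * symb m * (N%:R * cos a) else 0)).
  rewrite -big_mkcond big_pred1_eq; move: (N%:R : R) N0 => n n0; by field.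
move=> k _; have -> : (k == Ordinal mN') = (k == (N - m)%N :> nat) by [].
by congr (if _ then _ else _); apply/idP/idP => H; have := ltn_ord k; lia.
Qed.

Lemma kap_sum0 : \sum_(y : G) kap y = 0.
Proof.
have := @kap_symbol 0 0 isT; rewrite symb0 mul0r => H; rewrite -[RHS]H.
by apply: eq_bigr => y _; rewrite mul0n mulr0 addr0 cos0 mulr1.
Qed.

(** As [kap] sums to 0, this bounds the total mass of the off-diagonal weights [- kap y], and so
    fixes which time steps are admissible. *)
Lemma kap0 : kap 0 <= 2 / h.
Proof.
rewrite /kap ler_pdivrMl ?ltr0n //.
have -> : N%:R * (2 / h) = \sum_(k < N) 2 / h by rewrite sumr_const card_ord mulr_natl.
apply: ler_sum => k _.
by rewrite muln0 mulr0 cos0 mulr1 symb_le.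
Qed.

(* Off the diagonal, [kap] is a difference of two cotangents. *)
Lemma kap_le0 (y : G) : y != 0 -> kap y <= 0.
Proof.
move=> y0.
have yN : (0 < y < N)%N by rewrite lt0n y0 ltn_ord.
rewrite /kap pmulr_rle0 ?invr_gt0 ?ltr0n //.
rewrite (eq_bigr (fun k : 'I_N => h^-1 * (sin (h * ((y : nat)%:R + 2^-1) * k%:R)
     - sin (h * ((y : nat)%:R - 2^-1) * k%:R)))); last first.
  move=> k _; rewrite /symb.
  transitivity (h^-1 * (2 * (sin (h * k%:R / 2) * cos (h * (k * y)%:R)))); first by ring.
  rewrite sin_mul_cos natrM; congr (_ * (_ + _)); last rewrite -sinN; by congr sin; field.
rewrite -mulr_sumr pmulr_rle0 ?invr_gt0 ?mesh_gt0 // sumrB subr_le0.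
(* For z = y + 1/2 and z = y - 1/2 the angle h z N is an odd multiple of pi, and the sum of sines
   collapses to the cotangent of h z / 2. The sign then follows from the decrease of the cotangent
   on (0, pi). *)
have key z : sin (h * z / 2) != 0 -> cos (h * z * N%:R) = -1 -> sin (h * z * N%:R) = 0 ->
   \sum_(k < N) sin (h * z * k%:R) = cos (h * z / 2) / sin (h * z / 2).
  move=> s0 c1 s1; apply: (mulfI s0); rewrite [RHS]mulrC divfK //.
  apply: (@mulfI _ 2); rewrite ?pnatr_eq0 // mulrA sum_sin_arith cosB c1 s1 mul0r; ring.
have A1 : h * ((y : nat)%:R + 2^-1) * N%:R = pi + 2 * pi * (y : nat)%:R :> R by rewrite mulrAC mesh_period; field.
have A2 : h * ((y : nat)%:R - 2^-1) * N%:R = pi + 2 * pi * y.-1%:R :> R.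
  by rewrite mulrAC mesh_period -subn1 natrB ?(andP yN).1 //; field.
have h0 := mesh_gt0; have pi0 := @pi_gt0 R.
have y1 : 1 <= (y : nat)%:R :> R by rewrite ler1n; case/andP: yN.
have yN1 : (y : nat)%:R + 1 <= N%:R :> R by rewrite natr1 ler_nat; case/andP: yN.
have N0 : 0 < N%:R :> R by rewrite ltr0n.
have hy : h * (y : nat)%:R + h <= 2 * pi.
  by rewrite -mesh_period -[X in _ + X]mulr1 -mulrDr ler_pM2l.
have hy1 : h <= h * (y : nat)%:R by rewrite ler_peMr // ltW.
have sp : 0 < sin (h * ((y : nat)%:R + 2^-1) / 2).
  by apply: sin_gt0_pi; rewrite mulrDr; apply/andP; split; lra.
have sm : 0 < sin (h * ((y : nat)%:R - 2^-1) / 2).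
  by apply: sin_gt0_pi; rewrite mulrBr; apply/andP; split; lra.
rewrite !key ?gt_eqF ?A1 ?A2 ?cosD2pin ?sinD2pin ?cospi ?sinpi //.
rewrite ler_pdivrMr // [leRHS]mulrAC ler_pdivlMr // -subr_ge0.
rewrite [cos _ * sin _]mulrC -sinB.
by apply/ltW/sin_gt0_pi; rewrite mulrBr mulrDr; apply/andP; split; lra.
Qed.
End Orthogonality.

Section LatticeOperators.
Context {R : realType} {p : nat}.
Local Notation N := (p.+2).
Local Notation G := 'I_p.+2.
Local Notation h := (@mesh R p).
Local Notation symb := (@symb R p).
Implicit Types (f g : G -> R) (x y z : G) (a b : R).

Definition dif f : G -> R := fun x => (f (x + 1) - f x) / h.
Definition labs f : G -> R := fun x => \sum_(y : G) kap y * f (x + y).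
Definition ip f g : R := h * \sum_x f x * g x.
Definition nrm f : R := Num.sqrt (ip f f).
Definition en f : R := ip f (labs f).

Lemma sum_shift (F : G -> R) z : \sum_x F (x + z) = \sum_x F x.
Proof. by rewrite [RHS](reindex_inj (addIr z)). Qed.

Lemma sum_opp (F : G -> R) : \sum_x F (- x) = \sum_x F x.
Proof. by rewrite [RHS](reindex_inj oppr_inj). Qed.

Lemma cos_meshD a (m : nat) x y :
  cos (a + h * (m * (x + y)%R : nat)%:R) = cos (a + h * (m * x)%:R + h * (m * y)%:R).
Proof.
have e : (x + y : nat)%N = (((x + y)%R : G) + (x + y) %/ N * N)%N.
  by rewrite [RHS]addnC; exact: divn_eq.
rewrite -addrA -mulrDr -natrD -mulnDr e mulnDr natrD mulrDr addrA.
by rewrite mulnA [(_ * N)%N]mulnC cos_meshDN.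
Qed.

Lemma sin_cos_shift a : sin a = cos (a - pi / 2).
Proof. by rewrite cosBpihalf. Qed.

Lemma labs_cos a (m : nat) : (m < N)%N ->
  labs (fun x => cos (a + h * (m * x)%:R)) = fun x => symb m * cos (a + h * (m * x)%:R).
Proof.
move=> mN; apply/funext => x; rewrite -(@kap_symbol R p _ m) //.
by apply: eq_bigr => y _; rewrite cos_meshD.
Qed.

Lemma kapN y : kap (- y) = kap y :> R.
Proof.
rewrite /kap; congr (_ * _); apply: eq_bigr => k _; congr (_ * _).
have := @cos_meshD (- (h * (k * y)%:R)) k (- y) y.
rewrite addNr muln0 mulr0 addr0 cosN => ->; congr cos; ring.
Qed.

Lemma labsE f x : labs f x = \sum_y (- kap y) * (f x - f (x + y)).
Proof.
rewrite /labs; under [RHS]eq_bigr do rewrite mulrBr.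
rewrite sumrB -mulr_suml sumrN kap_sum0 oppr0 mul0r sub0r -sumrN.
by apply: eq_bigr => y _; rewrite mulNr opprK.
Qed.

Lemma labs_cst a : labs (fun=> a) = fun=> 0.
Proof. by apply/funext => x; rewrite labsE big1 // => y _; rewrite subrr mulr0. Qed.

Lemma labs_lin a b f g :
  labs (fun x => a * f x + b * g x) = fun x => a * labs f x + b * labs g x.
Proof.
apply/funext => x; rewrite /labs !mulr_sumr -big_split.
by apply: eq_bigr => y _ /=; ring.
Qed.

Lemma dif_lin a b f g :
  dif (fun x => a * f x + b * g x) = fun x => a * dif f x + b * dif g x.
Proof. by apply/funext => x; rewrite /dif; ring. Qed.

Lemma labs_dif f : labs (dif f) = dif (labs f).
Proof.
apply/funext => x; rewrite /labs /dif -sumrB mulr_suml.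
by apply: eq_bigr => y _; rewrite [x + 1 + y]addrAC; ring.
Qed.

Lemma labs_iter_dif n f : labs (iter n dif f) = iter n dif (labs f).
Proof. by elim: n => //= n IHn; rewrite labs_dif IHn. Qed.

Lemma ipC f g : ip f g = ip g f.
Proof. by rewrite /ip; under eq_bigr do rewrite mulrC. Qed.

Lemma ip_linl a b f g f' : ip (fun x => a * f x + b * g x) f' = a * ip f f' + b * ip g f'.
Proof.
rewrite /ip !mulr_sumr -big_split /=; apply: eq_bigr => x _; ring.
Qed.

Lemma ip_linr a b f g f' : ip f' (fun x => a * f x + b * g x) = a * ip f' f + b * ip f' g.
Proof. by rewrite ipC ip_linl ![ip f' _]ipC. Qed.

Lemma ip_shift f g z : ip (fun x => f (x + z)) (fun x => g (x + z)) = ip f g.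
Proof. by rewrite /ip (sum_shift (fun x => f x * g x)). Qed.

Lemma ip_ge0 f : 0 <= ip f f.
Proof.
apply: mulr_ge0; first exact/ltW/mesh_gt0.
by apply: sumr_ge0 => x _; rewrite -expr2 sqr_ge0.
Qed.

Lemma nrm_ge0 f : 0 <= nrm f. Proof. exact: sqrtr_ge0. Qed.

Lemma nrm_sqr f : nrm f ^+ 2 = ip f f.
Proof. by rewrite sqr_sqrtr ?ip_ge0. Qed.

Lemma labs_sym f g : ip (labs f) g = ip f (labs g).
Proof.
rewrite /ip /labs; congr (_ * _).
under eq_bigr do rewrite mulr_suml.
under [RHS]eq_bigr do rewrite mulr_sumr.
rewrite exchange_big [RHS]exchange_big /= -[RHS]sum_opp.
apply: eq_bigr => y _; rewrite -[RHS](sum_shift _ y).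
by apply: eq_bigr => x _; rewrite addrK kapN; ring.
Qed.

(** Discrete Gagliardo form of the H^{1/2} energy: averaging with the substitution that exchanges x
    and x + y, under which [kap] is even, produces the squares. All weights that count are
    nonnegative, which gives both positivity and [en_contraction]. *)
Lemma enE f : en f = h * 2^-1 * \sum_x \sum_y (- kap y) * (f x - f (x + y)) ^+ 2.
Proof.
have A : \sum_x f x * labs f x = \sum_x \sum_y (- kap y) * (f x * (f x - f (x + y))).
  apply: eq_bigr => x _; rewrite labsE mulr_sumr.
  by apply: eq_bigr => y _; ring.
have B : \sum_x \sum_y (- kap y) * (f x * (f x - f (x + y))) =
   \sum_x \sum_y (- kap y) * (f (x + y) * (f (x + y) - f x)).
  rewrite exchange_big [RHS]exchange_big /= -[LHS]sum_opp.
  apply: eq_bigr => y _; rewrite -[LHS](sum_shift _ y).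
  by apply: eq_bigr => x _; rewrite addrK kapN.
rewrite /en /ip A -mulrA; congr (_ * _).
apply: (@mulfI _ 2); rewrite ?pnatr_eq0 // mulrA divff ?pnatr_eq0 // mul1r.
rewrite mulr2n mulrDl mul1r {2}B -big_split /=; apply: eq_bigr => x _.
by rewrite -big_split /=; apply: eq_bigr => y _; ring.
Qed.

Lemma en_ge0 f : 0 <= en f.
Proof.
rewrite enE; apply: mulr_ge0; first by rewrite divr_ge0 //; exact/ltW/mesh_gt0.
apply: sumr_ge0 => x _; apply: sumr_ge0 => y _.
have [->|y0] := eqVneq y 0; first by rewrite addr0 subrr expr0n mulr0.
by rewrite mulr_ge0 ?sqr_ge0 // oppr_ge0 kap_le0.
Qed.

(** By Fourier inversion the convolution square of [kap] has symbol [symb k ^+ 2], the symbol of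
    minus the second difference. Averaging the cosines over all frequencies ([indic]) recovers the
    three Kronecker deltas. *)
Lemma kap_conv (w : G) : \sum_y kap y * kap (w + y) =
  h ^- 2 * (2 * (w == 0)%:R - (w == 1)%:R - (w == - 1)%:R).
Proof.
have indic (z : G) : N%:R^-1 * \sum_(m < N) cos (h * (m * z)%:R) = (z == 0)%:R :> R.
  have [->|z0] := eqVneq z 0.
    under eq_bigr do rewrite muln0 mulr0 cos0.
    by rewrite sumr_const card_ord mulVf // pnatr_eq0.
  have := @sum_cos_mesh R p 0 z; rewrite lt0n z0 ltn_ord => /(_ isT) H.
  rewrite -[RHS](mulr0 (N%:R^-1)); congr (_ * _); apply: etrans H.
  by apply: eq_bigr => m _; rewrite add0r mulnC.
transitivity (N%:R^-1 * \sum_(m < N) symb m ^+ 2 * cos (h * (m * w)%:R)).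
  transitivity (\sum_(y : G) \sum_(m < N) N%:R^-1 * (symb m * (kap y * cos (h * (m * w)%:R + h * (m * y)%:R)))).
    apply: eq_bigr => y _; rewrite {2}/kap mulrCA mulr_sumr mulr_sumr.
    apply: eq_bigr => m _; rewrite -[h * (m * (w + y)%R)%:R]add0r cos_meshD add0r.
    by ring.
  rewrite exchange_big /= mulr_sumr; apply: eq_bigr => m _.
  rewrite -mulr_sumr -mulr_sumr kap_symbol //; ring.
have c2 (m : 'I_N) : symb m ^+ 2 * cos (h * (m * w)%:R) =
   h ^- 2 * (2 * cos (h * (m * w)%:R) - cos (h * (m * (w - 1)%R)%:R) -
             cos (h * (m * (w + 1)%R)%:R)).
  have := @cos_meshD 0 m w 1; rewrite !add0r => ->.
  have e1 : (nat_of_ord (1 : G)) = 1%N by [].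
  have := @cos_meshD 0 m (w - 1) 1; rewrite subrK !add0r e1 muln1.
  rewrite [h * (m * w)%:R + _]addrC.
  have := @cos_meshD (h * m%:R) m (w - 1) 1; rewrite subrK e1 muln1.
  rewrite symb_sqr; set A := h * (m * (w - 1)%R)%:R; set B := h * m%:R.
  rewrite [B + A]addrC => -> ->.
  rewrite [cos (A + B)]cosD (cosD (A + B)) cosD sinD.
  rewrite -[2 / h ^+ 2]/(2 * h ^- 2).
  have := cos2Dsin2 B; set c := cos B; set s := sin B => H.
  set cA := cos A; set sA := sin A.
  have -> : (cA * c - sA * s) * c - (sA * c + cA * s) * s =
     cA * (2 * c ^+ 2 - (c ^+ 2 + s ^+ 2)) - 2 * sA * s * c by ring.
  by rewrite H; ring.
under eq_bigr do rewrite c2.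
rewrite -mulr_sumr mulrCA !sumrB -mulr_sumr; congr (_ * _).
rewrite !mulrBr [N%:R^-1 * (2 * _)]mulrCA !indic.
by rewrite subr_eq0 addr_eq0.
Qed.

(** Discrete counterpart of the fact that the Hilbert transform is an isometry on functions of mean
    zero: the square of [labs] is minus the second difference, and a summation by parts does the
    rest. It lets local differences stand for the nonlocal operator in every L^2 estimate. *)
Lemma ip_labs_labs f g : ip (labs f) (labs g) = ip (dif f) (dif g).
Proof.
have A : \sum_x labs f x * labs g x =
   \sum_x f x * \sum_w g (x + w) * (\sum_y kap y * kap (w + y)).
  transitivity (\sum_x \sum_y \sum_z f (x + y) * kap y * (kap z * g (x + z))).
    apply: eq_bigr => x _; rewrite /labs mulr_suml; apply: eq_bigr => y _.
    by rewrite mulr_sumr; apply: eq_bigr => z _; ring.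
  rewrite exchange_big /=.
  transitivity (\sum_y \sum_x \sum_w f x * (g (x + w) * (kap y * kap (w + y)))).
    apply: eq_bigr => y _; rewrite -[RHS](sum_shift _ y); apply: eq_bigr => x _.
    rewrite -(sum_shift _ y); apply: eq_bigr => z _.
    by rewrite -!addrA [y + z]addrC; ring.
  rewrite exchange_big /=; apply: eq_bigr => x _.
  rewrite exchange_big mulr_sumr /=; apply: eq_bigr => w _.
  by rewrite !mulr_sumr.
rewrite /ip A; congr (_ * _).
have -> : \sum_x f x * \sum_w g (x + w) * (\sum_y kap y * kap (w + y)) =
   \sum_x h ^- 2 * (2 * (f x * g x) - f x * g (x + 1) - f x * g (x - 1)).
  apply: eq_bigr => x _.
  transitivity (f x * (h ^- 2 * (2 * g x - g (x + 1) - g (x - 1)))); last by ring.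
  congr (_ * _).
  under eq_bigr do rewrite kap_conv mulrCA 2!(mulrBr (g _)) (mulrCA _ 2).
  rewrite -mulr_sumr; congr (_ * _); rewrite !sumrB -mulr_sumr.
  have pk (z : G) : \sum_w g (x + w) * (w == z)%:R = g (x + z).
    rewrite (bigD1 z) //= eqxx mulr1 big1 ?addr0 // => w wz.
    by rewrite (negbTE wz) mulr0.
  by rewrite !pk addr0.
transitivity (\sum_x h ^- 2 * (f (x + 1) * g (x + 1) - f (x + 1) * g x - f x * g (x + 1) + f x * g x)); last first.
  by apply: eq_bigr => x _; rewrite /dif; field; exact: mesh_neq0.
have sh : \sum_x f x * g (x - 1) = \sum_x f (x + 1) * g x.
  rewrite -[LHS](sum_shift _ 1); by under eq_bigr do rewrite addrK.
rewrite -!mulr_sumr; congr (_ * _); rewrite [RHS]big_split !sumrB /= sh.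
rewrite (sum_shift (fun x => f x * g x)) -mulr_sumr; ring.
Qed.

Lemma sum_dif f : \sum_x dif f x = 0.
Proof. by rewrite -mulr_suml sumrB (sum_shift f) subrr mul0r. Qed.

Lemma sum_labs f : \sum_x labs f x = 0.
Proof.
have := labs_sym f (fun=> 1); rewrite labs_cst /ip.
rewrite [X in _ = _ * X]big1 => [|x _]; last by rewrite mulr0.
rewrite mulr0 => /eqP; rewrite mulf_eq0 (negbTE (mesh_neq0 _)) /= => /eqP H; rewrite -[RHS]H.
by apply: eq_bigr => x _; rewrite mulr1.
Qed.

End LatticeOperators.

(** * Norms and interpolation on the lattice *)

Section LatticeInequalities.
Context {R : realType}.

(** Cauchy-Schwarz for a semidefinite form, stated on the three coefficients so that it serves both
    for [ip] and for the energy form. *)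
Lemma psd_form_le (a b c : R) : 0 <= c ->
  (forall s t, 0 <= s ^+ 2 * a + 2 * s * t * b + t ^+ 2 * c) -> b ^+ 2 <= a * c.
Proof.
move=> c0 H; have := H c (- b).
rewrite (_ : _ + _ + _ = c * (a * c - b ^+ 2)); last by ring.
have [c1|c1] := ltP 0 c; first by rewrite pmulr_rge0 // subr_ge0.
have cE : c = 0 by apply/eqP; rewrite eq_le c0 c1.
move=> _; rewrite {1}cE mulr0 le_eqVlt sqrf_eq0.
apply/orP; left; apply: contraT => b0.
(* With c = 0 the form is affine in t, and this t gives it the value -1. *)
have := H 1 (- (a + 1) / (2 * b)).
rewrite cE (_ : _ + _ + _ = - 1); last by field.
by rewrite ler0N1.
Qed.

Context {p : nat}.
Local Notation N := (p.+2).
Local Notation G := 'I_p.+2.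
Local Notation h := (@mesh R p).
Implicit Types (f g : G -> R) (x y z : G) (a b : R).

Lemma ip_sqr_le f g : ip f g ^+ 2 <= ip f f * ip g g.
Proof.
apply: psd_form_le => [|s t]; first exact: ip_ge0.
have := ip_ge0 (fun x => s * f x + t * g x).
by rewrite ip_linl !ip_linr [ip g f]ipC; congr (_ <= _); ring.
Qed.

Lemma en_form_sqr_le f g : ip f (labs g) ^+ 2 <= en f * en g.
Proof.
apply: psd_form_le => [|s t]; first exact: en_ge0.
have := en_ge0 (fun x => s * f x + t * g x).
rewrite /en labs_lin ip_linl !ip_linr -[ip g (labs f)]labs_sym [ip (labs g) f]ipC.
by rewrite -(labs_sym f g) [ip g _]ipC; congr (_ <= _); ring.
Qed.

Lemma ip_le f g : ip f g <= nrm f * nrm g.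
Proof.
apply: le_trans (ler_norm _) _.
rewrite -(ler_pXn2r (ltn0Sn 1)) ?nnegrE ?mulr_ge0 ?nrm_ge0 //.
by rewrite real_normK ?num_real // [leRHS]exprMn !nrm_sqr ip_sqr_le.
Qed.

Lemma nrm_le f M : 0 <= M -> ip f f <= M ^+ 2 -> nrm f <= M.
Proof.
by move=> M0 H; rewrite -(ler_pXn2r (ltn0Sn 1)) ?nnegrE ?nrm_ge0 // nrm_sqr.
Qed.

Lemma nrm_mul_le f g M : (forall x, `|f x| <= M) ->
  nrm (fun x => f x * g x) <= M * nrm g.
Proof.
move=> fM; have M0 : 0 <= M by apply: le_trans (fM 0).
apply: nrm_le; first by rewrite mulr_ge0 ?nrm_ge0.
rewrite exprMn nrm_sqr /ip mulrCA ler_pM2l ?mesh_gt0 // mulr_sumr.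
apply: ler_sum => x _.
rewrite (_ : f x * g x * (f x * g x) = f x ^+ 2 * (g x * g x)); last by ring.
rewrite ler_wpM2r ?sqr_ge0 // -?expr2 ?sqr_ge0 // -[f x ^+ 2]real_normK ?num_real //.
by rewrite ler_pXn2r // nnegrE.
Qed.

Lemma nrm_shift f z : nrm (fun x => f (x + z)) = nrm f.
Proof. by rewrite /nrm ip_shift. Qed.

Lemma nrmD f g : nrm (fun x => f x + g x) <= nrm f + nrm g.
Proof.
apply: nrm_le; first by rewrite addr_ge0 ?nrm_ge0.
have := ip_linl 1 1 f g (fun x => f x + g x).
under [X in ip X _]eq_fun do rewrite !mul1r.
move=> ->; have := ip_linr 1 1 f g; under eq_fun do rewrite !mul1r.
move=> H; rewrite !H [ip g f]ipC -!nrm_sqr.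
have := ip_le f g; rewrite sqrrD; lra.
Qed.

Lemma nrmZ a f : nrm (fun x => a * f x) = `|a| * nrm f.
Proof.
rewrite /nrm -sqrtr_sqr -sqrtrM ?sqr_ge0 //; congr Num.sqrt.
by rewrite /ip [RHS]mulrCA [in RHS]mulr_sumr; congr (_ * _); apply: eq_bigr => x _; ring.
Qed.

Lemma nrmN f : nrm (fun x => - f x) = nrm f.
Proof.
by have := nrmZ (-1) f; under eq_fun do rewrite mulN1r; rewrite normrN1 mul1r.
Qed.

Lemma nrmB f g : nrm (fun x => f x - g x) <= nrm f + nrm g.
Proof. by rewrite -[nrm g]nrmN nrmD. Qed.

Lemma nrm0 : nrm (fun _ : G => 0 : R) = 0.
Proof. by have := nrmZ 0 (fun=> 0); under eq_fun do rewrite mul0r; rewrite normr0 mul0r. Qed.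

Lemma nrm_sum (n : nat) (c : nat -> R) (F : nat -> G -> R) :
  nrm (fun x => \sum_(i < n) c i * F i x) <= \sum_(i < n) `|c i| * nrm (F i).
Proof.
elim: n => [|n IHn].
  by under eq_fun do rewrite big_ord0; rewrite nrm0 big_ord0.
under eq_fun do rewrite big_ord_recr.
rewrite big_ord_recr /=; apply: le_trans (nrmD _ _) _.
by rewrite nrmZ lerD2r.
Qed.

Lemma nrm_labs f : nrm (labs f) = nrm (dif f).
Proof. by rewrite /nrm ip_labs_labs. Qed.

Lemma nrm_dif_le f : nrm (dif f) <= 2 / h * nrm f.
Proof.
have -> : dif f = fun x => h^-1 * (f (x + 1) - f x).
  by apply/funext => x; rewrite mulrC.
have h0 := @mesh_gt0 R p.
rewrite nrmZ gtr0_norm ?invr_gt0 // [2 / h]mulrC -mulrA ler_pM2l ?invr_gt0 //.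
by apply: le_trans (nrmB _ _) _; rewrite nrm_shift mulr2n mulrDl mul1r.
Qed.

Lemma en_le f : en f <= nrm f * nrm (dif f).
Proof. by rewrite -nrm_labs; exact: ip_le. Qed.

Lemma en_le_sqr f : en f <= 2 / h * nrm f ^+ 2.
Proof.
apply: le_trans (en_le f) _; rewrite expr2 mulrCA.
by rewrite ler_wpM2l ?nrm_ge0 ?nrm_dif_le.
Qed.

Lemma dif_interp f : nrm (dif f) ^+ 2 <= nrm f * nrm (dif (dif f)).
Proof.
rewrite nrm_sqr -ip_labs_labs labs_sym.
by apply: le_trans (ip_le _ _) _; rewrite nrm_labs -labs_dif nrm_labs.
Qed.

Lemma en_labs f : en (labs f) = en (dif f).
Proof. by rewrite /en ip_labs_labs labs_dif. Qed.

(** H^1 lies midway between H^{1/2} and H^{3/2}: the squared norm of f' is the energy pairing of f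
    with [labs f], and Cauchy-Schwarz for that pairing applies. *)
Lemma en_interp f : (nrm (dif f) ^+ 2) ^+ 2 <= en f * en (dif f).
Proof.
rewrite nrm_sqr -ip_labs_labs labs_sym.
by apply: le_trans (en_form_sqr_le _ _) _; rewrite en_labs.
Qed.

Lemma dif_mul f g :
  dif (fun x => f x * g x) = fun x => f x * dif g x + dif f x * g (x + 1).
Proof. by apply/funext => x; rewrite /dif; field; exact: mesh_neq0. Qed.

Lemma total_variation (F : G -> R) x y :
  `|F x - F y| <= \sum_z `|F (z + 1) - F z|.
Proof.
have step (k : nat) : `|F (y + k%:R) - F y| <=
   \sum_(i < k) `|F (y + i%:R + 1) - F (y + i%:R)|.
  elim: k => [|k IHk]; first by rewrite addr0 subrr normr0 big_ord0.
  rewrite big_ord_recr /= -natr1 addrA.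
  rewrite (_ : _ - F y = (F (y + k%:R) - F y) + (F (y + k%:R + 1) - F (y + k%:R))); last by ring.
  by apply: le_trans (ler_normD _ _) _; rewrite lerD2r.
have := step (x - y : G); rewrite natr_Zp [y + _]addrC subrK => /le_trans; apply.
rewrite -(big_mkord xpredT (fun i => `|F (y + i%:R + 1) - F (y + i%:R)|)).
have lt := ltnW (ltn_ord (x - y : G)).
rewrite -[leRHS](sum_shift _ y).
rewrite [leRHS](eq_bigr (fun z : 'I_N => `|F (y + (z : nat)%:R + 1) - F (y + (z : nat)%:R)|)); last first.
  by move=> z _; rewrite natr_Zp [z + y]addrC.
rewrite -(big_mkord xpredT (fun i => `|F (y + i%:R + 1) - F (y + i%:R)|)).
by rewrite [leRHS](big_cat_nat _ lt) //= lerDl sumr_ge0.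
Qed.

(* Sobolev embedding: a mean-zero f changes sign, and [f |f|] has total
   variation at most [2 ||f|| ||f'||]. *)
Lemma agmon f x : \sum_z f z = 0 -> f x ^+ 2 <= 2 * nrm f * nrm (dif f).
Proof.
move=> f0.
have [->|fx0] := eqVneq (f x) 0.
  by rewrite expr0n /= mulr_ge0 ?mulr_ge0 ?nrm_ge0.
have [y fy] : exists y, f x * f y <= 0.
  apply/not_existsP => H.
  have H' y : 0 < f x * f y by rewrite ltNge; apply/negP => /H.
  have : 0 < \sum_y f x * f y.
    apply: (@lt_le_trans _ _ (f x * f x)) => //.
    rewrite (bigD1 x) //= lerDl sumr_ge0 // => y _; exact/ltW/H'.
  by rewrite -mulr_sumr f0 mulr0 ltxx.
pose F z := f z * `|f z|.
have A : f x ^+ 2 <= `|F x - F y|.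
  have [fx|fx] := lerP 0 (f x).
    apply: le_trans (ler_norm _); rewrite /F [`|f x|]ger0_norm //.
    have fy0 : f y <= 0 by rewrite -(pmulr_rle0 _ (_ : 0 < f x)) // lt0r fx0.
    by rewrite expr2 lerDl -mulNr mulr_ge0 // oppr_ge0.
  rewrite distrC; apply: le_trans (ler_norm _); rewrite /F [`|f x|]ltr0_norm //.
  have fy0 : 0 <= f y by rewrite -(nmulr_rle0 _ fx).
  by rewrite mulrN opprK expr2 lerDr mulr_ge0.
apply: le_trans A _; apply: le_trans (total_variation F x y) _.
have B z : `|F (z + 1) - F z| <= h * ((`|f (z + 1)| + `|f z|) * `|dif f z|).
  have -> : h * ((`|f (z + 1)| + `|f z|) * `|dif f z|) = (`|f (z + 1)| + `|f z|) * `|f (z + 1) - f z|.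
    rewrite /dif normrM normfV [`|h|]gtr0_norm ?mesh_gt0 //; field; exact: mesh_neq0.
  rewrite /F; move: (f (z + 1)) (f z) => a b.
  have -> : a * `|a| - b * `|b| = (a - b) * `|a| + b * (`|a| - `|b|) by ring.
  apply: le_trans (ler_normD _ _) _; rewrite !normrM normr_id mulrDl.
  by rewrite [`|a| * _]mulrC lerD2l ler_wpM2l // ler_dist_dist.
apply: le_trans (ler_sum _ (fun z _ => B z)) _.
rewrite -mulr_sumr.
under eq_bigr do rewrite mulrDl.
rewrite big_split mulrDr -mulrA mulr2n mulrDl mul1r.
have nn (g : G -> R) : nrm (fun x => `|g x|) = nrm g.
  rewrite /nrm /ip; congr (Num.sqrt (_ * _)); apply: eq_bigr => z _.
  by rewrite -normrM ger0_norm // -expr2 sqr_ge0.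
have H1 := ip_le (fun z => `|f (z + 1)|) (fun z => `|dif f z|).
have H2 := ip_le (fun z => `|f z|) (fun z => `|dif f z|).
rewrite (nn (fun z => f (z + 1))) nrm_shift nn in H1.
by rewrite !nn in H2; apply: lerD.
Qed.

Lemma agmon_dif f x : dif f x ^+ 2 <= 2 * nrm (dif f) * nrm (dif (dif f)).
Proof. exact/agmon/sum_dif. Qed.

Lemma agmon_labs f x : labs f x ^+ 2 <= 2 * nrm (dif f) * nrm (dif (dif f)).
Proof.
have := agmon x (sum_labs f).
by rewrite -labs_dif !nrm_labs.
Qed.

(** The translation of the second factor is the price of differences instead of derivatives; it is
    harmless because all the norms in use are translation invariant. *)
Lemma dif_iter_mul (n : nat) f g x :
  iter n dif (fun x => f x * g x) x =
  \sum_(a < n.+1) ('C(n, a))%:R * (iter a dif f x * iter (n - a) dif g (x + (a : nat)%:R)).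
Proof.
elim: n x => [|n IHn] x.
  by rewrite big_ord1 /= bin0 mul1r addr0.
have dif_sum (m : nat) (F : nat -> G -> R) : dif (fun x => \sum_(a < m) F a x) =
   fun x => \sum_(a < m) dif (F a) x.
  by apply/funext => z; rewrite /dif -sumrB mulr_suml.
rewrite iterS (funext IHn).
rewrite (dif_sum _ (fun (a : nat) x => 'C(n, a)%:R * (iter a dif f x * iter (n - a) dif g (x + a%:R)))).
have st (a : nat) : dif (fun x => 'C(n, a)%:R * (iter a dif f x * iter (n - a) dif g (x + a%:R))) x =
   'C(n, a)%:R * (iter a dif f x * iter (n - a).+1 dif g (x + a%:R)) +
   'C(n, a)%:R * (iter a.+1 dif f x * iter (n - a) dif g (x + a.+1%:R)).
  have := dif_lin 'C(n, a)%:R 0 (fun x => iter a dif f x * iter (n - a) dif g (x + a%:R)) (fun=> 0).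
  under eq_fun do rewrite mul0r addr0.
  move=> ->; rewrite mul0r addr0 dif_mul mulrDr -natr1; congr (_ * (_ * _) + _ * (_ * _)).
    by rewrite /dif /= /dif addrAC.
  by rewrite addrA addrAC.
under eq_bigr do rewrite st.
rewrite big_split /= [in RHS]big_ord_recl /= bin0.
rewrite [X in X + _]big_ord_recl /= bin0 subn0 -addrA; congr (_ + _).
rewrite [X in _ + X]big_ord_recr /= addrA [RHS]big_ord_recr /=; congr (_ + _).
  rewrite -big_split; apply: eq_bigr => i _ /=; rewrite /bump /= add1n subSS.
  have -> : iter (n - i) dif g = dif (iter (n - i.+1) dif g).
    by rewrite -iterS subnSK.
  by rewrite add0n binS natrD mulrDl.
by rewrite /bump /= add1n add0n !binn !subnn.
Qed.
End LatticeInequalities.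

(** * The scheme and its energy estimates *)

Section Scheme.
Context {R : realType} {p : nat}.
Local Notation N := (p.+2).
Local Notation G := 'I_p.+2.
Local Notation h := (@mesh R p).
Implicit Types (v f g : G -> R) (x y z : G) (a b : R).

(** The factor 16 serves twice: together with [kap0] it yields the maximum principle, and in
    [en_step] it makes the second-order error of an Euler step at most tau (l + q)^2 / 8, small
    against the dissipation. *)
Definition time_step : R := h / 16.
Local Notation tau := time_step.
(** Substituting U = 1 + v into U |D| U - |D|(U^2) leaves - |D| v + v |D| v - |D|(v^2), since |D|
    kills constants; [quad] is the part of degree two. *)
Definition quad v : G -> R := fun x => v x * labs v x - labs (fun y => v y * v y) x.
Definition rhs v : G -> R := fun x => - labs v x + quad v x.
Definition step v : G -> R := fun x => v x + tau * rhs v x.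

Lemma tau_gt0 : 0 < tau.
Proof. by rewrite /time_step divr_gt0 ?mesh_gt0. Qed.

Lemma rhsE v x :
  rhs v x = \sum_y (- kap y) * ((1 + v (x + y)) * (v (x + y) - v x)).
Proof.
rewrite /rhs /quad !labsE -sumrN mulr_sumr -sumrB -big_split.
by apply: eq_bigr => y _ /=; ring.
Qed.

(* As [v >= -1], the size of [time_step] makes [step v x] a convex combination of
   values of [v]. *)
Lemma step_max v e : e <= 1 -> (forall x, `|v x| <= e) -> forall x, `|step v x| <= e.
Proof.
move=> e1 ve x; rewrite /step rhsE.
rewrite (bigD1 0) //= addr0 subrr !mulr0 add0r.
pose c y := tau * (- kap y * (1 + v (x + y))).
have v01 y : 0 <= 1 + v (x + y) <= 2.
  by have := ve (x + y); rewrite ler_norml; lra.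
have c0 y : y != 0 -> 0 <= c y.
  move=> y0; rewrite /c mulr_ge0 ?(ltW tau_gt0) // mulr_ge0 ?oppr_ge0 ?kap_le0 //.
  by case/andP: (v01 y).
have csum : \sum_(y | y != 0) c y <= 1.
  rewrite /c -mulr_sumr.
  apply: (@le_trans _ _ (tau * \sum_(y : G | y != 0) (- kap y * 2))).
    rewrite ler_pM2l ?tau_gt0 //; apply: ler_sum => y y0.
    by apply: ler_wpM2l; [rewrite oppr_ge0 kap_le0|case/andP: (v01 y)].
  rewrite -mulr_suml sumrN.
  have -> : - (\sum_(y : G | y != 0) kap y) = @kap R p 0.
    by have := @kap_sum0 R p; rewrite (bigD1 0) //= => /eqP; rewrite addr_eq0 => /eqP ->.
  rewrite /time_step; have := @kap0 R p; have := @mesh_gt0 R p => h0.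
  rewrite ler_pdivlMr // => H; nra.
have -> : v x + tau * \sum_(y | y != 0) (- kap y * ((1 + v (x + y)) * (v (x + y) - v x))) =
   (1 - \sum_(y | y != 0) c y) * v x + \sum_(y | y != 0) c y * v (x + y).
  rewrite mulrBl mul1r -addrA; congr (_ + _); rewrite mulr_suml -sumrN -big_split mulr_sumr.
  by apply: eq_bigr => y _; rewrite /c /=; ring.
apply: le_trans (ler_normD _ _) _; rewrite normrM ger0_norm ?subr_ge0 //.
have : `|\sum_(y | y != 0) c y * v (x + y)| <= \sum_(y | y != 0) c y * e.
  apply: le_trans (ler_norm_sum _ _ _) _; apply: ler_sum => y y0.
  by rewrite normrM ger0_norm ?c0 // ler_wpM2l ?c0.
rewrite -mulr_suml; have := ve x; move: (\sum_(y | y != 0) c y) csum => C C1.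
move=> vx H; have : (1 - C) * `|v x| <= (1 - C) * e by rewrite ler_wpM2l ?subr_ge0.
lra.
Qed.

Lemma iter_dif_lin n a b f g :
  iter n dif (fun x => a * f x + b * g x) =
  fun x => a * iter n dif f x + b * iter n dif g x.
Proof. by elim: n => //= n ->; rewrite dif_lin. Qed.

(** With l the norm of order n+1 and q that of the differenced [quad], the expansion of the energy
    gives - 2 l^2, a cross term at most l^2 / 2 + 2 q^2 and a second-order term at most (l^2 + q^2)
    / 4: hence 5/4 and 9/4. The inverse inequality [en_le_sqr] pays for the second-order term with
    one power of the mesh. *)
Lemma en_step n v :
  en (iter n dif (step v)) <= en (iter n dif v)
  - tau * (5/4 * nrm (iter n.+1 dif v) ^+ 2 - 9/4 * nrm (iter n dif (quad v)) ^+ 2).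
Proof.
set w := iter n dif v; set W := iter n dif (quad v).
pose g x := -1 * labs w x + 1 * W x.
have stepE : iter n dif (step v) = fun x => 1 * w x + tau * g x.
  have -> : step v = fun x => 1 * v x + tau * (-1 * labs v x + 1 * quad v x).
    by apply/funext => x; rewrite /step /rhs; ring.
  by rewrite !iter_dif_lin -labs_iter_dif.
set l := nrm (iter n.+1 dif v); set q := nrm W.
have lE : nrm (labs w) = l by rewrite nrm_labs.
have enE' : en (fun x => 1 * w x + tau * g x) =
   en w + 2 * tau * (- l ^+ 2 + ip (labs w) W) + tau ^+ 2 * en g.
  rewrite {1}/en labs_lin ip_linl !ip_linr -/(en w) -/(en g).
  rewrite -(labs_sym w g) -[ip g (labs w)]ipC.
  have -> : ip (labs w) g = - l ^+ 2 + ip (labs w) W.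
    by rewrite /g ip_linr -lE nrm_sqr; ring.
  by ring.
rewrite stepE enE'.
have H1 : ip (labs w) W <= l * q by rewrite -lE ip_le.
have ng : nrm g <= l + q.
  have -> : g = fun x => W x - labs w x by apply/funext => x; rewrite /g; ring.
  by apply: le_trans (nrmB _ _) _; rewrite lE addrC.
have l0 : 0 <= l by exact: nrm_ge0.
have q0 : 0 <= q by exact: nrm_ge0.
have H2 : tau ^+ 2 * en g <= tau * (4^-1 * (l ^+ 2 + q ^+ 2)).
  rewrite expr2 -mulrA ler_pM2l ?tau_gt0 //.
  apply: (@le_trans _ _ (tau * (2 / h * (l + q) ^+ 2))).
    rewrite ler_pM2l ?tau_gt0 //; apply: le_trans (en_le_sqr g) _.
    rewrite ler_wpM2l ?two_mesh_ge0 //.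
    by rewrite ler_pXn2r ?nnegrE ?addr_ge0 ?nrm_ge0.
  have -> : tau * (2 / h * (l + q) ^+ 2) = 8^-1 * (l + q) ^+ 2.
    by rewrite /time_step; field; exact: mesh_neq0.
  by have := sqr_ge0 (l - q); nra.
have H3 : 2 * l * q <= 2^-1 * l ^+ 2 + 2 * q ^+ 2.
  by have := sqr_ge0 (l - 2 * q); nra.
have t0 := tau_gt0.
have H4 : tau * (2 * ip (labs w) W) <= tau * (2^-1 * l ^+ 2 + 2 * q ^+ 2).
  by rewrite ler_pM2l //; lra.
lra.
Qed.

(** The bound that [agmon] gives for the sup norm of the j-th difference, j >= 1. The same number
    bounds [labs] of the difference of order j - 1, so that the local and nonlocal factors of [quad]
    are treated alike. *)
Definition supn v j : R := Num.sqrt (2 * nrm (iter j dif v) * nrm (iter j.+1 dif v)).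

Lemma supn_ge0 v j : 0 <= supn v j. Proof. exact: sqrtr_ge0. Qed.

Lemma supn_sqr v j : supn v j ^+ 2 = 2 * nrm (iter j dif v) * nrm (iter j.+1 dif v).
Proof. by rewrite sqr_sqrtr // !mulr_ge0 ?nrm_ge0. Qed.

Lemma le_supn v j r : r ^+ 2 <= 2 * nrm (iter j dif v) * nrm (iter j.+1 dif v) ->
  `|r| <= supn v j.
Proof.
move=> H; rewrite -(ler_pXn2r (ltn0Sn 1)) ?nnegrE ?supn_ge0 //.
by rewrite real_normK ?num_real // supn_sqr.
Qed.

Lemma dif_le_supn v j x : `|iter j.+1 dif v x| <= supn v j.+1.
Proof. by apply: le_supn; exact: agmon_dif. Qed.

Lemma labs_le_supn v j x : `|labs (iter j dif v) x| <= supn v j.+1.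
Proof. by apply: le_supn; exact: agmon_labs. Qed.

(** Sums of the binomial coefficients in the expansions of the two halves of [quad]; the second has
    order n+1 because its outer [labs] is traded for one more difference. *)
Definition leibniz_cst (n : nat) : R :=
  \sum_(a < n.+1) 'C(n, a)%:R + \sum_(a < n.+2) 'C(n.+1, a)%:R.

Lemma leibniz_cst_ge0 n : 0 <= leibniz_cst n.
Proof. by rewrite addr_ge0 // sumr_ge0. Qed.

(** In the Leibniz expansions three terms put all n+1 derivatives on one factor: one from v |D| v,
    two from |D|(v^2). They cost the sup bound e each and will be absorbed. Every other term splits
    the order as a + (n+1-a) with both parts positive, and the disjunction leaves free which factor
    is measured in sup norm. *)
Lemma quad_le (n : nat) v (e X : R) : (forall x, `|v x| <= e) -> 0 <= X ->
  (forall a : nat, (1 <= a <= n)%N ->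
     supn v a * nrm (iter (n.+1 - a) dif v) <= X \/
     nrm (iter a dif v) * supn v (n.+1 - a) <= X) ->
  nrm (iter n dif (quad v)) <= 3 * e * nrm (iter n.+1 dif v) + leibniz_cst n * X.
Proof.
move=> ve X0 XH; set l := nrm (iter n.+1 dif v).
have prod_le (a : nat) (f g : G -> R) : (1 <= a <= n)%N ->
    (forall x, `|f x| <= supn v a) -> nrm f <= nrm (iter a dif v) ->
    (forall x, `|g x| <= supn v (n.+1 - a)) -> nrm g <= nrm (iter (n.+1 - a) dif v) ->
    nrm (fun x => f x * g (x + a%:R)) <= X.
  move=> an f1 f2 g1 g2; case: (XH a an) => H; apply: le_trans H.
    apply: le_trans (nrm_mul_le _ f1) _.
    by rewrite nrm_shift ler_wpM2l ?supn_ge0.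
  rewrite (_ : (fun x => _) = fun x => g (x + a%:R) * f x); last first.
    by apply/funext => x; rewrite mulrC.
  apply: le_trans (nrm_mul_le _ (fun x => g1 (x + a%:R))) _.
  by rewrite mulrC ler_wpM2r ?supn_ge0.
have vsup (a : nat) x : (1 <= a)%N -> `|iter a dif v x| <= supn v a.
  by case: a => // a _; exact: dif_le_supn.
have A : nrm (iter n dif (fun x => v x * labs v x)) <=
    e * l + (\sum_(a < n.+1) 'C(n, a)%:R) * X.
  rewrite (funext (dif_iter_mul n v (labs v))).
  apply: le_trans (nrm_sum n.+1 (fun a : nat => 'C(n, a)%:R)
    (fun (a : nat) x => iter a dif v x * iter (n - a) dif (labs v) (x + a%:R))) _.
  rewrite !big_ord_recl /= bin0 normr1 mul1r subn0.
  apply: (@le_trans _ _ (e * l + \sum_(i < n) ('C(n, bump 0 i)%:R * X))); last first.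
    by rewrite lerD2l -mulr_suml mulrDl mul1r lerDr.
  apply: lerD.
    apply: le_trans (nrm_mul_le _ ve) _.
    by rewrite nrm_shift -labs_iter_dif nrm_labs.
  apply: ler_sum => i _; rewrite /bump /= add1n normr_nat ler_wpM2l //.
  apply: (prod_le i.+1 (iter i.+1 dif v) (iter (n - i.+1) dif (labs v))) => //.
  - by rewrite ltn_ord.
  - by move=> x; exact: vsup.
  - move=> x; rewrite -labs_iter_dif subSS.
    by have := labs_le_supn v (n - i.+1) x; rewrite subnSK.
  - by rewrite -labs_iter_dif nrm_labs -iterS subSS subnSK.
have B : nrm (iter n dif (labs (fun x => v x * v x))) <=
    2 * (e * l) + (\sum_(a < n.+2) 'C(n.+1, a)%:R) * X.
  rewrite -labs_iter_dif nrm_labs -iterS.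
  rewrite (funext (dif_iter_mul n.+1 v v)).
  apply: le_trans (nrm_sum n.+2 (fun a : nat => 'C(n.+1, a)%:R)
    (fun (a : nat) x => iter a dif v x * iter (n.+1 - a) dif v (x + a%:R))) _.
  rewrite big_ord_recr big_ord_recl /= bin0 normr1 mul1r binn subnn normr1 mul1r.
  apply: (@le_trans _ _ (e * l + \sum_(i < n) ('C(n.+1, bump 0 i)%:R * X) + e * l)); last first.
    rewrite [in leRHS]big_ord_recr [in leRHS]big_ord_recl /= bin0 binn.
    by rewrite -mulr_suml !mulrDl !mul1r; lra.
  apply: lerD; first apply: lerD.
  - by apply: le_trans (nrm_mul_le _ ve) _; rewrite nrm_shift.
  - apply: ler_sum => i _; rewrite /bump /= add1n normr_nat ler_wpM2l //.
    apply: (prod_le i.+1 (iter i.+1 dif v) (iter (n.+1 - i.+1) dif v)) => //.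
    + by rewrite ltn_ord.
    + by move=> x; exact: vsup.
    + by move=> x; apply: vsup; rewrite subSS subn_gt0.
  - rewrite (_ : (fun x => _) = fun x => v (x + n.+1%:R) * iter n.+1 dif v x); last first.
      by apply/funext => x; rewrite mulrC.
    exact: (nrm_mul_le _ (fun x => ve (x + n.+1%:R))).
have -> : iter n dif (quad v) =
   fun x => iter n dif (fun x => v x * labs v x) x - iter n dif (labs (fun x => v x * v x)) x.
  have -> : quad v = fun x => 1 * (v x * labs v x) + (-1) * labs (fun x => v x * v x) x.
    by apply/funext => x; rewrite /quad; ring.
  by rewrite iter_dif_lin; apply/funext => x; ring.
apply: le_trans (nrmB _ _) _; rewrite /leibniz_cst.
by rewrite mulrDl; lra.
Qed.

End Scheme.

Ltac nneg := repeat first [ lazymatch goal with |- is_true (0 <= _%:R) => exact: ler0n end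
  | assumption | by apply: ltW | exact: ler0n | exact: ler01
  | exact: nrm_ge0 | exact: sqr_ge0 | apply: exprn_ge0 | apply: addr_ge0
  | apply: mulr_ge0 | rewrite invr_ge0 ].

(** * Energy decay and first-order smoothing along trajectories *)

Section Trajectory.
Context {R : realType}.

Lemma discrete_gronwall (y a b : nat -> R) :
  (forall m, 0 <= a m) -> (forall m, 0 <= b m) -> 0 <= y 0%N ->
  (forall m, y m.+1 <= (1 + a m) * y m + b m) ->
  forall m, y m <= expR (\sum_(i < m) a i) * (y 0%N + \sum_(i < m) b i).
Proof.
move=> a0 b0 y0 H; elim=> [|m IHm]; first by rewrite !big_ord0 expR0 mul1r addr0.
apply: le_trans (H m) _; rewrite !big_ord_recr /= expRD.
set S := expR _ in IHm *; set B := _ + _ in IHm.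
have B0 : 0 <= B by rewrite addr_ge0 // sumr_ge0.
have S1 : 1 <= S by rewrite -expR0 ler_expR sumr_ge0.
have ea : 1 + a m <= expR (a m) by exact: expR_ge1Dx.
have e1 : 1 <= expR (a m) by rewrite -expR0 ler_expR.
rewrite addrA -/B mulrDr; apply: lerD.
  apply: (@le_trans _ _ ((1 + a m) * (S * B))).
    by rewrite ler_wpM2l // addr_ge0.
  rewrite (_ : S * expR (a m) * B = expR (a m) * (S * B)); last by ring.
  by rewrite ler_wpM2r // mulr_ge0 // (le_trans ler01).
by rewrite ler_peMl // mulr_ege1.
Qed.

(** The hypothesis makes z grow at most like the square root of l, so z^3 is of order l^{3/2} and
    can be absorbed by l^2. In use, l is the norm that is dissipated and z collects the norms below
    it. *)
Lemma young_cube (c B : R) : 0 <= c -> exists C, 0 <= C /\ forall z l : R, 0 <= z -> 0 <= l ->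
  z ^+ 2 <= 2 * B ^+ 2 + 2 * B * l -> c * z ^+ 3 <= l ^+ 2 / 4 + C.
Proof.
move=> c0.
(* In z^3 <= eta z^4 + eta^-3, this eta makes the resulting coefficient 8 c eta B^2 of l^2 at most
   1/4. *)
pose eta := (32 * (c + 1) * (B ^+ 2 + 1))^-1.
have B1 : 0 < B ^+ 2 + 1 by rewrite ltr_wpDl ?sqr_ge0.
have c1 : 0 < c + 1 by rewrite ltr_wpDl.
have eta0 : 0 < eta by rewrite invr_gt0 !mulr_gt0.
exists (c * eta^-1 ^+ 3 + c * eta * (8 * B ^+ 4)); split.
  have -> : B ^+ 4 = (B ^+ 2) ^+ 2 by ring.
  by nneg.
move=> z l z0 l0 H.
have z3 : z ^+ 3 <= eta * z ^+ 4 + eta^-1 ^+ 3.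
  have [h1|h1] := leP 1 (eta * z).
    apply: (@le_trans _ _ (eta * z ^+ 4)); last by rewrite lerDl; nneg.
    by rewrite [z ^+ 4]exprS mulrA ler_peMl ?exprn_ge0.
  apply: (@le_trans _ _ (eta^-1 ^+ 3)); last by rewrite lerDr; nneg.
  have ze : z <= eta^-1.
    by apply/ltW; rewrite -[X in _ < X]mul1r ltr_pdivlMr // mulrC.
  by apply: lerXn2r; rewrite ?nnegrE //; nneg.
have z4 : z ^+ 4 <= 8 * B ^+ 4 + 8 * B ^+ 2 * l ^+ 2.
  have zz : (z ^+ 2) ^+ 2 <= (2 * B ^+ 2 + 2 * B * l) ^+ 2.
    rewrite ler_pXn2r ?nnegrE ?sqr_ge0 //; exact: le_trans (sqr_ge0 z) H.
  have e4 : z ^+ 4 = (z ^+ 2) ^+ 2 by ring.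
  rewrite e4; apply: le_trans zz _.
  by have := sqr_ge0 (B ^+ 2 - B * l); nra.
have ceB : c * eta * (8 * B ^+ 2) <= 4^-1.
  have -> : c * eta * (8 * B ^+ 2) = 8 * (c * B ^+ 2) * eta by ring.
  rewrite /eta ler_pdivrMr ?mulr_gt0 //; have := sqr_ge0 B; nra.
apply: (@le_trans _ _ (c * (eta * (8 * B ^+ 4 + 8 * B ^+ 2 * l ^+ 2) + eta^-1 ^+ 3))).
  rewrite ler_wpM2l //; apply: le_trans z3 _.
  by rewrite lerD2r ler_pM2l.
have := ler_wpM2r (sqr_ge0 l) ceB; lra.
Qed.

Context {p : nat}.
Local Notation G := 'I_p.+2.
Local Notation h := (@mesh R p).
Local Notation tau := (@time_step R p).
Variables (v : nat -> G -> R) (A : R).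
Hypothesis vS : forall m, v m.+1 = step (v m).
Hypothesis v0 : forall x, `|v 0%N x| <= 1 / 100.
Hypothesis enA : en (v 0%N) <= A.

Local Notation NN j m := (nrm (iter j dif (v m))).
Local Notation E j m := (en (iter j dif (v m))).

Lemma traj_max m x : `|v m x| <= 1 / 100.
Proof.
elim: m x => [|m IHm] x; first exact: v0.
by rewrite vS; apply: step_max => //; lra.
Qed.

(** At order 0 the expansion of [quad] has no intermediate terms, so the smallness of v suffices:
    5/4 - 9/4 (3/100)^2 >= 1. *)
Lemma en0_step m : E 0 m.+1 <= E 0 m - tau * NN 1 m ^+ 2.
Proof.
have t0 := @tau_gt0 R p.
rewrite vS; apply: le_trans (en_step 0 (v m)) _.
have q : nrm (iter 0 dif (quad (v m))) <= 3 * (1/100) * NN 1 m + leibniz_cst 0 * 0.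
  by apply: quad_le => // [x|[|a]]; first exact: traj_max.
rewrite mulr0 addr0 in q.
have q2 : nrm (iter 0 dif (quad (v m))) ^+ 2 <= (3 * (1/100) * NN 1 m) ^+ 2.
  by rewrite ler_pXn2r ?nnegrE ?mulr_ge0 ?nrm_ge0.
rewrite lerD2l lerN2 ler_pM2l //.
have := sqr_ge0 (NN 1 m); rewrite exprMn in q2; lra.
Qed.

Lemma dissipation m : E 0 m + \sum_(i < m) tau * NN 1 i ^+ 2 <= A.
Proof.
elim: m => [|m IHm]; first by rewrite big_ord0 addr0.
by apply: le_trans IHm; rewrite big_ord_recr /=; have := en0_step m; lra.
Qed.

Lemma en0_le m : E 0 m <= A.
Proof.
apply: le_trans (dissipation m); rewrite lerDl sumr_ge0 // => i _.
by rewrite mulr_ge0 ?sqr_ge0 ?(ltW (@tau_gt0 R p)).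
Qed.

Lemma dissipation_sum m : \sum_(i < m) tau * NN 1 i ^+ 2 <= A.
Proof. by apply: le_trans (dissipation m); rewrite lerDr en_ge0. Qed.

Lemma energy_cst_ge0 : 0 <= A.
Proof. exact: le_trans (en_ge0 _) enA. Qed.

Lemma rhs_nrm m : nrm (rhs (v m)) <= 2 * NN 1 m.
Proof.
have q : nrm (iter 0 dif (quad (v m))) <= 3 * (1/100) * NN 1 m + leibniz_cst 0 * 0.
  by apply: quad_le => // [x|[|a]]; first exact: traj_max.
rewrite mulr0 addr0 in q.
rewrite /rhs; apply: le_trans (nrmD _ _) _; rewrite nrmN nrm_labs.
have := nrm_ge0 (dif (v m)); rewrite /= in q *; lra.
Qed.

(** One step moves v by at most 2 tau ||v'|| in L^2, and the squares of ||v'|| are summable in time: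
    Cauchy-Schwarz in time gives a drift of order the square root of the elapsed time, uniformly in
    the mesh. *)
Lemma traj_l2_drift m :
  nrm (fun x => v m x - v 0%N x) ^+ 2 <= 4 * A * (m%:R * tau).
Proof.
have t0 := @tau_gt0 R p.
have A1 : nrm (fun x => v m x - v 0%N x) <= \sum_(i < m) tau * (2 * NN 1 i).
  elim: m => [|m IHm].
    by under eq_fun do rewrite subrr; rewrite nrm0 big_ord0.
  rewrite big_ord_recr vS /step /=.
  rewrite (_ : (fun x => _) = fun x => (v m x - v 0%N x) + tau * rhs (v m) x); last first.
    by apply/funext => x; ring.
  apply: le_trans (nrmD _ _) _; apply: lerD => //.
  by rewrite nrmZ gtr0_norm // ler_pM2l // rhs_nrm.
(* Cauchy-Schwarz for the sum over time steps, by induction on their number. *)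
have A2 : (\sum_(i < m) tau * (2 * NN 1 i)) ^+ 2 <=
   4 * (m%:R * tau) * \sum_(i < m) tau * NN 1 i ^+ 2.
  elim: m {A1} => [|m IHm]; first by rewrite !big_ord0 mulr0 expr0n.
  rewrite !big_ord_recr /= -natr1.
  set S := \sum_(i < m) _ in IHm *; set Q := \sum_(i < m) _ in IHm *.
  set n := nrm _; set M := m%:R in IHm *.
  have M0 : 0 <= M by exact: ler0n.
  have Q0 : 0 <= Q by apply: sumr_ge0 => i _; rewrite mulr_ge0 ?sqr_ge0 ?ltW.
  have n0 : 0 <= n by exact: nrm_ge0.
  have S0 : 0 <= S by apply: sumr_ge0 => i _; nneg.
  have key : S * n <= M * (tau * n ^+ 2) + Q.
    rewrite -(ler_pXn2r (ltn0Sn 1)) ?nnegrE; [|nneg|nneg].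
    rewrite exprMn.
    have := ler_wpM2r (sqr_ge0 n) IHm.
    by have := sqr_ge0 (M * (tau * n ^+ 2) - Q); nra.
  have := ler_wpM2l (ltW t0) key; rewrite sqrrD; nra.
have A3 := dissipation_sum m.
apply: (@le_trans _ _ ((\sum_(i < m) tau * (2 * NN 1 i)) ^+ 2)).
  rewrite ler_pXn2r ?nnegrE ?nrm_ge0 //; apply: sumr_ge0 => i _; nneg.
apply: le_trans A2 _.
rewrite (_ : 4 * A * (m%:R * tau) = 4 * (m%:R * tau) * A); last by ring.
by rewrite ler_wpM2l //; nneg.
Qed.

(** 41 rounds up 81/2, the constant of Young's inequality for 9 (c^2 n^3) l against l^2 / 2 in
    [en1_step]. *)
Let kappa := 41 * @leibniz_cst R 1 ^+ 4 * A.

(** The only intermediate term has square 2 n^3 l, where n and l are the norms of v' and v''. Young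
    leaves n^6 = n^2 (n^2)^2, and [en_interp] turns (n^2)^2 into A times the energy of v'. The
    growth rate is thus a multiple of n^2, which is summable in time by dissipation, so Gronwall
    applies. *)
Lemma en1_step m :
  E 1 m.+1 <= (1 + tau * (kappa * NN 1 m ^+ 2)) * E 1 m - tau * (NN 2 m ^+ 2 / 2).
Proof.
have t0 := @tau_gt0 R p.
rewrite vS; apply: le_trans (en_step 1 (v m)) _.
set l := NN 2 m; set n := NN 1 m; set c := @leibniz_cst R 1.
have n0 : 0 <= n by exact: nrm_ge0.
have l0 : 0 <= l by exact: nrm_ge0.
have c0 : 0 <= c by exact: leibniz_cst_ge0.
set X := n * supn (v m) 1.
have X0 : 0 <= X by rewrite mulr_ge0 ?supn_ge0.
have X2 : X ^+ 2 = 2 * n ^+ 3 * l by rewrite exprMn supn_sqr -/n -/l; ring.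
have q : nrm (iter 1 dif (quad (v m))) <= 3 * (1/100) * l + c * X.
  apply: quad_le => // [x|a]; first exact: traj_max.
  by case: a => [|[|a]] //= _; right.
set Q := nrm _ in q *.
have Q0 : 0 <= Q by exact: nrm_ge0.
have q2 : Q ^+ 2 <= (3 * (1/100) * l + c * X) ^+ 2.
  by rewrite ler_pXn2r ?nnegrE //; nneg.
have q3 : Q ^+ 2 <= 18/10000 * l ^+ 2 + 2 * c ^+ 2 * X ^+ 2.
  apply: le_trans q2 _; have := sqr_ge0 (3 * (1/100) * l - c * X); nra.
rewrite X2 in q3.
have q4 : 9 * (c ^+ 2 * n ^+ 3) * l <= l ^+ 2 / 2 + 41 * c ^+ 4 * n ^+ 6.
  have := sqr_ge0 (l - 9 * (c ^+ 2 * n ^+ 3)).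
    have := sqr_ge0 (c ^+ 2 * n ^+ 3).
  have -> : 41 * c ^+ 4 * n ^+ 6 = 41 * (c ^+ 2 * n ^+ 3) ^+ 2 by ring.
  nra.
have n6 : n ^+ 6 <= n ^+ 2 * (A * E 1 m).
  have -> : n ^+ 6 = n ^+ 2 * (n ^+ 2) ^+ 2 by ring.
  rewrite ler_wpM2l ?sqr_ge0 //; apply: le_trans (en_interp (v m)) _.
  by rewrite ler_wpM2r ?en_ge0 ?en0_le.
have q5 : 41 * c ^+ 4 * n ^+ 6 <= kappa * n ^+ 2 * E 1 m.
  have -> : kappa * n ^+ 2 * E 1 m = 41 * c ^+ 4 * (n ^+ 2 * (A * E 1 m)).
    by rewrite /kappa -/c; ring.
  by rewrite ler_wpM2l // mulr_ge0 ?exprn_ge0.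
have q6 : 9/4 * Q ^+ 2 <= 3/4 * l ^+ 2 + kappa * n ^+ 2 * E 1 m.
  have := sqr_ge0 l; lra.
have := ler_wpM2l (ltW t0) q6; lra.
Qed.

(** The weight t^2 removes the unknown initial value. Its increment costs about 2 t ||v'|| ||v''||,
    which the dissipated t^2 ||v''||^2 / 2 absorbs up to a multiple of ||v'||^2, again summable in
    time. *)
Lemma en1_smoothing m :
  (m%:R * tau) ^+ 2 * E 1 m <= expR (kappa * A) * (2 * (1 + kappa * A) ^+ 2 * A).
Proof.
have t0 := @tau_gt0 R p; have A0 := energy_cst_ge0.
have k0 : 0 <= kappa by rewrite /kappa !mulr_ge0 ?exprn_ge0 ?leibniz_cst_ge0.
(* K bounds each single Gronwall factor, because one term of the dissipation sum is at most the
   whole sum. *)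
set K := 1 + kappa * A.
have K1 : 1 <= K by rewrite lerDl mulr_ge0.
pose a m := tau * (kappa * NN 1 m ^+ 2).
pose b m := 2 * K ^+ 2 * (tau * NN 1 m ^+ 2).
pose y m := (m%:R * tau) ^+ 2 * E 1 m.
have a0 i : 0 <= a i by rewrite /a; nneg.
have K0 : 0 <= K by apply: le_trans K1.
have b0 i : 0 <= b i by rewrite /b; nneg.
have y0 : y 0%N = 0 by rewrite /y mul0r expr0n mul0r.
have aK i : 1 + a i <= K.
  rewrite lerD2l /a mulrCA ler_wpM2l //.
  apply: le_trans (dissipation_sum i.+1); rewrite big_ord_recr lerDr sumr_ge0 // => j _.
  nneg.
have H i : y i.+1 <= (1 + a i) * y i + b i.
  have := en1_step i; rewrite -/(a i) /y => HE.
  have en1 : E 1 i <= NN 1 i * NN 2 i by exact: en_le.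
  have aiK := aK i; have ai0 := a0 i; have e0 := en_ge0 (iter 1 dif (v i)).
  move: HE en1 e0; rewrite /b; set e := E 1 i; set e' := E 1 i.+1.
  set n1 := NN 1 i; set n2 := NN 2 i => HE en1 e0.
  set t := i%:R * tau; have -> : i.+1%:R * tau = t + tau by rewrite -natr1 mulrDl mul1r.
  set s := t + tau.
  have t00 : 0 <= t by rewrite /t; nneg.
  have s0 : 0 <= s by rewrite addr_ge0 // ltW.
  apply: (@le_trans _ _ (s ^+ 2 * ((1 + a i) * e - tau * (n2 ^+ 2 / 2)))).
    by rewrite ler_wpM2l ?sqr_ge0.
  have n20 : 0 <= n2 by exact: nrm_ge0.
  have n10 : 0 <= n1 by exact: nrm_ge0.
  have s2 : s ^+ 2 <= t ^+ 2 + 2 * s * tau.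
    by rewrite /s; have := mulr_ge0 t00 (ltW t0); have := sqr_ge0 tau; nra.
  have st1 : (1 + a i) * e * s ^+ 2 <= (1 + a i) * (t ^+ 2 * e) + K * (n1 * n2) * (2 * s * tau).
    apply: (@le_trans _ _ ((1 + a i) * e * (t ^+ 2 + 2 * s * tau))).
      by rewrite ler_wpM2l //; nneg.
    rewrite mulrDr; apply: lerD; first by rewrite -mulrA [e * _]mulrC.
    by apply: ler_wpM2r; [nneg|apply: ler_pM => //; nneg].
  have st2 : K * (n1 * n2) * (2 * s) <= s ^+ 2 * (n2 ^+ 2 / 2) + 2 * K ^+ 2 * n1 ^+ 2.
    by have := sqr_ge0 (s * n2 - 2 * K * n1); nra.
  have := ler_wpM2r (ltW t0) st2; lra.
have := discrete_gronwall a0 b0 _ H m; rewrite y0 lexx add0r => /(_ isT) /le_trans; apply.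
have asum : \sum_(i < m) a i <= kappa * A.
  rewrite /a; under eq_bigr do rewrite mulrCA.
  by rewrite -mulr_sumr ler_wpM2l ?dissipation_sum.
have bsum : \sum_(i < m) b i <= 2 * K ^+ 2 * A.
  by rewrite -mulr_sumr ler_wpM2l ?dissipation_sum //; nneg.
rewrite ler_pM ?expR_ge0 ?ler_expR //; exact: sumr_ge0.
Qed.

End Trajectory.

(** * Higher-order smoothing, uniform in the mesh *)

Section Smoothing.
Context {R : realType}.
Local Notation tau p := (@time_step R p).
Local Notation NN n w := (nrm (iter n dif w)).

(** Each intermediate product has total order n+2, so its lower factor has order at most n (as n >=
    1) and one of its norms is bounded by B. With Z = B plus the norm of order n+1, these products
    are at most X, where X^2 = 2 B Z^3, and interpolation makes Z^2 linear in the dissipated norm: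
    [young_cube] absorbs them. *)
Lemma high_energy_step (n : nat) (B : R) : (1 <= n)%N -> 0 <= B ->
  exists C, 0 <= C /\ forall p (w : 'I_p.+2 -> R),
    (forall x, `|w x| <= 1 / 100) ->
    (forall j, (1 <= j <= n)%N -> NN j w <= B) ->
    en (iter n.+1 dif (step w)) <=
    en (iter n.+1 dif w) - tau p * (NN n.+2 w ^+ 2 / 2 - C).
Proof.
move=> n1 B0.
have idx a : (1 <= a <= n.+1)%N -> (a <= n.+2 - a)%N ->
    (1 <= a <= n)%N && (1 <= n.+2 - a <= n.+1)%N by lia.
have idx' a : (1 <= a <= n.+1)%N -> (n.+2 - a < a)%N ->
    (1 <= n.+2 - a <= n)%N && (1 <= a <= n.+1)%N by lia.
set c := @leibniz_cst R n.+1.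
have c0 : 0 <= c by exact: leibniz_cst_ge0.
have [|C [C0 HC]] := @young_cube R (9 * c ^+ 2 * B) B; first by nneg.
exists C; split=> // p w wmax wB.
have t0 := @tau_gt0 R p.
apply: le_trans (en_step n.+1 w) _.
set l := NN n.+2 w; set Z := B + NN n.+1 w.
have l0 : 0 <= l by exact: nrm_ge0.
have Nn0 : 0 <= NN n.+1 w by exact: nrm_ge0.
have Z0 : 0 <= Z by rewrite /Z; nneg.
have Z2 : Z ^+ 2 <= 2 * B ^+ 2 + 2 * B * l.
  have H1 : NN n.+1 w ^+ 2 <= B * l.
    apply: le_trans (dif_interp (iter n dif w)) _.
    by rewrite ler_wpM2r // wB // n1 leqnn.
  by have := sqr_ge0 (B - NN n.+1 w); rewrite /Z; nra.
have wZ j : (1 <= j <= n.+1)%N -> NN j w <= Z.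
  case/andP=> j1; rewrite leq_eqVlt => /orP[/eqP ->|jn].
    by rewrite /Z lerDr.
  by apply: (@le_trans _ _ B); [apply: wB; rewrite j1|rewrite /Z lerDl].
set X := Num.sqrt (2 * B * Z ^+ 3).
have X0 : 0 <= X by exact: sqrtr_ge0.
have X2 : X ^+ 2 = 2 * B * Z ^+ 3 by rewrite sqr_sqrtr //; nneg.
have XM a b : (1 <= a <= n)%N -> (1 <= b <= n.+1)%N -> supn w a * NN b w <= X.
  move=> an bn; rewrite -(ler_pXn2r (ltn0Sn 1)) ?nnegrE ?mulr_ge0 ?supn_ge0 ?nrm_ge0 //.
  rewrite X2 exprMn supn_sqr.
  have -> : 2 * B * Z ^+ 3 = 2 * B * Z * Z ^+ 2 by ring.
  apply: ler_pM; [nneg|nneg| |].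
    apply: ler_pM; [nneg|nneg| |].
      by rewrite ler_wpM2l // wB.
    by apply: wZ; case/andP: an.
  by rewrite ler_pXn2r ?nnegrE ?nrm_ge0 // wZ.
have q : NN n.+1 (quad w) <= 3 * (1/100) * l + c * X.
  apply: quad_le => // a an.
  case: (leqP a (n.+2 - a)) => ab.
    by left; have /andP[] := idx _ an ab; exact: XM.
  by right; rewrite mulrC; have /andP[] := idx' _ an ab; exact: XM.
set Q := NN n.+1 (quad w) in q *.
have Q0 : 0 <= Q by exact: nrm_ge0.
have q2 : Q ^+ 2 <= (3 * (1/100) * l + c * X) ^+ 2.
  by rewrite ler_pXn2r ?nnegrE //; nneg.
have q3 : Q ^+ 2 <= 18/10000 * l ^+ 2 + 2 * c ^+ 2 * X ^+ 2.
  apply: le_trans q2 _; have := sqr_ge0 (3 * (1/100) * l - c * X); nra.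
rewrite X2 in q3.
have q4 := HC _ _ Z0 l0 Z2.
have q6 : 9/4 * Q ^+ 2 <= 3/4 * l ^+ 2 + C.
  have := sqr_ge0 l; lra.
have := ler_wpM2l (ltW t0) q6; lra.
Qed.

(** The exponent 4 of the weight s is dictated by homogeneity: the increment of the weight costs s^3
    N l with N^2 <= B l, of order (s^2 l)^{3/2}, while the dissipation supplies (s^2 l)^2. Two
    applications of Young leave 256 B^2. *)
Lemma high_energy_smoothing (n : nat) (B d T : R) : (1 <= n)%N -> 0 <= B -> 0 < d ->
  exists C, forall p (v : nat -> 'I_p.+2 -> R),
    (forall m, v m.+1 = step (v m)) ->
    (forall m x, `|v m x| <= 1 / 100) ->
    (forall m j, d <= m%:R * tau p <= T -> (1 <= j <= n)%N -> NN j (v m) <= B) ->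
    forall m, 2 * d <= m%:R * tau p <= T -> en (iter n.+1 dif (v m)) <= C.
Proof.
move=> n1 B0 d0; have [C0 [C00 HC]] := high_energy_step n1 B0.
pose K := T ^+ 4 * C0 + 256 * B ^+ 2.
exists ((B ^+ 2 + T * K) / d ^+ 4) => p v vS vmax vB m /andP[dm mT].
have t0 := @tau_gt0 R p; have h0 := @mesh_gt0 R p.
have hpi : mesh p <= 4 :> R.
  rewrite ler_pdivrMr ?ltr0n //; apply: (@le_trans _ _ (4 * 2)).
    by have := @pihalf_lt2 R; lra.
  by rewrite ler_pM2l // ler_nat.
have T0 : 0 <= T by apply: le_trans mT; rewrite mulr_ge0 // ltW.
have K0 : 0 <= K by apply: addr_ge0; apply: mulr_ge0; rewrite ?exprn_ge0 ?ler0n.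
have exm : exists m0, d <= m0%:R * tau p.
  by exists m; lra.
pose m0 := ex_minn exm.
(* At the first index m0 past time d the weight s is at most one time step. Its fourth power
   compensates the loss h^-3 of the inverse inequalities, so the induction can start from norms of
   order n only. *)
have [dm0 mmin] : d <= m0%:R * tau p /\ forall k, d <= k%:R * tau p -> (m0 <= k)%N.
  by rewrite /m0; case: ex_minnP.
clearbody m0; have m0m : (m0 <= m)%N by apply: mmin; lra.
have m0d : m0%:R * tau p <= d + tau p.
  case: m0 dm0 mmin m0m => [|k] dk mk _; first by rewrite mul0r addr_ge0 // ltW.
  have : ~~ (d <= k%:R * tau p) by apply/negP => /mk; rewrite ltnn.
  by rewrite -ltNge -natr1 mulrDl mul1r => /ltW; lra.
pose s k : R := k%:R * tau p - d.
pose Y k := s k ^+ 4 * en (iter n.+1 dif (v k)).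
have key : forall k, (m0 + k <= m)%N -> Y (m0 + k)%N <= B ^+ 2 + k%:R * tau p * K.
  elim=> [|k IHk] km.
    rewrite addn0 mul0r mul0r addr0 /Y.
    have s0 : 0 <= s m0 by rewrite subr_ge0.
    have s1 : s m0 <= tau p by rewrite /s; lra.
    have N1 : NN n (v m0) <= B.
      apply: vB; last by rewrite n1 leqnn.
      rewrite dm0 /=; apply: le_trans mT; rewrite ler_pM2r // ler_nat //.
    have e1 : en (iter n.+1 dif (v m0)) <= 2 / mesh p * (2 / mesh p * B) ^+ 2.
      apply: le_trans (en_le_sqr _) _; apply: ler_wpM2l; first exact: two_mesh_ge0.
      rewrite ler_pXn2r ?nnegrE ?nrm_ge0 ?(mulr_ge0 (two_mesh_ge0 p) B0) //.
      apply: le_trans (nrm_dif_le _) _.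
      by rewrite ler_wpM2l ?two_mesh_ge0.
    apply: (@le_trans _ _ (tau p ^+ 4 * (2 / mesh p * (2 / mesh p * B) ^+ 2))).
      apply: (@le_trans _ _ (tau p ^+ 4 * en (iter n.+1 dif (v m0)))).
        by rewrite ler_wpM2r ?en_ge0 // ler_pXn2r ?nnegrE // ltW.
      by rewrite ler_wpM2l // exprn_ge0 // ltW.
    have -> : tau p ^+ 4 * (2 / mesh p * (2 / mesh p * B) ^+ 2) = mesh p * B ^+ 2 / 8192.
      by rewrite /time_step; field; exact: mesh_neq0.
    have B2 := sqr_ge0 B; nra.
  have kmm : (m0 + k < m)%N by rewrite -addnS.
  have {}IHk := IHk (ltnW kmm).
  rewrite addnS; set i := (m0 + k)%N in IHk kmm *.
  have i0 : (m0 <= i)%N by exact: leq_addr.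
  have di : d <= i%:R * tau p <= T.
    apply/andP; split; first by apply: le_trans dm0 _; rewrite ler_pM2r // ler_nat.
    by apply: le_trans mT; rewrite ler_pM2r // ler_nat ltnW.
  have wB j : (1 <= j <= n)%N -> NN j (v i) <= B by exact: vB.
  have HE := HC p (v i) (vmax i) wB; rewrite -vS in HE.
  have en1 : en (iter n.+1 dif (v i)) <= NN n.+1 (v i) * NN n.+2 (v i) by exact: en_le.
  have Ni : NN n.+1 (v i) ^+ 2 <= B * NN n.+2 (v i).
    apply: le_trans (dif_interp (iter n dif (v i))) _.
    by rewrite ler_wpM2r ?nrm_ge0 // wB // n1 leqnn.
  have e0 := en_ge0 (iter n.+1 dif (v i)).
  have n10 : 0 <= NN n.+1 (v i) by exact: nrm_ge0.
  have l0 : 0 <= NN n.+2 (v i) by exact: nrm_ge0.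
  have sS : s i.+1 = s i + tau p by rewrite /s -natr1; ring.
  have s0 : 0 <= s i by rewrite subr_ge0; case/andP: di.
  have sT : s i.+1 <= T.
    rewrite /s; apply: (@le_trans _ _ (i.+1%:R * tau p)); first by rewrite gerBl ltW.
    by apply: le_trans mT; rewrite ler_pM2r // ler_nat.
  have Yi : Y i.+1 <= Y i + tau p * K.
    rewrite /Y sS; rewrite sS in sT.
    set e := en _ in e0 en1 HE *; set e' := en _ in HE *.
    set N1 := NN n.+1 _ in en1 Ni n10 *; set l := NN n.+2 _ in en1 Ni HE l0 *.
    set si := s i in s0 sT *; set S := si + tau p in sT *.
    have S0 : 0 <= S by rewrite /S; nneg.
    apply: (@le_trans _ _ (S ^+ 4 * (e - tau p * (l ^+ 2 / 2 - C0)))).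
      by rewrite ler_wpM2l // exprn_ge0.
    have S4 : S ^+ 4 - si ^+ 4 <= 4 * S ^+ 3 * tau p.
      have -> : S ^+ 4 - si ^+ 4 = tau p * (S ^+ 3 + S ^+ 2 * si + S * si ^+ 2 + si ^+ 3).
        by rewrite /S; ring.
      have siS : si <= S by rewrite /S lerDl ltW.
      have h1 : S ^+ 2 * si <= S ^+ 3 by rewrite [leRHS]exprSr ler_wpM2l // exprn_ge0.
      have h2 : S * si ^+ 2 <= S ^+ 3.
        by rewrite [leRHS]exprS ler_wpM2l // ler_pXn2r ?nnegrE.
      have h3 : si ^+ 3 <= S ^+ 3 by rewrite ler_pXn2r ?nnegrE.
      rewrite mulrC ler_wpM2r ?(ltW t0) //; lra.
    have a1 : (S ^+ 4 - si ^+ 4) * e <= 4 * S ^+ 3 * tau p * (N1 * l).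
      apply: (@le_trans _ _ (4 * S ^+ 3 * tau p * e)); first by rewrite ler_wpM2r.
      by rewrite ler_wpM2l //; nneg.
    have a2 : 4 * S ^+ 3 * (N1 * l) <= S ^+ 4 * (l ^+ 2 / 2) + 256 * B ^+ 2.
      have b1 : 4 * (S ^+ 2 * l) * (S * N1) <= (S ^+ 2 * l) ^+ 2 / 4 + 16 * (S * N1) ^+ 2.
        by have := sqr_ge0 (S ^+ 2 * l - 8 * (S * N1)); nra.
      have b2 : (S * N1) ^+ 2 <= S ^+ 2 * (B * l) by rewrite exprMn ler_wpM2l ?sqr_ge0.
      have b3 : 16 * (B * (S ^+ 2 * l)) <= (S ^+ 2 * l) ^+ 2 / 4 + 256 * B ^+ 2.
        by have := sqr_ge0 (S ^+ 2 * l - 32 * B); nra.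
      have -> : 4 * S ^+ 3 * (N1 * l) = 4 * (S ^+ 2 * l) * (S * N1) by ring.
      have -> : S ^+ 4 * (l ^+ 2 / 2) = (S ^+ 2 * l) ^+ 2 / 2 by ring.
      lra.
    have a3 : S ^+ 4 * C0 <= T ^+ 4 * C0.
      by rewrite ler_wpM2r // ler_pXn2r ?nnegrE.
    have a4 := ler_wpM2l (ltW t0) a2; have a5 := ler_wpM2l (ltW t0) a3.
    rewrite /K; lra.
  apply: le_trans Yi _; rewrite -natr1; lra.
have sm : d <= s m by rewrite /s; lra.
have Ym : Y m <= B ^+ 2 + T * K.
  have := key (m - m0)%N; rewrite subnKC // => /(_ (leqnn _)) /le_trans; apply.
  rewrite lerD2l ler_wpM2r //; apply: le_trans mT.
  by rewrite ler_pM2r // ler_nat leq_subr.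
rewrite ler_pdivlMr ?exprn_gt0 //; apply: le_trans Ym.
rewrite /Y mulrC ler_wpM2r ?en_ge0 // ler_pXn2r ?nnegrE ?(ltW d0) //.
exact: le_trans (ltW d0) sm.
Qed.

(* Bootstrap on [n]: a power of the elapsed time, used as a weight, absorbs the
   energy at the beginning of the time interval. *)
Lemma uniform_energy (A : R) (n : nat) (d T : R) : 0 < d ->
  exists C, 0 <= C /\ forall p (v : nat -> 'I_p.+2 -> R),
    (forall m, v m.+1 = step (v m)) -> (forall x, `|v 0%N x| <= 1 / 100) ->
    en (v 0%N) <= A ->
    forall m j, d <= m%:R * tau p <= T -> (j <= n)%N -> en (iter j dif (v m)) <= C.
Proof.
elim: n d => [|n IHn] d d0.
  exists `|A|; split=> // p v vS v0 vA m [|//] _ _.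
  by apply: le_trans (ler_norm A); exact: (en0_le vS).
have d20 : 0 < d / 2 by rewrite divr_gt0.
have [C [C0 HC]] := IHn _ d20.
(* Order 1 relies on the energy alone, which is controlled from time 0 on; higher orders start at
   time d / 2 from the bound on the preceding orders. *)
case: n IHn HC => [|n] _ HC.
  have [C1 HC1] : exists C1, forall p (v : nat -> 'I_p.+2 -> R),
    (forall m, v m.+1 = step (v m)) -> (forall x, `|v 0%N x| <= 1 / 100) ->
    en (v 0%N) <= A -> forall m, d <= m%:R * tau p <= T -> en (iter 1 dif (v m)) <= C1.
    pose k := 41 * @leibniz_cst R 1 ^+ 4 * A.
    exists (expR (k * A) * (2 * (1 + k * A) ^+ 2 * A) / d ^+ 2) => p v vS v0 vA m /andP[dm mT].
    have H := en1_smoothing vS v0 vA m.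
    rewrite ler_pdivlMr ?exprn_gt0 //; apply: le_trans H.
    rewrite mulrC ler_wpM2r ?en_ge0 // ler_pXn2r ?nnegrE ?(ltW d0) //.
    by apply: le_trans dm; exact: ltW.
  exists (`|A| + `|C1|); split=> [|p v vS v0 vA m [|[|//]] dmT _]; first by nneg; rewrite normr_ge0.
    apply: (@le_trans _ _ A); first exact: (en0_le vS).
    by rewrite (le_trans (ler_norm A)) // lerDl.
  apply: (@le_trans _ _ C1); first exact: HC1.
  by rewrite (le_trans (ler_norm C1)) // lerDr.
have d40 : 0 < d / 2 by [].
(* By [en_interp] the squared norms of orders 1 to n+1 are at most C, hence the norms themselves are
   at most C + 1. *)
have [C2 HC2] := @high_energy_smoothing n.+1 (C + 1) (d / 2) T isT (addr_ge0 C0 ler01) d40.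
exists (C + `|C2|); split=> [|p v vS v0 vA m j dmT jn]; first by nneg; rewrite normr_ge0.
have HCm m' j' : d / 2 <= m'%:R * tau p <= T -> (j' <= n.+1)%N -> en (iter j' dif (v m')) <= C.
  exact: HC.
have := jn; rewrite leq_eqVlt => /orP[/eqP ->|jn'].
  apply: (@le_trans _ _ C2); last by rewrite (le_trans (ler_norm C2)) // lerDr.
  apply: (HC2 p v vS) => //; last by rewrite (_ : 2 * (d / 2) = d) //; field.
    by move=> m' x; exact: traj_max.
  move=> m' [//|j'] dm' j'n.
  have n0 : 0 <= NN j'.+1 (v m') by exact: nrm_ge0.
  have H : (NN j'.+1 (v m') ^+ 2) ^+ 2 <= C * C.
    apply: le_trans (en_interp (iter j' dif (v m'))) _.
    case/andP: j'n => _ j'n.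
    apply: ler_pM; [exact: en_ge0|exact: en_ge0| |exact: (HCm m' j'.+1)].
    exact: (HCm m' j' dm' (ltnW j'n)).
  rewrite -expr2 ler_pXn2r ?nnegrE ?sqr_ge0 // in H.
  by have := sqr_ge0 (NN j'.+1 (v m') - 1); nra.
apply: (@le_trans _ _ C); last by rewrite lerDl.
apply: HCm => //; case/andP: dmT => dm ->; rewrite andbT; lra.
Qed.

End Smoothing.

(** * A discontinuous datum of finite energy *)

Section SineBounds.
Context {R : realType}.
Implicit Types x y : R.

Lemma sin_lipschitz x y : `|sin x - sin y| <= `|x - y|.
Proof.
wlog xy : x y / x <= y.
  move=> H; have [|/ltW] := leP x y; first exact: H.
  by rewrite (distrC (sin x)) (distrC x); exact: H.
have [z _ E] := @MVT_segment R (@sin R) (@cos R) x y xy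
  (fun z _ => is_derive_sin z) (continuous_subspaceT (@continuous_sin R)).
by rewrite distrC E normrM [leRHS]distrC ler_piMl // cos_max.
Qed.

Lemma norm_sin_le x : `|sin x| <= `|x|.
Proof. by have := sin_lipschitz x 0; rewrite sin0 !subr0. Qed.

Lemma cos_ge x : 1 - x ^+ 2 / 2 <= cos x.
Proof.
have -> : cos x = 1 - 2 * sin (x / 2) ^+ 2 by rewrite cos_half; ring.
have : sin (x / 2) ^+ 2 <= (x / 2) ^+ 2.
  rewrite -[leLHS]real_normK ?num_real // -[leRHS]real_normK ?num_real //.
  by rewrite ler_pXn2r ?nnegrE // norm_sin_le.
by rewrite exprMn; lra.
Qed.

Lemma sin_ge x : 0 <= x <= pi / 2 -> x / 4 <= sin x.
Proof.
move=> /andP[x0 xpi].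
have small y : 0 <= y <= 1 -> y / 2 <= sin y.
  move=> /andP[y0 y1].
  have [z /[!in_itv]/= /andP[z0 z1] E] := @MVT_segment R (@sin R) (@cos R) 0 y y0
    (fun z _ => is_derive_sin z) (continuous_subspaceT (@continuous_sin R)).
  rewrite sin0 !subr0 in E; rewrite E mulrC ler_wpM2r //.
  apply: le_trans (cos_ge z); have : z ^+ 2 <= 1 by rewrite expr_le1 // (le_trans z1).
  lra.
have [x1|x1] := leP x 1; first by have := small x; lra.
have : sin 1 < sin x.
  by rewrite ltr_sin // in_itv /=; have := @pihalf_ge1 R; lra.
have := small 1; have := @pihalf_lt2 R; lra.
Qed.

Lemma norm_sin_half_ge x : 0 <= x <= 2 * pi -> Num.min x (2 * pi - x) / 8 <= `|sin (x / 2)|.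
Proof.
move=> x02; rewrite ger0_norm; last by apply: sin_ge0_pi; lra.
have [xpi|xpi] := leP x pi.
  apply: (@le_trans _ _ (x / 2 / 4)).
    have : Num.min x (2 * pi - x) <= x by rewrite ge_min lexx.
    lra.
  by apply: sin_ge; lra.
have -> : sin (x / 2) = sin ((2 * pi - x) / 2).
  by rewrite (_ : (2 * pi - x) / 2 = - (x / 2) + pi) ?sinDpi ?sinN ?opprK //; field.
apply: (@le_trans _ _ ((2 * pi - x) / 2 / 4)).
  have : Num.min x (2 * pi - x) <= 2 * pi - x by rewrite ge_min lexx orbT.
  lra.
by apply: sin_ge; lra.
Qed.

(** Here |sin (x / 2)| stands for the distance of x to 2 pi Z, which makes the tents periodic. The
    ratio 4 of successive widths is what makes tents of different index almost orthogonal in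
    energy. *)
Definition tent (i : nat) x : R := Num.max 0 (1 - 4 ^+ i * `|sin (x / 2)|).

Lemma tent_lipschitz i x y : `|tent i x - tent i y| <= 4 ^+ i / 2 * `|x - y|.
Proof.
have mx (a b : R) : `|Num.max 0 a - Num.max 0 b| <= `|a - b|.
  move: (ler_norm (a - b)) (ler_norm (b - a)); rewrite (distrC b a) ler_norml => h1 h2.
  by rewrite /Num.max; case: ltP => ha; case: ltP => hb; apply/andP; split; lra.
apply: le_trans (mx _ _) _.
rewrite (_ : _ - _ = 4 ^+ i * (`|sin (y / 2)| - `|sin (x / 2)|)); last by ring.
rewrite normrM ger0_norm ?exprn_ge0 // -mulrA ler_wpM2l ?exprn_ge0 //.
apply: le_trans (ler_dist_dist _ _) _; apply: le_trans (sin_lipschitz _ _) _.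
by rewrite -mulrBl normrM distrC [`|2^-1|]ger0_norm // mulrC.
Qed.

Lemma tent_ge0 i x : 0 <= tent i x.
Proof. by rewrite le_max lexx. Qed.

Lemma tent_le1 i x : tent i x <= 1.
Proof. by rewrite ge_max ler01 gerBl mulr_ge0 ?exprn_ge0. Qed.

Lemma tentD2pi i x : tent i (x + 2 * pi) = tent i x.
Proof.
by rewrite /tent (_ : (x + 2 * pi) / 2 = x / 2 + pi) ?sinDpi ?normrN //; field.
Qed.

(* Each tent has bounded energy and the weights are square summable but not
   summable: the energy of [tents n] stays bounded, while [tents n 0] does not. *)
Definition tents (n : nat) x : R := \sum_(i < n) tent i x / i.+1%:R.

Lemma tentsD2pi n x : tents n (x + 2 * pi) = tents n x.
Proof. by apply: eq_bigr => i _; rewrite tentD2pi. Qed.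

End SineBounds.

Section TentEnergy.
Context {R : realType} (p M : nat).
Hypothesis pM : p.+2 = (8 * 4 ^ M)%N.
Local Notation G := 'I_p.+2.
Local Notation h := (@mesh R p).

Definition sample (F : R -> R) : G -> R := fun x => F (h * (x : nat)%:R).

Lemma sampleD1 (F : R -> R) (x : G) : (forall y, F (y + 2 * pi) = F y) ->
  sample F (x + 1) = F (h * (x : nat)%:R + h).
Proof.
move=> Fp; rewrite /sample.
have [x1|x1] := ltnP x.+1 p.+2.
  rewrite (_ : ((x + 1)%R : nat) = x.+1); last by rewrite /= addn1 modn_small.
  by rewrite -natr1 mulrDr mulr1.
have xN : x.+1 = p.+2 by apply/eqP; rewrite eqn_leq x1 ltn_ord.
rewrite (_ : ((x + 1)%R : nat) = 0%N); last by rewrite /= addn1 xN modnn.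
by rewrite mulr0 -[X in _ + X]mulr1 -mulrDr natr1 xN mesh_period -Fp add0r.
Qed.

Lemma sum_ltn_le (n c : nat) : (\sum_(x < n) (x < c) <= c)%N.
Proof.
suff : (\sum_(x < n) (x < c) <= minn n c)%N by move/leq_trans; apply; exact: geq_minr.
elim: n => [|n IHn]; first by rewrite big_ord0.
rewrite big_ord_recr /=; move: IHn; rewrite !leq_min => /andP[h1 h2].
move: h1 h2; set S := (\sum_(i < n) _)%N => h1 h2.
by case: (ltnP n c) => nc /=; rewrite ?addn1 ?addn0; apply/andP; split; lia.
Qed.

(** The measure of the support is obtained by counting: its lattice points lie within c steps of 0
    on either side. *)
Lemma tent_support (i : nat) : (i <= M)%N ->
  h * \sum_(x : G) (tent i (h * (x : nat)%:R) != 0 :> R)%:R <= 32 / 4 ^+ i.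
Proof.
(* c steps cover the length 4 pi / 4^i >= 8 / 4^i, and beyond the distance 8 / 4^i the bound
   [norm_sin_half_ge] makes the tent vanish. *)
move=> iM; set c := (16 * 4 ^ (M - i))%N.
have h0 := @mesh_gt0 R p; have pi2 := @pi_ge2 R.
have N0 : (p.+2)%:R = 8 * 4 ^+ M :> R by rewrite pM natrM natrX.
have hE : h * (8 * 4 ^+ M) = 2 * pi by rewrite -N0 mesh_period.
have c4 : c%:R = 16 * 4 ^+ M / 4 ^+ i :> R.
  by rewrite natrM natrX -mulrA -expfB_cond ?pnatr_eq0.
have i0 : 0 < 4 ^+ i :> R by rewrite exprn_gt0.
have supp (x : G) : tent i (h * (x : nat)%:R) != 0 :> R -> (x < c)%N || (p.+2 - x.+1 < c)%N.
  apply: contraNT; rewrite negb_or -!leqNgt => /andP[xc xc'].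
  apply/eqP/max_idPl; rewrite subr_le0.
  have xp : h * (x : nat)%:R <= 2 * pi.
    by rewrite -(@mesh_period R p) ler_pM2l // ler_nat ltnW.
  have x0 : 0 <= h * (x : nat)%:R by rewrite mulr_ge0 // ltW.
  have x02 : 0 <= h * (x : nat)%:R <= 2 * pi by rewrite x0.
  have := norm_sin_half_ge x02.
  have hc : 8 <= 4 ^+ i * (h * c%:R).
    rewrite c4; have -> : 4 ^+ i * (h * (16 * 4 ^+ M / 4 ^+ i)) = 2 * (h * (8 * 4 ^+ M)).
      by field; rewrite gt_eqF.
    by rewrite hE; lra.
  have m1 : h * c%:R <= Num.min (h * (x : nat)%:R) (2 * pi - h * (x : nat)%:R).
    rewrite le_min !ler_pM2l // ler_nat xc /= -(@mesh_period R p) -mulrBr ler_pM2l //.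
    rewrite -natrB ?ler_nat; last exact: ltnW.
    by apply: leq_trans xc' _; rewrite leq_sub2l.
  move=> m2; have {}m2 : h * c%:R / 8 <= `|sin (h * (x : nat)%:R / 2)|.
    by apply: le_trans m2; rewrite ler_pM2r.
  have := ler_wpM2l (ltW i0) m2; lra.
have cnt : (\sum_(x : G) (tent i (h * (x : nat)%:R)%R != 0%R) <= c + c)%N.
  apply: (@leq_trans (\sum_(x < p.+2) ((x < c) + (p.+2 - x.+1 < c)))%N).
    apply: leq_sum => x _; case: (altP (tent i (h * (x : nat)%:R)%R =P 0%R)) => //= t0.
    by have := supp x t0; case: (x < c)%N; case: (_ < c)%N.
  rewrite big_split leq_add ?sum_ltn_le //=.
  rewrite (reindex_inj rev_ord_inj) /=; apply: leq_trans (sum_ltn_le p.+2 c).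
  apply: leq_sum => x _; rewrite (_ : (p.+2 - (p.+2 - x.+1).+1)%N = x) //.
  by have := ltn_ord x; clear; lia.
rewrite -natr_sum; apply: (@le_trans _ _ (h * (c + c)%:R)).
  by rewrite ler_pM2l // ler_nat.
rewrite natrD c4.
have -> : h * (16 * 4 ^+ M / 4 ^+ i + 16 * 4 ^+ M / 4 ^+ i) = 4 * (h * (8 * 4 ^+ M)) / 4 ^+ i.
  by field; rewrite gt_eqF.
by rewrite hE ler_pM2r ?invr_gt0 //; have := @pihalf_lt2 R; lra.
Qed.

Lemma sum_two_points (f : G -> R) (q : R) :
  h * \sum_x (q / 2) ^+ 2 * (f x + f (x + 1)) = q * q / 2 * (h * \sum_x f x).
Proof.
by rewrite -mulr_sumr big_split /= (sum_shift f); move: (\sum_x _) => S; field.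
Qed.

(** Height 1 on a set of measure of order 4^-i gives 2^-i; slope of order 4^i on the same set gives
    2^i in [tent_nrm_dif]. The product, which bounds the energy, does not depend on i: this is the
    scale invariance of H^{1/2}. *)
Lemma tent_nrm (i : nat) : (i <= M)%N -> nrm (sample (tent i)) <= 6 / 2 ^+ i.
Proof.
move=> iM; have i0 : 0 < 2 ^+ i :> R by rewrite exprn_gt0.
apply: nrm_le; first by rewrite divr_ge0 // ltW.
have -> : (6 / 2 ^+ i) ^+ 2 = 36 / 4 ^+ i :> R.
  rewrite (_ : 4 = 2 * 2) ?exprMn //; last by ring.
  by field; rewrite gt_eqF.
apply: (@le_trans _ _ (32 / 4 ^+ i)); last first.
  by rewrite ler_pM2r ?invr_gt0 ?exprn_gt0 // ler_nat.
apply: le_trans (tent_support iM).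
rewrite ler_pM2l ?mesh_gt0 //; apply: ler_sum => x _; rewrite /sample.
have := tent_ge0 i (h * (x : nat)%:R); have := tent_le1 i (h * (x : nat)%:R).
by case: eqVneq => [->|_] t1 t0; rewrite ?mulr0 // mulr_ile1.
Qed.

Lemma tent_nrm_dif (i : nat) : (i <= M)%N -> nrm (dif (sample (tent i))) <= 4 * 2 ^+ i.
Proof.
move=> iM; have h0 := @mesh_gt0 R p.
pose ind x : R := (tent i (h * (x : G)%:R) != 0 :> R)%:R.
apply: nrm_le; first by rewrite mulr_ge0 // exprn_ge0.
have -> : (4 * 2 ^+ i) ^+ 2 = 4 ^+ i * 4 ^+ i / 2 * (32 / 4 ^+ i) :> R.
  rewrite (_ : 4 ^+ i = 2 ^+ i * 2 ^+ i); last by rewrite -exprMn; congr (_ ^+ _); ring.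
  by field; rewrite expf_neq0.
apply: (@le_trans _ _ (4 ^+ i * 4 ^+ i / 2 * (h * \sum_x ind x))); last first.
  by rewrite ler_wpM2l ?tent_support // divr_ge0 // mulr_ge0 // exprn_ge0.
rewrite -sum_two_points.
rewrite ler_pM2l //; apply: ler_sum => x _.
have d1 : `|dif (sample (tent i)) x| <= 4 ^+ i / 2.
  rewrite /dif sampleD1; last by move=> y; rewrite tentD2pi.
  rewrite normrM normfV [`|h|]gtr0_norm // ler_pdivrMr //.
  apply: le_trans (tent_lipschitz _ _ _) _.
  by rewrite addrC addKr gtr0_norm.
rewrite -expr2 -[leLHS]real_normK ?num_real //.
have d2 : `|dif (sample (tent i)) x| ^+ 2 <= (4 ^+ i / 2) ^+ 2.
  by rewrite ler_pXn2r ?nnegrE // divr_ge0 // exprn_ge0.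
have s0 : 0 <= (4 ^+ i / 2) ^+ 2 :> R by exact: sqr_ge0.
rewrite /ind; case: eqVneq => e1 /=; last first.
  by apply: le_trans d2 _; rewrite -[leLHS]mulr1 ler_wpM2l // lerDl.
rewrite add0r; case: eqVneq => e2; last by rewrite mulr1.
by rewrite /dif /sample e1 e2 subrr mul0r normr0 expr0n mulr0.
Qed.

(** In the form [enE] every square shrinks. It transfers the energy bound from the unbounded sums of
    tents to their sine. *)
Lemma en_contraction (f g : G -> R) (k : R) : (forall x y, `|g x - g y| <= k * `|f x - f y|) ->
  en g <= k ^+ 2 * en f.
Proof.
move=> H; rewrite !enE [leRHS]mulrCA ler_pM2l; last by rewrite divr_gt0 ?mesh_gt0.
rewrite mulr_sumr.
apply: ler_sum => x _; rewrite mulr_sumr; apply: ler_sum => y _.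
have [->|y0] := eqVneq y 0; first by rewrite addr0 !subrr !expr0n !mulr0.
rewrite [leRHS]mulrCA ler_wpM2l ?oppr_ge0 ?kap_le0 //.
rewrite -exprMn -[leLHS]real_normK ?num_real // -[leRHS]real_normK ?num_real //.
rewrite ler_pXn2r ?nnegrE // normrM; apply: le_trans (H _ _) _.
by rewrite ler_wpM2r // ler_norm.
Qed.

(** The difference of the sum is dominated by its last tent, whence the bound 2^n / (n+2). Pairing
    it with the norm 2^-(n+1) of the next tent bounds the cross energy by 72 a, a = 1/(n+2); a new
    tent then adds at most 2 a 72 a + 24 a^2 = 168 a^2, and a^2 <= 1/(n+1) - 1/(n+2) telescopes. *)
Lemma tents_energy (n : nat) : (n <= M)%N ->
  nrm (dif (sample (tents n.+1))) <= 24 * 2 ^+ n / n.+2%:R /\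
  en (sample (tents n.+1)) <= 24 + 168 * (1 - n.+1%:R^-1).
Proof.
elim: n => [|n IHn] nM.
  have E : sample (tents 1) = sample (tent 0).
    by apply/funext => x; rewrite /sample /tents big_ord1 /= divr1.
  have t1 := @tent_nrm 0 nM; have t2 := @tent_nrm_dif 0 nM.
  rewrite !expr0 in t1 t2; rewrite E expr0 invr1; split; first by lra.
  apply: le_trans (en_le _) _.
  have := ler_pM (nrm_ge0 _) (nrm_ge0 _) t1 t2; lra.
have [{IHn} H1 H2] := IHn (ltnW nM).
set a : R := n.+2%:R^-1.
have E : sample (tents n.+2) = fun x => 1 * sample (tents n.+1) x + a * sample (tent n.+1) x.
  by apply/funext => x; rewrite /sample /tents big_ord_recr /= mul1r [_ / _]mulrC.
have t1 := tent_nrm nM; have t2 := tent_nrm_dif nM.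
rewrite exprS in t1 t2.
have aE : a * n.+2%:R = 1 by rewrite mulVf // pnatr_eq0.
have kE : (n.+1%:R^-1 : R) * n.+1%:R = 1 by rewrite mulVf // pnatr_eq0.
have n3 : n.+3%:R = n.+1%:R + 2 :> R by rewrite -addn2 natrD.
have n2 : n.+2%:R = n.+1%:R + 1 :> R by rewrite -natr1.
have n11 : 1 <= n.+1%:R :> R by rewrite ler1n.
have a0 : 0 <= a by rewrite invr_ge0.
have p2 : 0 < 2 ^+ n :> R by rewrite exprn_gt0.
have q2 : (2 ^+ n)^-1 * 2 ^+ n = 1 :> R by rewrite mulVf // gt_eqF.
split.
  rewrite E dif_lin; under eq_fun do rewrite mul1r.
  apply: le_trans (nrmD _ _) _; rewrite nrmZ ger0_norm //.
  apply: (@le_trans _ _ (24 * 2 ^+ n / n.+2%:R + a * (4 * (2 * 2 ^+ n)))).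
    by apply: lerD => //; rewrite ler_wpM2l.
  rewrite ler_pdivlMr ?ltr0n // exprS -/a n3.
  move: aE; rewrite n2; move: (n.+1%:R) n11 (2 ^+ n) p2 a0 => k k1 q q0 a0 aE.
  have -> : (24 * q * a + a * (4 * (2 * q))) * (k + 2) = 32 * q * (a * (k + 1) + a) by ring.
  have : a <= 2^-1 by nra.
  rewrite aE; nra.
have e1 : ip (sample (tents n.+1)) (labs (sample (tent n.+1))) <= 72 * a.
  rewrite -labs_sym ipC; apply: le_trans (ip_le _ _) _; rewrite nrm_labs.
  apply: le_trans (ler_pM (nrm_ge0 _) (nrm_ge0 _) t1 H1) _.
  rewrite -/a le_eqVlt; apply/orP; left; apply/eqP.
  by field; rewrite gt_eqF.
have e2 : en (sample (tent n.+1)) <= 24.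
  apply: le_trans (en_le _) _; apply: le_trans (ler_pM (nrm_ge0 _) (nrm_ge0 _) t1 t2) _.
  rewrite le_eqVlt; apply/orP; left; apply/eqP.
  by field; rewrite gt_eqF.
have enE' : en (fun x => 1 * sample (tents n.+1) x + a * sample (tent n.+1) x) =
    en (sample (tents n.+1)) + 2 * a * ip (sample (tents n.+1)) (labs (sample (tent n.+1)))
    + a ^+ 2 * en (sample (tent n.+1)).
  rewrite {1}/en labs_lin ip_linl !ip_linr -/(en _) -/(en (sample (tent _))).
  rewrite -[ip (sample (tent _)) (labs (sample (tents _)))]labs_sym ipC; ring.
rewrite E enE'.
have e3 := ler_wpM2l (mulr_ge0 (ler0n R 2) a0) e1.
have e4 := ler_wpM2l (sqr_ge0 a) e2.
have aa : a ^+ 2 <= n.+1%:R^-1 - a.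
  move: aE kE n11 a0; rewrite n2; move: (n.+1%:R) (n.+1%:R^-1) => k b aE kE k1 a0.
  have -> : b - a = a * b.
    apply: (@mulfI _ (k * (k + 1))); first by rewrite mulf_neq0 // gt_eqF //; lra.
    have -> : k * (k + 1) * (b - a) = (b * k) * (k + 1) - (a * (k + 1)) * k by ring.
    have -> : k * (k + 1) * (a * b) = (b * k) * (a * (k + 1)) by ring.
    by rewrite aE kE; ring.
  rewrite expr2 ler_wpM2l //; have : 0 <= b by nra.
  nra.
by move: (n.+1%:R^-1) aa H2 => b aa H2; lra.
Qed.

Lemma tents_energy_le : en (sample (tents M.+1)) <= 192.
Proof.
have [_ e1] := tents_energy (leqnn M).
have e2 : 0 <= M.+1%:R^-1 :> R by rewrite invr_ge0.
move: (M.+1%:R^-1) e2 e1 => b; lra.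
Qed.

Lemma sin_tents_energy_le :
  en (sample (fun x => 1 / 100 * sin (tents M.+1 x))) <= 1.
Proof.
apply: (@le_trans _ _ ((1 / 100) ^+ 2 * en (sample (tents M.+1)))).
  apply: en_contraction => x y; rewrite /sample -mulrBr normrM ger0_norm //.
  by rewrite ler_wpM2l // sin_lipschitz.
have := tents_energy_le; have := en_ge0 (sample (tents M.+1)); lra.
Qed.
End TentEnergy.

(** * Passage to the limit *)

Section UltraLimit.
Context {R : realType} (U : set_system nat) {UU : UltraFilter U}.
Implicit Types (a b : nat -> R) (C c l x e : R).

(** Compactness gives a cluster point, and an ultrafilter converges to each of its cluster
    points. *)
Lemma ultra_bounded_cvg a C : (\forall M \near U, `|a M| <= C) -> cvg (a @ U).
Proof.
move=> aC.
have [|l [_ lU]] := @segment_compact R (- C) C (a @ U) _ _.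
  by apply: filterS aC => M; rewrite /= in_itv /= -ler_norml.
apply/cvg_ex; exists l => /= V Vl.
have [//|nV] := in_ultra_setVsetC (a @^-1` V) UU.
by have [x [xnV xV]] := lU (~` V) V nV Vl.
Qed.

Definition ulim a : R := lim (a @ U).

Lemma ulim_cvg a C : (\forall M \near U, `|a M| <= C) -> a @ U --> ulim a.
Proof. by move/ultra_bounded_cvg. Qed.

Lemma ucvg_le a l c : a @ U --> l ->
  (forall e, 0 < e -> \forall M \near U, a M <= c + e) -> l <= c.
Proof.
move=> al H; apply/ler_addgt0Pr => e e0.
by apply: (cvgr_to_le al); exact: H.
Qed.

Lemma ucvg_dist_le a l x c : a @ U --> l ->
  (forall e, 0 < e -> \forall M \near U, `|a M - x| <= c + e) -> `|l - x| <= c.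
Proof.
move=> al; apply: ucvg_le; apply: cvg_norm; apply: cvgB => //; exact: cvg_cst.
Qed.

End UltraLimit.

Section Increments.
Context {R : realType}.
Implicit Types (g q r : nat -> R) (s z C D F : R).

(** This lemma and the next are used twice: in space with step [mesh] and [dif], and in time with
    step [time_step] and [tq]. *)
Lemma increments_le g q s C k : 0 <= s -> (forall j, g j.+1 = g j + q j * s) ->
  (forall j, (j < k)%N -> `|q j| <= C) -> `|g k - g 0%N| <= C * (k%:R * s).
Proof.
move=> s0 gS; elim: k => [|k IHk] H; first by rewrite subrr normr0 mul0r mulr0.
rewrite gS addrAC; apply: le_trans (ler_normD _ _) _.
rewrite -natr1 mulrDl mul1r mulrDr; apply: lerD.
  by apply: IHk => j jk; apply: H; exact: ltnW.
by rewrite normrM (ger0_norm s0) ler_wpM2r // H.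
Qed.

Lemma increments_taylor g q r s C k : 0 <= s -> 0 <= C ->
  (forall j, g j.+1 = g j + q j * s) -> (forall j, q j.+1 = q j + r j * s) ->
  (forall j, (j < k)%N -> `|r j| <= C) ->
  `|g k - g 0%N - k%:R * s * q 0%N| <= C * (k%:R * s) ^+ 2.
Proof.
move=> s0 C0 gS qS; elim: k => [|k IHk] H.
  by rewrite subrr !mul0r subrr normr0 expr0n mulr0.
have Hk j : (j < k)%N -> `|r j| <= C by move=> jk; apply: H; exact: ltnW.
have -> : g k.+1 - g 0%N - k.+1%:R * s * q 0%N =
    (g k - g 0%N - k%:R * s * q 0%N) + s * (q k - q 0%N) by rewrite gS -natr1; ring.
apply: le_trans (ler_normD _ _) _.
apply: (@le_trans _ _ (C * (k%:R * s) ^+ 2 + s * (C * (k%:R * s)))).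
  apply: lerD; first exact: IHk.
  by rewrite normrM ger0_norm // ler_wpM2l //; exact: increments_le.
rewrite -natr1 -subr_ge0.
have -> : C * ((k%:R + 1) * s) ^+ 2 - (C * (k%:R * s) ^+ 2 + s * (C * (k%:R * s))) =
   C * (s * s) * (k%:R + 1) by ring.
by nneg.
Qed.

(** z is the displacement on the lattice, d the true one and s the mesh: rounding costs a term of
    order s, which disappears in the limit. *)
Lemma taylor_round F D C z d s : 0 <= z -> 0 <= d -> s <= 1 -> `|z - d| <= s ->
  `|D| <= C -> `|F - z * D| <= C * z ^+ 2 ->
  `|F - d * D| <= C * d ^+ 2 + C * (2 * d + 2) * s.
Proof.
move=> z0 d0 s1 zd DC H; have C0 : 0 <= C by exact: le_trans DC.
have s0 : 0 <= s by exact: le_trans zd.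
have -> : F - d * D = (F - z * D) + (z - d) * D by ring.
apply: le_trans (ler_normD _ _) _.
have e1 : `|(z - d) * D| <= C * s by rewrite normrM mulrC; exact: ler_pM.
have zs : z <= d + s by move: zd; rewrite ler_distl => /andP[]; lra.
have e2 : z ^+ 2 <= (d + s) ^+ 2 by rewrite ler_pXn2r ?nnegrE //; nneg.
have e3 : z ^+ 2 <= d ^+ 2 + (2 * d + 1) * s by nra.
have := ler_wpM2l C0 e3; lra.
Qed.

End Increments.

Section LatticeToLine.
Context {R : realType}.
Implicit Types (C x y e t : R) (M : nat).

Lemma size_of_lattice (M : nat) : ((8 * 4 ^ M).-2).+2 = (8 * 4 ^ M)%N.
Proof. by have := expn_gt0 4 M; lia. Qed.

(* The lattice [M] has [8 * 4 ^ M] points, enough to resolve [tent i], whose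
   support has width of order [4 ^ - i], for all [i <= M]. *)
Definition lat (M : nat) : nat := (8 * 4 ^ M).-2.
Local Notation h M := (@mesh R (lat M)).
Local Notation tau M := (@time_step R (lat M)).

Lemma lat_size M : (lat M).+2 = (8 * 4 ^ M)%N.
Proof. exact: size_of_lattice. Qed.

Lemma mesh_lat M : h M = pi / 4 / 4 ^+ M.
Proof.
rewrite /mesh lat_size natrM natrX.
by have := expf_neq0 M (_ : 4 != 0 :> R); rewrite pnatr_eq0 => /(_ isT) q; field.
Qed.

Lemma mesh_lat_le1 M : h M <= 1.
Proof.
rewrite mesh_lat ler_pdivrMr ?exprn_gt0 // mul1r.
apply: (@le_trans _ _ 1); first by have := @pihalf_lt2 R; lra.
by rewrite exprn_ege1 // ler1n.
Qed.

Lemma mesh_lat_cvg : (fun M => h M) @ \oo --> (0 : R).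
Proof.
under eq_fun do rewrite mesh_lat -exprVn.
have := @cvgMl_tmp R nat \oo _ (GRing.exp 4^-1) (pi / 4) 0; rewrite mulr0; apply.
by apply: cvg_expr; rewrite gtr0_norm ?invr_gt0 // invf_lt1 // ltr1n.
Qed.

Lemma near_mesh_le e : 0 < e -> \forall M \near \oo, h M <= e.
Proof. by move=> e0; apply: (cvgr_le _ mesh_lat_cvg). Qed.

(* The cast of an integer into ['I_N] makes [idx] periodic. *)
Definition idx (M : nat) (x : R) : 'I_(lat M).+2 := (Num.floor (x / h M))%:~R.
Definition tdx (M : nat) (t : R) : nat := Num.truncn (t / tau M).

Lemma floor_mesh M x : (Num.floor (x / h M))%:~R * h M <= x < (Num.floor (x / h M))%:~R * h M + h M.
Proof.
have h0 := @mesh_gt0 R (lat M); have := floor_itv (x / h M).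
by rewrite ler_pdivlMr // ltr_pdivrMr // intrD mulrDl mul1r.
Qed.

Lemma tdx_itv M t : 0 <= t -> (tdx M t)%:R * tau M <= t < (tdx M t)%:R * tau M + tau M.
Proof.
move=> t0; have tau0 := @tau_gt0 R (lat M).
have := truncn_itv (divr_ge0 t0 (ltW tau0)).
by rewrite -/(tdx M t) ler_pdivlMr // ltr_pdivrMr // -natr1 mulrDl mul1r.
Qed.

Lemma natN0 p : (p.+2)%:R = 0 :> 'I_p.+2.
Proof. by rewrite Zp_nat; apply/val_inj; rewrite /= modnn. Qed.

Lemma idxD2pi M x : idx M (x + 2 * pi) = idx M x.
Proof.
rewrite /idx; have -> : (x + 2 * pi) / h M = x / h M + ((lat M).+2%:Z)%:~R.
  by rewrite -(@mesh_period R (lat M)) mulrDl mulrAC divff ?mesh_neq0 // mul1r.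
by rewrite floorDrz ?intr_int // intrKfloor intrD -pmulrn natN0 addr0.
Qed.

Lemma idx_mesh M (i : 'I_(lat M).+2) x :
  h M * i%:R <= x < h M * i%:R + h M -> idx M x = i.
Proof.
move=> H; have h0 := @mesh_gt0 R (lat M).
have -> : idx M x = (i : nat)%:R.
  rewrite /idx (@floor_def _ _ (i : nat)%:Z) //.
  by rewrite ler_pdivlMr // ltr_pdivrMr // intrD mulrDl mul1r -pmulrn ![_ * h M]mulrC.
by rewrite natr_Zp.
Qed.

Section Lipschitz.
Context {p : nat}.
Implicit Types f : 'I_p.+2 -> R.
Local Notation h' := (@mesh R p).

Lemma dif_step f (i : 'I_p.+2) (k : nat) :
  f (i + k.+1%:R) = f (i + k%:R) + dif f (i + k%:R) * h'.
Proof. by rewrite /dif divfK ?mesh_neq0 // -natr1 addrA; ring. Qed.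

Lemma lattice_lip_nat f C (i : 'I_p.+2) (k : nat) : (forall j, `|dif f j| <= C) ->
  `|f (i + k%:R) - f i| <= C * (k%:R * h').
Proof.
move=> fC; rewrite -{2}(addr0 i).
apply: (@increments_le R (fun j => f (i + j%:R)) (fun j => dif f (i + j%:R))) => // [|j].
  exact/ltW/mesh_gt0.
exact: dif_step.
Qed.

Lemma lattice_taylor_nat f C (i : 'I_p.+2) (k : nat) : (forall j, `|dif (dif f) j| <= C) ->
  `|f (i + k%:R) - f i - k%:R * h' * dif f i| <= C * (k%:R * h') ^+ 2.
Proof.
move=> fC; have C0 : 0 <= C by apply: le_trans (fC 0).
have := @increments_taylor R (fun j => f (i + j%:R)) (fun j => dif f (i + j%:R))
  (fun j => dif (dif f) (i + j%:R)) h' C k; rewrite addr0; apply=> //.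
- exact/ltW/mesh_gt0.
- by move=> j; exact: dif_step.
- by move=> j; exact: dif_step.
Qed.

End Lipschitz.

Lemma idxB M x y : x <= y -> exists k : nat,
  idx M y = idx M x + k%:R /\ `|k%:R * h M - (y - x)| <= h M.
Proof.
move=> xy; have h0 := @mesh_gt0 R (lat M).
have : Num.floor (x / h M) <= Num.floor (y / h M).
  by apply: le_floor; rewrite ler_pM2r // invr_gt0.
rewrite -subr_ge0 => /gez0_abs kE.
exists `|Num.floor (y / h M) - Num.floor (x / h M)|%N; split.
  by rewrite /idx pmulrn kE intrB addrC subrK.
rewrite pmulrn kE intrB mulrBl ler_distl.
have /andP[a1 a2] := floor_mesh M x; have /andP[b1 b2] := floor_mesh M y.
by apply/andP; split; lra.
Qed.

Lemma lattice_lip M f C x y : (forall i, `|dif f i| <= C) ->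
  `|f (idx M y) - f (idx M x)| <= C * (`|y - x| + h M).
Proof.
move=> fC; have C0 : 0 <= C by apply: le_trans (fC 0).
wlog xy : x y / x <= y.
  move=> H; have [|/ltW] := leP x y; first exact: H.
  by rewrite distrC (distrC y); exact: H.
have [k [-> kh]] := idxB M xy.
apply: le_trans (lattice_lip_nat _ _ fC) _; rewrite ler_wpM2l //.
have := ler_norm (y - x); move: kh; rewrite ler_distl => /andP[]; lra.
Qed.

Lemma lattice_taylor M f C x y : (forall i, `|dif f i| <= C) ->
  (forall i, `|dif (dif f) i| <= C) -> x <= y ->
  `|f (idx M y) - f (idx M x) - (y - x) * dif f (idx M x)| <=
    C * (y - x) ^+ 2 + C * (2 * (y - x) + 2) * h M.
Proof.
move=> fC ffC xy; have [k [-> kh]] := idxB M xy.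
apply: taylor_round kh (fC _) _ => //.
- by rewrite mulr_ge0 // ltW // mesh_gt0.
- by rewrite subr_ge0.
- exact: mesh_lat_le1.
- exact: lattice_taylor_nat.
Qed.

End LatticeToLine.

(** * Families of lattice functions with bounds uniform in the mesh *)

Section Families.
Context {R : realType}.
Local Notation h M := (@mesh R (lat M)).
Local Notation tau M := (@time_step R (lat M)).

Definition lattice_family := forall M, nat -> 'I_(lat M).+2 -> R.
Implicit Types (a b : lattice_family) (C d T : R).

(* Bounds uniform in [M] on compact time intervals of (0, +oo). *)
Definition bdd a := forall (j : nat) d T, 0 < d -> exists C, 0 <= C /\
  forall M m i, d <= m%:R * tau M <= T -> `|iter j dif (a M m) i| <= C.

Definition tq a : lattice_family := fun M m i => (a M m.+1 i - a M m i) / tau M.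

Arguments tq a M m i : clear implicits.

(** Linear combinations, products, [dif] and [labs] preserve this property, so the regularity of
    each term of the equation reduces to that of [traj]. *)
Definition good a := bdd a /\ bdd (tq a).

Lemma time_step_le1 M : tau M <= 1.
Proof.
rewrite /time_step ler_pdivrMr // mul1r; apply: le_trans (mesh_lat_le1 M) _.
by rewrite ler1n.
Qed.

Lemma bdd_lin (r s : R) a b : bdd a -> bdd b -> bdd (fun M m i => r * a M m i + s * b M m i).
Proof.
move=> ha hb j d T d0; have [Ca [Ca0 HA]] := ha j _ T d0; have [Cb [Cb0 HB]] := hb j _ T d0.
exists (`|r| * Ca + `|s| * Cb); split=> [|M m i dm]; first by rewrite addr_ge0 ?mulr_ge0.
rewrite iter_dif_lin; apply: le_trans (ler_normD _ _) _; rewrite !normrM.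
by apply: lerD; rewrite ler_wpM2l // ?HA ?HB.
Qed.

Lemma bdd_ext a b : (forall M m i, a M m i = b M m i) -> bdd a -> bdd b.
Proof.
move=> ab ha j d T d0; have [C [C0 HC]] := ha j d T d0; exists C; split=> // M m i H.
by rewrite -(_ : a M m = b M m) ?HC //; apply/funext => k; exact: ab.
Qed.

Lemma bdd_dif a : bdd a -> bdd (fun M m => dif (a M m)).
Proof.
move=> ha j d T d0; have [C [C0 HC]] := ha j.+1 d T d0; exists C; split=> // M m i H.
by rewrite -iterSr HC.
Qed.

Lemma bdd_shift a : bdd a -> bdd (fun M m i => a M m (i + 1)).
Proof.
move=> ha j d T d0; have [C [C0 HC]] := ha j d T d0; exists C; split=> // M m i H.
rewrite (_ : iter j dif _ i = iter j dif (a M m) (i + 1)) ?HC //.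
by elim: j {ha C C0 HC} i => [//|j IH] i; rewrite !iterS /dif !IH.
Qed.

Lemma bdd_mul a b : bdd a -> bdd b -> bdd (fun M m i => a M m i * b M m i).
Proof.
move=> ha hb j; elim: j a b ha hb => [|j IH] a b ha hb d T d0.
  have [Ca [Ca0 HA]] := ha 0%N _ T d0; have [Cb [Cb0 HB]] := hb 0%N _ T d0.
  exists (Ca * Cb); split=> [|M m i dm]; first by rewrite mulr_ge0.
  by rewrite /= normrM ler_pM // ?HA ?HB.
have [C1 [C10 H1]] := IH _ _ ha (bdd_dif hb) _ T d0.
have [C2 [C20 H2]] := IH _ _ (bdd_dif ha) (bdd_shift hb) _ T d0.
exists (1 * C1 + 1 * C2); split=> [|M m i dm]; first by nneg.
rewrite iterSr dif_mul.
have -> : (fun x => a M m x * dif (b M m) x + dif (a M m) x * b M m (x + 1)) =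
  (fun x => 1 * (a M m x * dif (b M m) x) + 1 * (dif (a M m) x * b M m (x + 1))).
  by apply/funext => x; rewrite !mul1r.
rewrite iter_dif_lin !mul1r; apply: le_trans (ler_normD _ _) _.
by apply: lerD; [exact: H1|exact: H2].
Qed.

Lemma nrm_le_sup p (f : 'I_p.+2 -> R) C : 0 <= C -> (forall i, `|f i| <= C) -> nrm f <= 3 * C.
Proof.
move=> C0 fC; apply: nrm_le; first by nneg.
apply: (@le_trans _ _ (@mesh R p * \sum_(x < p.+2) C ^+ 2)).
  rewrite ler_pM2l ?mesh_gt0 //; apply: ler_sum => x _.
  rewrite -expr2 -[leLHS]real_normK ?num_real //.
  by rewrite ler_pXn2r ?nnegrE.
rewrite sumr_const card_ord -[C ^+ 2 *+ _]mulr_natl mulrA mesh_period.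
have := @pihalf_lt2 R; have := sqr_ge0 C; rewrite exprMn => c2 p2.
by rewrite ler_wpM2r //; lra.
Qed.

(** A sup bound on f does not bound [labs f] uniformly in the mesh; Agmon's inequality supplies one
    from the next two differences, which [bdd] provides at every order. *)
Lemma bdd_labs a : bdd a -> bdd (fun M m => labs (a M m)).
Proof.
move=> ha j d T d0.
have [C1 [C10 H1]] := ha j.+1 _ T d0; have [C2 [C20 H2]] := ha j.+2 _ T d0.
exists (3 * (C1 + C2) + 3 * (C1 + C2)); split=> [|M m i dm]; first by nneg.
rewrite -labs_iter_dif; apply: le_trans (labs_le_supn (a M m) j i) _.
rewrite -(ler_pXn2r (ltn0Sn 1)) ?nnegrE ?supn_ge0 //; last by nneg.
rewrite supn_sqr.
have b1 : nrm (iter j.+1 dif (a M m)) <= 3 * (C1 + C2).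
  apply: nrm_le_sup => [|k]; first by nneg.
  by apply: le_trans (H1 M m k dm) _; rewrite lerDl.
have b2 : nrm (iter j.+2 dif (a M m)) <= 3 * (C1 + C2).
  apply: nrm_le_sup => [|k]; first by nneg.
  by apply: le_trans (H2 M m k dm) _; rewrite lerDr.
have := ler_pM (nrm_ge0 _) (nrm_ge0 _) b1 b2; have := sqr_ge0 (3 * (C1 + C2)); nra.
Qed.

Lemma bdd_next a : bdd a -> bdd (fun M m => a M m.+1).
Proof.
move=> ha j d T d0; have [C [C0 HC]] := ha j d (T + 1) d0; exists C; split=> // M m i /andP[dm mT].
apply: HC; rewrite -natr1 mulrDl mul1r; have := time_step_le1 M; have := @tau_gt0 R (lat M).
by move=> t0 t1; apply/andP; split; lra.
Qed.

Lemma good_lin (r s : R) a b : good a -> good b -> good (fun M m i => r * a M m i + s * b M m i).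
Proof.
move=> [a1 a2] [b1 b2]; split; first exact: bdd_lin.
by apply: bdd_ext (bdd_lin r s a2 b2) => M m i; rewrite /tq; ring.
Qed.

Lemma good_ext a b : (forall M m i, a M m i = b M m i) -> good a -> good b.
Proof.
move=> ab [a1 a2]; split; first exact: bdd_ext a1.
by apply: bdd_ext a2 => M m i; rewrite /tq !ab.
Qed.

Lemma good_mul a b : good a -> good b -> good (fun M m i => a M m i * b M m i).
Proof.
move=> [a1 a2] [b1 b2]; split; first exact: bdd_mul.
apply: bdd_ext (bdd_lin 1 1 (bdd_mul a1 b2) (bdd_mul a2 (bdd_next b1))) => M m i.
by rewrite /tq; field; rewrite gt_eqF // tau_gt0.
Qed.

Lemma good_labs a : good a -> good (fun M m => labs (a M m)).
Proof.
move=> [a1 a2]; split; first exact: bdd_labs.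
apply: bdd_ext (bdd_labs a2) => M m i; rewrite /tq /labs -sumrB mulr_suml.
by apply: eq_bigr => y _; ring.
Qed.

Lemma good_dif a : good a -> good (fun M m => dif (a M m)).
Proof.
move=> [a1 a2]; split; first exact: bdd_dif.
by apply: bdd_ext (bdd_dif a2) => M m i; rewrite /tq /dif; ring.
Qed.

Definition data (M : nat) : R -> R := fun x => 1 / 100 * sin (tents M.+1 x).

Definition traj : lattice_family := fun M m => iter m step (sample (data M)).

Arguments traj M m i : clear implicits.

Lemma trajS M m : traj M m.+1 = step (traj M m).
Proof. by []. Qed.

Lemma data_le M x : `|data M x| <= 1 / 100.
Proof. by rewrite /data normrM ger0_norm // ler_piMr // sin_max. Qed.

Lemma traj_le M m i : `|traj M m i| <= 1 / 100.
Proof. by apply: traj_max (@trajS M) _ m i => k; exact: data_le. Qed.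

Lemma traj_energy0 M : en (traj M 0) <= 1.
Proof. exact: sin_tents_energy_le (lat_size M). Qed.

(** Energies of two consecutive orders bound the norm of the higher order by interpolation, and two
    consecutive norms bound a sup norm by Agmon; hence the energies up to order j+2. *)
Lemma bdd_traj : bdd traj.
Proof.
move=> j d T d0; case: j => [|j].
  by exists (1 / 100); split=> // M m i _; exact: traj_le.
have [C [C0 HC]] := @uniform_energy R 1 j.+2 d T d0.
have NB M m k : d <= m%:R * tau M <= T -> (k <= j.+1)%N -> nrm (iter k.+1 dif (traj M m)) ^+ 2 <= C.
  move=> dm kj; have H := en_interp (iter k dif (traj M m)).
  have e1 : en (iter k dif (traj M m)) <= C.
    exact: (HC _ (traj M) (@trajS M) (fun x => data_le M _) (traj_energy0 M) m k dm (leqW kj)).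
  have e2 : en (iter k.+1 dif (traj M m)) <= C.
    exact: (HC _ (traj M) (@trajS M) (fun x => data_le M _) (traj_energy0 M) m k.+1 dm kj).
  rewrite -(ler_pXn2r (ltn0Sn 1)) ?nnegrE ?sqr_ge0 //; apply: le_trans H _.
  by rewrite [leRHS]expr2; apply: ler_pM => //; exact: en_ge0.
exists (C + C + 1); split=> [|M m i dm]; first by nneg.
apply: le_trans (dif_le_supn (traj M m) j i) _.
have n1 := NB M m j dm (leqnSn j); have n2 := NB M m j.+1 dm (leqnn _).
rewrite -(ler_pXn2r (ltn0Sn 1)) ?nnegrE ?supn_ge0 //; last by nneg.
rewrite supn_sqr; set x := nrm _ in n1 *; set y := nrm _ in n2 *.
by have := sqr_ge0 (x - y); nra.
Qed.

Lemma good_traj : good traj.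
Proof.
have b := bdd_traj; split=> //.
have b1 := bdd_labs b; have b2 := bdd_labs (bdd_mul b b).
apply: bdd_ext (bdd_lin 1 1 (bdd_lin (-1) 1 b1 (bdd_mul b b1)) (bdd_lin (-1) 0 b2 b2)) => M m i.
rewrite /tq trajS /step /rhs /quad; field.
by rewrite gt_eqF // tau_gt0.
Qed.

Lemma tq_traj M m i : tq traj M m i = rhs (traj M m) i.
Proof.
by rewrite /tq trajS /step addrC addKr mulrC mulKf // gt_eqF // tau_gt0.
Qed.

Lemma good_labs_traj : good (fun M m => labs (traj M m)).
Proof. exact: good_labs good_traj. Qed.

Lemma good_labs_traj2 : good (fun M m => labs (fun i => traj M m i * traj M m i)).
Proof. exact: good_labs (good_mul good_traj good_traj). Qed.

Lemma good_rhs_traj : good (fun M m => rhs (traj M m)).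
Proof.
have b := good_traj; have b1 := good_labs_traj; have b2 := good_labs_traj2.
apply: good_ext (good_lin 1 1 (good_lin (-1) 1 b1 (good_mul b b1)) (good_lin (-1) 0 b2 b2)) => M m i.
by rewrite /rhs /quad; ring.
Qed.

Section Limits.
Variable (U : set_system nat).
Context {UU : UltraFilter U}.
Hypothesis Uoo : \oo `<=` U.

(** Limit of the piecewise constant interpolants, which are discontinuous: continuity and
    differentiability appear only in the limit, from the bounds on differences. *)
Definition lims a (t x : R) : R := ulim U (fun M => a M (tdx M t) (idx M x)).

(** Times are rounded down to the grid, so a lower bound d survives only as d / 2, and for fine
    meshes. *)
Lemma near_time d T : 0 < d -> \forall M \near U,
  forall t, d <= t <= T -> d / 2 <= (tdx M t)%:R * tau M <= T.
Proof.
move=> d0; apply: Uoo.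
have d20 : 0 < d / 2 by rewrite divr_gt0.
apply: filterS (near_mesh_le d20) => M hd t /andP[dt tT].
have t0 : 0 <= t by apply: le_trans dt; exact: ltW.
have /andP[a1 a2] := tdx_itv M t0.
have h0 := @mesh_gt0 R (lat M).
move: a1 a2; rewrite /time_step => a1 a2; apply/andP; split; lra.
Qed.

Lemma near_mesh e : 0 < e -> \forall M \near U, h M <= e.
Proof. by move=> e0; apply: Uoo; exact: near_mesh_le. Qed.

Lemma near_bdd a j d T : bdd a -> 0 < d -> exists C, 0 <= C /\
  \forall M \near U, forall t i, d <= t <= T -> `|iter j dif (a M (tdx M t)) i| <= C.
Proof.
move=> ha d0; have d20 : 0 < d / 2 by rewrite divr_gt0.
have [C [C0 HC]] := ha j _ T d20; exists C; split=> //.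
by apply: filterS (near_time T d0) => M H t i dt; apply: HC; exact: H.
Qed.

Lemma lims_cvg a t x : bdd a -> 0 < t ->
  (fun M => a M (tdx M t) (idx M x)) @ U --> lims a t x.
Proof.
move=> ha t0; have [C [C0 HC]] := near_bdd 0 t ha t0.
apply: (@ulim_cvg _ _ _ _ C); apply: filterS HC => M H.
by apply: H; rewrite lexx.
Qed.

Lemma lims_periodic a t x : lims a t (x + 2 * pi) = lims a t x.
Proof. by rewrite /lims; congr ulim; apply/funext => M; rewrite idxD2pi. Qed.

Lemma lims_norm_le a t x C : bdd a -> 0 < t ->
  (forall M m i, `|a M m i| <= C) -> `|lims a t x| <= C.
Proof.
move=> ha t0 aC; rewrite -[lims _ _ _]subr0.
apply: (ucvg_dist_le (lims_cvg (x := x) ha t0)) => e e0.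
by apply: nearW => M; rewrite subr0; apply: le_trans (aC _ _ _) _; rewrite lerDl ltW.
Qed.

Lemma lims_lip_x a d T : bdd a -> 0 < d -> exists C, 0 <= C /\
  forall t x y, d <= t <= T -> `|lims a t y - lims a t x| <= C * `|y - x|.
Proof.
move=> ha d0; have [C [C0 HC]] := near_bdd 1 T ha d0.
exists C; split=> // t x y dt.
have t0 : 0 < t by apply: lt_le_trans d0 _; case/andP: dt.
rewrite -[_ - _]subr0.
apply: (ucvg_dist_le (cvgB (lims_cvg (x := y) ha t0) (lims_cvg (x := x) ha t0))) => e e0.
have e1 : 0 < e / (C + 1) by rewrite divr_gt0 // ltr_wpDl.
near=> M.
have H : forall t i, d <= t <= T -> `|iter 1 dif (a M (tdx M t)) i| <= C by near: M.
have hM : h M <= e / (C + 1) by near: M; exact: near_mesh.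
have h0 := @mesh_gt0 R (lat M).
rewrite subr0; apply: le_trans (lattice_lip x y (fun i => H t i dt)) _.
rewrite mulrDr lerD2l; move: hM; rewrite ler_pdivlMr ?ltr_wpDl // => hM; nra.
Unshelve. all: by end_near. Qed.

Lemma traj_lip_nat a (M m k : nat) i C d T :
  (forall m i, d <= m%:R * tau M <= T -> `|tq a M m i| <= C) ->
  d <= m%:R * tau M -> (m + k)%:R * tau M <= T ->
  `|a M (m + k)%N i - a M m i| <= C * (k%:R * tau M).
Proof.
move=> H dm kT; have t0 := @tau_gt0 R (lat M); rewrite -{2}[m]addn0.
apply: (@increments_le R (fun j => a M (m + j)%N i) (fun j => tq a M (m + j)%N i)) => [|j|j jk].
- exact: ltW.
- by rewrite /tq divfK ?gt_eqF // addnS; ring.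
apply: H; rewrite (le_trans dm) ?ler_pM2r ?ler_nat ?leq_addr //=.
by apply: le_trans kT; rewrite ler_pM2r // ler_nat leq_add2l ltnW.
Qed.

Lemma tdxB M s t : 0 <= s -> s <= t -> exists k : nat,
  tdx M t = (tdx M s + k)%N /\ `|k%:R * tau M - (t - s)| <= tau M.
Proof.
move=> s0 st; have t0 := @tau_gt0 R (lat M).
have le : (tdx M s <= tdx M t)%N by apply: le_truncn; rewrite ler_pM2r // invr_gt0.
exists (tdx M t - tdx M s)%N; split; first by rewrite subnKC.
rewrite natrB // mulrBl ler_distl.
have /andP[a1 a2] := tdx_itv M s0; have /andP[b1 b2] := tdx_itv M (le_trans s0 st).
by apply/andP; split; lra.
Qed.

Lemma lims_lip_t a d T : good a -> 0 < d -> exists C, 0 <= C /\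
  forall s t x, d <= s <= T -> d <= t <= T -> `|lims a t x - lims a s x| <= C * `|t - s|.
Proof.
move=> [ha hq] d0; have d20 : 0 < d / 2 by rewrite divr_gt0.
have [C [C0 HC]] := hq 0%N _ T d20.
exists C; split=> // s t x ds dt.
wlog st : s t ds dt / s <= t.
  move=> H; have [|/ltW] := leP s t; first exact: H.
  by rewrite distrC (distrC t); exact: H.
have s0 : 0 < s by apply: lt_le_trans d0 _; case/andP: ds.
have t0 : 0 < t by apply: lt_le_trans d0 _; case/andP: dt.
rewrite -[_ - _]subr0.
apply: (ucvg_dist_le (cvgB (lims_cvg (x := x) ha t0) (lims_cvg (x := x) ha s0))) => e e0.
have e1 : 0 < e / (C + 1) by rewrite divr_gt0 // ltr_wpDl.
near=> M.
have hM : h M <= e / (C + 1) by near: M; exact: near_mesh.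
have hT : forall t, d <= t <= T -> d / 2 <= (tdx M t)%:R * tau M <= T.
  by near: M; exact: near_time.
have h0 := @mesh_gt0 R (lat M).
have [k [tE kh]] := tdxB M (ltW s0) st.
have /andP[t1 t2] := hT t dt; have /andP[s1 s2] := hT s ds.
rewrite tE in t2.
rewrite subr0 !fctE tE; apply: le_trans (traj_lip_nat (idx M x) (HC M) s1 t2) _.
have ts : `|t - s| = t - s by rewrite ger0_norm // subr_ge0.
rewrite ts; move: kh; rewrite ler_distl => /andP[_ kh].
apply: (@le_trans _ _ (C * (t - s + tau M))); first by rewrite ler_wpM2l.
rewrite mulrDr lerD2l; move: hM; rewrite ler_pdivlMr ?ltr_wpDl // /time_step => hM; nra.
Unshelve. all: by end_near. Qed.

(** The lattice estimates give an expansion forwards only; exchanging the endpoints and the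
    Lipschitz bound on F' give it backwards. *)
Lemma taylor_sym (P : R -> Prop) (F F' : R -> R) C C' :
  (forall x y, P x -> P y -> x <= y -> `|F y - F x - (y - x) * F' x| <= C * (y - x) ^+ 2) ->
  (forall x y, P x -> P y -> `|F' y - F' x| <= C' * `|y - x|) ->
  forall x y, P x -> P y -> `|F y - F x - (y - x) * F' x| <= (C + `|C'|) * (y - x) ^+ 2.
Proof.
move=> H1 H2 x y Px Py; have [xy|/ltW yx] := leP x y.
  by apply: le_trans (H1 x y Px Py xy) _; rewrite ler_wpM2r ?sqr_ge0 // lerDl.
have -> : F y - F x - (y - x) * F' x = - (F x - F y - (x - y) * F' y) + (x - y) * (F' x - F' y) by ring.
apply: le_trans (ler_normD _ _) _; rewrite normrN.
have -> : (y - x) ^+ 2 = (x - y) ^+ 2 by ring.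
rewrite [leRHS]mulrDl; apply: lerD; first exact: H1.
have xy0 : 0 <= x - y by rewrite subr_ge0.
rewrite normrM (ger0_norm xy0) expr2 mulrCA ler_wpM2l //.
apply: le_trans (H2 y x Py Px) _; rewrite (ger0_norm xy0) ler_wpM2r //.
exact: ler_norm.
Qed.

Lemma lims_taylor_x a d T : bdd a -> 0 < d -> exists C, 0 <= C /\
  forall t x y, d <= t <= T ->
    `|lims a t y - lims a t x - (y - x) * lims (fun M m => dif (a M m)) t x| <= C * (y - x) ^+ 2.
Proof.
move=> ha d0; have [C1 [C10 HC1]] := near_bdd 1 T ha d0.
have [C2 [C20 HC2]] := near_bdd 2 T ha d0.
have [C' [C'0 HC']] := lims_lip_x T (bdd_dif ha) d0.
exists (C1 + C2 + `|C'|); split=> [|t x y dt]; first by rewrite addr_ge0 // addr_ge0.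
apply: (@taylor_sym (fun=> True) (lims a t) (lims (fun M m => dif (a M m)) t)) => // {x y}; last first.
  by move=> x y _ _; exact: HC'.
move=> x y _ _ xy.
have t0 : 0 < t by apply: lt_le_trans d0 _; case/andP: dt.
rewrite -[_ - _ * _]subr0.
apply: (ucvg_dist_le (cvgB (cvgB (lims_cvg (x := y) ha t0) (lims_cvg (x := x) ha t0))
  (cvgMl_tmp (a := y - x) (lims_cvg (x := x) (bdd_dif ha) t0)))) => e e0.
set C := C1 + C2; have C0 : 0 <= C by rewrite /C addr_ge0.
have yx : 0 <= y - x by rewrite subr_ge0.
pose K := C * (2 * (y - x) + 2); have K0 : 0 <= K by rewrite /K; nneg.
have e1 : 0 < e / (K + 1) by rewrite divr_gt0 // ltr_wpDl.
near=> M.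
have H1 : forall t i, d <= t <= T -> `|iter 1 dif (a M (tdx M t)) i| <= C1 by near: M.
have H2 : forall t i, d <= t <= T -> `|iter 2 dif (a M (tdx M t)) i| <= C2 by near: M.
have hM : h M <= e / (K + 1) by near: M; exact: near_mesh.
have h0 := @mesh_gt0 R (lat M).
have D1 i : `|dif (a M (tdx M t)) i| <= C by apply: le_trans (H1 t i dt) _; rewrite lerDl.
have D2 i : `|dif (dif (a M (tdx M t))) i| <= C by apply: le_trans (H2 t i dt) _; rewrite lerDr.
rewrite subr0; apply: le_trans (lattice_taylor D1 D2 xy) _.
rewrite lerD2l -/K; move: hM; rewrite ler_pdivlMr ?ltr_wpDl // => hM; nra.
Unshelve. all: by end_near. Qed.

Lemma traj_taylor_nat a (M m k : nat) i C d T :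
  (forall m i, d <= m%:R * tau M <= T -> `|tq (tq a) M m i| <= C) -> 0 <= C ->
  d <= m%:R * tau M -> (m + k)%:R * tau M <= T ->
  `|a M (m + k)%N i - a M m i - k%:R * tau M * tq a M m i| <= C * (k%:R * tau M) ^+ 2.
Proof.
move=> H C0 dm kT; have t0 := @tau_gt0 R (lat M).
have S b j : b M (m + j.+1)%N i = b M (m + j)%N i + tq b M (m + j)%N i * tau M.
  by rewrite /tq divfK ?gt_eqF // addnS; ring.
have := @increments_taylor R (fun j => a M (m + j)%N i) (fun j => tq a M (m + j)%N i)
  (fun j => tq (tq a) M (m + j)%N i) (tau M) C k (ltW t0) C0 (S a) (S (tq a)).
rewrite addn0; apply=> j jk; apply: H.
rewrite (le_trans dm) ?ler_pM2r ?ler_nat ?leq_addr //=.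
by apply: le_trans kT; rewrite ler_pM2r // ler_nat leq_add2l ltnW.
Qed.

Lemma lims_taylor_t a d T : good a -> good (tq a) -> 0 < d -> exists C, 0 <= C /\
  forall s t x, d <= s <= T -> d <= t <= T ->
    `|lims a t x - lims a s x - (t - s) * lims (tq a) s x| <= C * (t - s) ^+ 2.
Proof.
move=> [ha _] gq d0; have [hq hqq] := gq.
have d20 : 0 < d / 2 by rewrite divr_gt0.
have [C1 [C10 HC1]] := hq 0%N _ T d20.
have [C2 [C20 HC2]] := hqq 0%N _ T d20.
have [C' [C'0 HC']] := lims_lip_t T gq d0.
exists (C1 + C2 + `|C'|); split=> [|s t x ds dt]; first by rewrite addr_ge0 // addr_ge0.
pose P t := d <= t <= T.
apply: (@taylor_sym P (lims a ^~ x) (lims (tq a) ^~ x)) => // {s t ds dt}; last first.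
  by move=> s t ds dt; exact: HC'.
move=> s t ds dt st.
have s0 : 0 < s by apply: lt_le_trans d0 _; case/andP: ds.
have t0 : 0 < t by apply: lt_le_trans d0 _; case/andP: dt.
rewrite -[_ - _ * _]subr0.
apply: (ucvg_dist_le (cvgB (cvgB (lims_cvg (x := x) ha t0) (lims_cvg (x := x) ha s0))
  (cvgMl_tmp (a := t - s) (lims_cvg (x := x) hq s0)))) => e e0.
set C := C1 + C2; have C0 : 0 <= C by rewrite /C addr_ge0.
have ts : 0 <= t - s by rewrite subr_ge0.
pose K := C * (2 * (t - s) + 2); have K0 : 0 <= K by rewrite /K; nneg.
have e1 : 0 < e / (K + 1) by rewrite divr_gt0 // ltr_wpDl.
near=> M.
have hM : h M <= e / (K + 1) by near: M; exact: near_mesh.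
have hT : forall t, d <= t <= T -> d / 2 <= (tdx M t)%:R * tau M <= T.
  by near: M; exact: near_time.
have h0 := @mesh_gt0 R (lat M); have tau0 := @tau_gt0 R (lat M); have tau1 := time_step_le1 M.
have [k [tE kh]] := tdxB M (ltW s0) st.
have /andP[t1 t2] := hT t dt; have /andP[s1 s2] := hT s ds.
have := HC1 M (tdx M s) (idx M x) (hT s ds); rewrite tE in t2; rewrite /= => HD.
have T1 := traj_taylor_nat (idx M x) (HC2 M) C20 s1 t2.
rewrite subr0 !fctE tE.
have DC : `|tq a M (tdx M s) (idx M x)| <= C by apply: le_trans HD _; rewrite /C lerDl.
have k0 : 0 <= k%:R * tau M by rewrite mulr_ge0 // ltW.
apply: le_trans (taylor_round k0 ts tau1 kh DC (le_trans T1 _)) _.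
  by rewrite ler_wpM2r ?sqr_ge0 // /C lerDr.
rewrite lerD2l -/K; move: hM; rewrite ler_pdivlMr ?ltr_wpDl // => hM.
apply: (@le_trans _ _ (h M * (K + 1))) => //.
have : tau M <= h M by rewrite /time_step; lra.
nra.
Unshelve. all: by end_near. Qed.

End Limits.

End Families.

Arguments tq {R} a M m i.
Arguments traj {R} M m i.

(** * Integrals over the torus *)

Section BoundedIntegrals.
Context d (T : measurableType d) {R : realType} (mu : {measure set T -> \bar R}).
Hypothesis mufin : (mu setT < +oo)%E.
Implicit Types (f g : T -> R) (C : R).

Lemma bounded_integrable f C (D : set T) : measurable D -> measurable_fun setT f ->
  (forall x, `|f x| <= C) -> mu.-integrable D (EFin \o f).
Proof.
move=> mD mf fC; apply: measurable_bounded_integrable => //.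
- by apply: le_lt_trans mufin; apply: le_measure; rewrite ?inE.
- exact: measurable_funTS.
- by exists C; split; [rewrite num_real|move=> x Cx y _; apply: le_trans (fC y) (ltW Cx)].
Qed.

Lemma bounded_Rintegral_le f C (D : set T) : measurable D -> measurable_fun setT f ->
  (forall x, `|f x| <= C) -> forall c, (forall x, D x -> `|f x| <= c) ->
  `|\int[mu]_(x in D) f x| <= c * fine (mu D).
Proof.
move=> mD mf fC c fc; have fi := bounded_integrable mD mf fC.
apply: le_trans (le_normr_Rintegral mD fi) _; rewrite -Rintegral_cst //.
apply: le_Rintegral => //.
  apply: (bounded_integrable (C := C)) => //; first exact: measurableT_comp.
  by move=> x; rewrite normr_id.
by apply: (bounded_integrable (C := `|c|)).
Qed.

End BoundedIntegrals.

Section Circle.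
Context {R : realType}.
Local Notation mu := (@circle_measure R).
Local Notation RR := (measurableTypeR R).

Lemma circle_itv (a b : R) : 0 <= a -> a <= b -> b <= 2 * pi ->
  mu `[a, b[%classic = (b - a)%:E.
Proof.
move=> a0 ab b2; rewrite /circle_measure /= /mrestr.
rewrite (_ : _ `&` _ = `[a, b[%classic).
  rewrite lebesgue_measure_itv /= lte_fin; case: ltP => // ba.
  by rewrite (_ : a = b) ?subrr //; apply/eqP; rewrite eq_le ab.
apply/seteqP; split => x /=; rewrite !in_itv /=; first by case.
move=> /andP[ax xb]; split; first by rewrite ax.
by rewrite (le_trans a0 ax) /= (le_trans (ltW xb)).
Qed.

Lemma circle_outside : mu (~` `[0, 2 * pi[%classic) = 0%E.
Proof.
rewrite /circle_measure /= /mrestr.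
rewrite (_ : _ `&` _ = [set (2 * pi : R)]) ?lebesgue_measure_set1 //.
have p0 := @pi_gt0 R.
apply/seteqP; split => x /=; rewrite !in_itv /=.
  move=> [H /andP[x0 x2]]; apply/eqP; rewrite eq_le x2 /= leNgt; apply/negP => x2'.
  by apply: H; rewrite x0.
by move=> ->; rewrite ltxx lexx andbF mulr_ge0 // ltW.
Qed.

(** [idx] sends 2 pi back to 0, so the lattice cells tile the half-open interval only; the endpoint
    has measure 0. *)
Lemma circle_Rintegral_period (F : RR -> R) C : measurable_fun setT F ->
  (forall x, `|F x| <= C) ->
  \int[mu]_x F x = \int[mu]_(x in `[0, 2 * pi[%classic) F x.
Proof.
move=> mF FC; have fin := @circle_measure_lty R.
have mI : measurable (`[0, 2 * pi[%classic : set RR) by exact: measurable_itv.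
have -> : \int[mu]_x F x = \int[mu]_(x in `[0, 2 * pi[%classic `|` ~` `[0, 2 * pi[%classic) F x.
  by rewrite setUv.
rewrite Rintegral_setU //; last 3 first.
- exact: measurableC.
- by rewrite setUv; exact: bounded_integrable FC.
- by apply/disj_setPS; rewrite setICr.
rewrite [X in _ + X](_ : _ = 0) ?addr0 //.
apply/eqP; rewrite -normr_le0.
have := @bounded_Rintegral_le _ _ _ mu fin F C _ (measurableC mI) mF FC C (fun x _ => FC x).
by rewrite circle_outside /= mulr0.
Qed.

Lemma riemann_sum M (F : RR -> R) (b : 'I_(lat M).+2 -> R) (C e : R) :
  measurable_fun setT F -> (forall x, `|F x| <= C) ->
  (forall x, 0 <= x < 2 * pi -> `|F x - b (idx M x)| <= e) ->
  `|\int[mu]_x F x - mesh (lat M) * \sum_i b i| <= 2 * pi * e.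
Proof.
move=> mF FC Fb; have fin := @circle_measure_lty R.
set h := mesh (lat M); have h0 : 0 < h by exact: mesh_gt0.
rewrite (circle_Rintegral_period mF FC).
have hN : h * (lat M).+2%:R = 2 * pi by exact: mesh_period.
pose B (n : nat) := b (n%:R).
have key (n : nat) : (n <= (lat M).+2)%N ->
   `|\int[mu]_(x in `[0, h * n%:R[%classic) F x - h * \sum_(i < n) B i| <= h * n%:R * e.
  elim: n => [|n IHn] nN.
    rewrite big_ord0 !mulr0 mul0r subr0.
    by rewrite set_itvco0 Rintegral_set0 normr0.
  have nh : h * n%:R <= h * n.+1%:R by rewrite ler_pM2l // ler_nat.
  have n0 : 0 <= h * n%:R by rewrite mulr_ge0 // ltW.
  have n2 : h * n.+1%:R <= 2 * pi by rewrite -hN ler_pM2l // ler_nat.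
  have -> : `[0, h * n.+1%:R[%classic = `[0, h * n%:R[%classic `|` `[h * n%:R, h * n.+1%:R[%classic :> set RR.
    by rewrite -itv_bndbnd_setU // bnd_simp.
  rewrite Rintegral_setU //; last 2 first.
  - by apply: bounded_integrable FC => //; apply: measurableU.
  - apply/disj_setPS => x /=; rewrite !in_itv /= => -[/andP[_ a1] /andP[a2 _]].
    by have := lt_le_trans a1 a2; rewrite ltxx.
  set I := `[h * n%:R, h * n.+1%:R[%classic.
  rewrite big_ord_recr /=.
  have -> : \int[mu]_(x in `[0, h * n%:R[%classic) F x + \int[mu]_(x in I) F x -
      h * (\sum_(i < n) B i + B n) =
      (\int[mu]_(x in `[0, h * n%:R[%classic) F x - h * \sum_(i < n) B i) +
      (\int[mu]_(x in I) F x - h * B n) by ring.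
  apply: le_trans (ler_normD _ _) _.
  have -> : h * n.+1%:R * e = h * n%:R * e + e * h by rewrite -natr1; ring.
  apply: lerD; first exact/IHn/ltnW.
  have mI : measurable (I : set RR) by exact: measurable_itv.
  have muI : mu I = h%:E by rewrite circle_itv // -natr1; congr _%:E; ring.
  have -> : \int[mu]_(x in I) F x - h * B n = \int[mu]_(x in I) (F x - B n).
    rewrite RintegralB //; last 2 first.
    - exact: bounded_integrable FC.
    - by apply: (@bounded_integrable _ _ _ mu fin _ `|B n|).
    by rewrite Rintegral_cst // muI /= mulrC.
  rewrite -[h in e * h]/(fine h%:E) -muI.
  apply: (@bounded_Rintegral_le _ _ _ mu fin _ (C + `|B n|)) => //.
  - by apply: measurable_funB.
  - by move=> x; apply: le_trans (ler_normB _ _) _; rewrite lerD2r.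
  move=> x; rewrite /I /= in_itv /= => /andP[x1 x2].
  have -> : B n = b (idx M x).
    rewrite /B; congr b; have nlt : (n < (lat M).+2)%N by [].
    rewrite (@idx_mesh _ M (Ordinal nlt)) /=.
      by rewrite -[RHS]natr_Zp.
    by move: x2; rewrite -natr1 mulrDr mulr1 => ->; rewrite x1.
  by apply: Fb; rewrite (le_trans n0 x1) (lt_le_trans x2).
have := key _ (leqnn _); rewrite hN.
by under eq_bigr do rewrite /B natr_Zp.
Qed.

End Circle.

Section TorusIntegral.
Context {R : realType}.
Local Notation RR := (measurableTypeR R).
Local Notation mu := (@circle_measure R).
Local Notation tor := (@torus_measure R).

Lemma torus_fin n : (tor n setT < +oo)%E.
Proof. by rewrite -ge0_fin_numE ?measure_ge0 // fin_num_measure. Qed.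

Lemma circle_itv_lty : (@lebesgue_measure R `[0%R, (2 * pi)%R]%classic < +oo)%E.
Proof. by have := circle_measure_lty (R := R); rewrite /circle_measure /= /mrestr setTI. Qed.

(* [circle_measure] packed as a finite measure, as Fubini's theorem requires. *)
Definition circle_fmeasure : {finite_measure set RR -> \bar R} :=
  @mfrestr _ RR R _ (@lebesgue_measure R) (measurable_itv `[0, 2 * pi]) circle_itv_lty.

Lemma torus_Rintegral_prod n (G : n.+1.-tuple RR -> R) (F : RR -> R) (H : n.-tuple RR -> R)
    (C D E : R) :
  measurable_fun setT G -> measurable_fun setT F -> measurable_fun setT H ->
  (forall x, `|G x| <= C) -> (forall x, `|F x| <= D) -> (forall x, `|H x| <= E) ->
  (forall x y, G (tuple_cons (x, y)) = F x * H y) ->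
  (\int[tor n.+1]_x G x = \int[mu]_x F x * \int[tor n]_y H y)%R.
Proof.
move=> mG mF mH GC FD HE GFH.
have FH := bounded_integrable (torus_fin n) measurableT mH HE.
have FF := bounded_integrable (circle_measure_lty (R := R)) measurableT mF FD.
have FG := bounded_integrable (torus_fin n.+1) measurableT mG GC.
have mGc : measurable_fun setT (G \o @tuple_cons R n).
  by apply: measurableT_comp => //; exact: measurable_tuple_cons.
have fin2 : ((circle_fmeasure \x tor n)%E setT < +oo)%E.
  rewrite -setXTT product_measure1E // lte_mul_pinfty ?measure_ge0 //.
    by rewrite fin_num_measure.
  exact: torus_fin.
have I2 := bounded_integrable fin2 measurableT mGc (fun x => GC _).
rewrite /Rintegral; transitivity (fine (\int[circle_fmeasure \x tor n]_z (EFin \o (G \o @tuple_cons R n)) z)).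
  congr fine; rewrite -[LHS]/(\int[pushforward (circle_fmeasure \x tor n)%E (@tuple_cons R n)]_y (EFin \o G) y)%E.
  by rewrite integral_pushforward //; exact/measurable_EFinP.
rewrite -(integral12_prod_meas1 I2).
have -> : (\int[circle_fmeasure]_x fubini_F (tor n) (EFin \o (G \o @tuple_cons R n)) x =
    \int[circle_fmeasure]_x ((F x * \int[tor n]_y H y)%R)%:E)%E.
  apply: eq_integral => x _; rewrite /fubini_F.
  under eq_integral do rewrite /= GFH EFinM.
  by rewrite integralZl // EFinM fineK // integrable_fin_num.
rewrite -[RHS]/(\int[mu]_x F x * \int[tor n]_y H y)%R.
by rewrite -[RHS](@RintegralZr _ _ _ mu) .
Qed.

Lemma measurable_dotv n (xi : 'rV[R]_n) :
  measurable_fun setT (fun x : n.-tuple RR => dotv xi (torus_pt x)).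
Proof.
rewrite /dotv; apply: measurable_sum => i.
apply: measurable_funM => //.
rewrite (_ : (fun x => _) = @tnth n RR ^~ i); first exact: measurable_tnth.
by apply/funext => x; rewrite mxE.
Qed.

Definition rbehead n (xi : 'rV[int]_n.+1) : 'rV[int]_n := \row_j xi 0 (lift ord0 j).

Lemma dotv_cons n (xi : 'rV[int]_n.+1) x (y : n.-tuple RR) :
  dotv (freq xi) (torus_pt (tuple_cons (x, y))) =
  (xi 0 ord0)%:~R * x + dotv (freq (rbehead xi)) (torus_pt y) :> R.
Proof.
rewrite /dotv big_ord_recl /=; congr (_ + _); first by rewrite !mxE tnth0.
by apply: eq_bigr => i _; rewrite !mxE tnthS.
Qed.

Lemma tuple_consK n (x : n.+1.-tuple RR) :
  tuple_cons (tnth x ord0, [tuple of behead x]) = x.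
Proof. by rewrite [RHS]tuple_eta /thead; apply/val_inj. Qed.

Lemma measurable_cosT d (T : measurableType d) (f : T -> R) :
  measurable_fun setT f -> measurable_fun setT (fun x => cos (f x)).
Proof.
move=> mf; apply: (measurableT_comp (f := cos)) => //.
by apply: continuous_measurable_fun; exact: continuous_cos.
Qed.

Lemma measurable_sinT d (T : measurableType d) (f : T -> R) :
  measurable_fun setT f -> measurable_fun setT (fun x => sin (f x)).
Proof.
move=> mf; apply: (measurableT_comp (f := sin)) => //.
by apply: continuous_measurable_fun; exact: continuous_sin.
Qed.

(** The addition formula separates the first coordinate from the others, and Fubini applies to each
    product. The free phase [theta] covers cosine and sine coefficients at once. *)
Lemma torus_Rintegral_cos n (phi : RR -> R) (C : R) (xi : 'rV[int]_n.+1) theta :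
  measurable_fun setT phi -> (forall x, `|phi x| <= C) ->
  \int[tor n.+1]_x (phi (tnth x ord0) * cos (dotv (freq xi) (torus_pt x) + theta)) =
  \int[mu]_x (phi x * cos ((xi 0 ord0)%:~R * x + theta)) *
    \int[tor n]_y cos (dotv (freq (rbehead xi)) (torus_pt y)) -
  \int[mu]_x (phi x * sin ((xi 0 ord0)%:~R * x + theta)) *
    \int[tor n]_y sin (dotv (freq (rbehead xi)) (torus_pt y)).
Proof.
move=> mphi phiC; set k : R := (xi 0 ord0)%:~R.
have mk : measurable_fun [set: RR] (fun x : RR => k * x + theta).
  by apply: measurable_funD => //; apply: measurable_funM.
have mb : measurable_fun setT (fun x : n.+1.-tuple RR => [tuple of behead x] : n.-tuple RR).
  exact: measurable_behead.
have mt : measurable_fun setT (fun x : n.+1.-tuple RR => tnth x ord0) by exact: measurable_tnth.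
have md : measurable_fun setT (fun y : n.-tuple RR => dotv (freq (rbehead xi)) (torus_pt y)).
  exact: measurable_dotv.
have bnd (a b : R) : `|a| <= 1 -> `|b| <= C -> `|b * a| <= C.
  move=> a1 bC; rewrite normrM -[C]mulr1; exact: ler_pM.
pose F1 (x : RR) := phi x * cos (k * x + theta).
pose F2 (x : RR) := phi x * sin (k * x + theta).
pose H1 (y : n.-tuple RR) := cos (dotv (freq (rbehead xi)) (torus_pt y)).
pose H2 (y : n.-tuple RR) := sin (dotv (freq (rbehead xi)) (torus_pt y)).
have mF1 : measurable_fun setT F1 by apply: measurable_funM => //; exact: measurable_cosT.
have mF2 : measurable_fun setT F2 by apply: measurable_funM => //; exact: measurable_sinT.
have mH1 : measurable_fun setT H1 by exact: measurable_cosT.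
have mH2 : measurable_fun setT H2 by exact: measurable_sinT.
have F1C x : `|F1 x| <= C by apply: bnd => //; exact: cos_max.
have F2C x : `|F2 x| <= C by apply: bnd => //; exact: sin_max.
have H11 x : `|H1 x| <= 1 by exact: cos_max.
have H21 x : `|H2 x| <= 1 by exact: sin_max.
pose G1 (x : n.+1.-tuple RR) := F1 (tnth x ord0) * H1 [tuple of behead x].
pose G2 (x : n.+1.-tuple RR) := F2 (tnth x ord0) * H2 [tuple of behead x].
have mG1 : measurable_fun setT G1.
  by apply: measurable_funM; [exact: (measurableT_comp mF1)|exact: (measurableT_comp mH1)].
have mG2 : measurable_fun setT G2.
  by apply: measurable_funM; [exact: (measurableT_comp mF2)|exact: (measurableT_comp mH2)].
have G1C x : `|G1 x| <= C by apply: bnd.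
have G2C x : `|G2 x| <= C by apply: bnd.
have beh (x : RR) (y : n.-tuple RR) : [tuple of behead (tuple_cons (x, y))] = y.
  exact/val_inj.
rewrite -(torus_Rintegral_prod mG1 mF1 mH1 G1C F1C H11); last first.
  by move=> x y; rewrite /G1 beh tnth0.
rewrite -(torus_Rintegral_prod mG2 mF2 mH2 G2C F2C H21); last first.
  by move=> x y; rewrite /G2 beh tnth0.
have fin := torus_fin n.+1.
rewrite -RintegralB //; last 2 first.
- exact: bounded_integrable mG1 G1C.
- exact: bounded_integrable mG2 G2C.
apply: eq_Rintegral => x _; rewrite -[in LHS](tuple_consK x) dotv_cons tuple_consK.
by rewrite addrAC cosD /G1 /G2 /F1 /F2 /H1 /H2; ring.
Qed.

Lemma idx_itv M (x : R) : 0 <= x < 2 * pi ->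
  mesh (lat M) * (idx M x : nat)%:R <= x < mesh (lat M) * (idx M x : nat)%:R + mesh (lat M).
Proof.
move=> /andP[x0 x2]; have h0 := @mesh_gt0 R (lat M).
pose n := Num.truncn (x / mesh (lat M)).
have /andP[n1 n2] := truncn_itv (divr_ge0 x0 (ltW h0)).
rewrite -/n in n1 n2; move: n1 n2; rewrite ler_pdivlMr // ltr_pdivrMr // => n1 n2.
have nN : (n < (lat M).+2)%N.
  rewrite -(ltr_nat R) -(ltr_pM2r h0) [X in _ < X]mulrC mesh_period.
  exact: le_lt_trans n1 x2.
have H : mesh (lat M) * (Ordinal nN : nat)%:R <= x < mesh (lat M) * (Ordinal nN : nat)%:R + mesh (lat M).
  by rewrite /= mulrC n1 /=; move: n2; rewrite -natr1 mulrDl mul1r.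
by rewrite (idx_mesh H).
Qed.

Lemma cos_lipschitz (x y : R) : `|cos x - cos y| <= `|x - y|.
Proof.
have E z : cos z = sin (z + pi / 2) :> R by rewrite sin_cos_shift addrK.
rewrite !E; apply: le_trans (sin_lipschitz _ _) _.
by rewrite opprD addrACA subrr addr0.
Qed.

Lemma cos_affine_lattice M (k : nat) theta (x : R) : 0 <= x < 2 * pi ->
  `|cos (k%:R * x + theta) - cos (theta + mesh (lat M) * (k * idx M x)%:R)| <= k%:R * mesh (lat M).
Proof.
move=> x02; have /andP[a1 a2] := idx_itv M x02.
apply: le_trans (cos_lipschitz _ _) _.
have -> : k%:R * x + theta - (theta + mesh (lat M) * (k * idx M x)%:R) =
  k%:R * (x - mesh (lat M) * (idx M x : nat)%:R) by rewrite natrM; ring.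
rewrite normrM ger0_norm // ler_wpM2l // ger0_norm ?subr_ge0 //.
by rewrite lerBlDl ltW.
Qed.

(** The Riemann sums vanish exactly as soon as k < N, by orthogonality on the lattice, and they
    converge to the integral. *)
Lemma circle_cos_int (k : nat) theta : (0 < k)%N ->
  \int[mu]_x cos (k%:R * x + theta) = 0.
Proof.
move=> k0; apply/eqP; rewrite -normr_le0; apply/ler_addgt0Pr => e e0; rewrite add0r.
have p0 := @pi_gt0 R; have kR : 0 < k%:R :> R by rewrite ltr0n.
have e1 : 0 < e / (2 * pi * k%:R) by rewrite divr_gt0 // !mulr_gt0.
have [M [hM kM]] : exists M, mesh (lat M) <= e / (2 * pi * k%:R) /\ (k < (lat M).+2)%N.
  have [M0 _ H] := near_mesh_le e1; exists (maxn M0 k); split; first by apply: H; rewrite /= leq_maxl.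
  rewrite lat_size; apply: (@leq_ltn_trans (maxn M0 k)); first exact: leq_maxr.
  apply: (leq_trans (ltn_expl _ (isT : (1 < 4)%N))); exact: leq_pmull.
have h0 := @mesh_gt0 R (lat M).
have mk : measurable_fun [set: RR] (fun x : RR => cos (k%:R * x + theta)).
  by apply: measurable_cosT; apply: measurable_funD => //; apply: measurable_funM.
have := @riemann_sum R M (fun x => cos (k%:R * x + theta))
  (fun i => cos (theta + mesh (lat M) * (k * i)%:R)) 1 (k%:R * mesh (lat M)) mk (fun x => cos_max _)
  (cos_affine_lattice M k theta).
rewrite sum_cos_mesh ?k0 // mulr0 subr0 => H; apply: le_trans H _.
by move: hM; rewrite ler_pdivlMr ?mulr_gt0 //; lra.
Qed.

Lemma int_phase (k : int) (x theta : R) :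
  cos (k%:~R * x + theta) = cos ((absz k)%:R * x + (if 0 <= k then theta else - theta)).
Proof.
case: k => n //=; rewrite NegzE /= mulrNz mulNr.
by rewrite -cosN opprD opprK.
Qed.

Lemma torus_cos_int n (xi : 'rV[int]_n) theta : xi != 0 ->
  \int[tor n]_x cos (dotv (freq xi) (torus_pt x) + theta) = 0.
Proof.
elim: n xi theta => [xi|n IHn xi] theta xi0; first by rewrite thinmx0 eqxx in xi0.
have H := @torus_Rintegral_cos n (fun=> 1) 1 xi theta.
under [LHS]eq_Rintegral do rewrite -[cos _]mul1r.
rewrite H //; last by move=> _; rewrite normr1.
have [x'0|x'0] := eqVneq (rbehead xi) 0; last first.
  have := IHn _ 0 x'0; under eq_Rintegral do rewrite addr0; move=> ->.
  have := IHn _ (- (pi / 2)) x'0; under eq_Rintegral do rewrite -sin_cos_shift; move=> ->.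
  by rewrite !mulr0 subr0.
have k0 : (0 < absz (xi 0%R ord0))%N.
  rewrite absz_gt0; apply: contraNneq xi0 => k0; apply/eqP/rowP => i; rewrite mxE.
  case: (unliftP ord0 i) => [j ->|-> //].
  by have := congr1 (fun m : 'rV_n => m 0 j) x'0; rewrite !mxE.
have C0 : \int[mu]_x (1 * cos ((xi 0 ord0)%:~R * x + theta)) = 0.
  by under eq_Rintegral do rewrite mul1r int_phase; exact: circle_cos_int.
have S0 : \int[mu]_x (1 * sin ((xi 0 ord0)%:~R * x + theta)) = 0.
  under eq_Rintegral do rewrite mul1r sin_cos_shift -addrA int_phase.
  exact: circle_cos_int.
by rewrite C0 S0 !mul0r subr0.
Qed.

(* [psi = |d/dx| phi] on the circle, tested on all phases of each frequency. *)
Definition circle_absgrad (phi psi : RR -> R) := forall (k : nat) theta,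
  \int[mu]_x (psi x * cos (k%:R * x + theta)) =
  k%:R * \int[mu]_x (phi x * cos (k%:R * x + theta)).

(** If a coordinate of the frequency other than the first is nonzero, both sides vanish; otherwise
    the Euclidean norm of the frequency is |xi_0|. The d-dimensional operator thus acts on functions
    of x_0 as the one-dimensional one. *)
Lemma torus_absgrad_cos n (phi psi : RR -> R) (C : R) (xi : 'rV[int]_n.+1) theta :
  measurable_fun setT phi -> (forall x, `|phi x| <= C) ->
  measurable_fun setT psi -> (forall x, `|psi x| <= C) -> circle_absgrad phi psi ->
  \int[tor n.+1]_x (psi (tnth x ord0) * cos (dotv (freq xi) (torus_pt x) + theta)) =
  euclid (freq xi) *
    \int[tor n.+1]_x (phi (tnth x ord0) * cos (dotv (freq xi) (torus_pt x) + theta)).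
Proof.
move=> mphi phiC mpsi psiC H.
rewrite (torus_Rintegral_cos _ _ mphi phiC) (torus_Rintegral_cos _ _ mpsi psiC).
have [x'0|x'0] := eqVneq (rbehead xi) 0; last first.
  have := torus_cos_int 0 x'0; under eq_Rintegral do rewrite addr0; move=> ->.
  have := torus_cos_int (- (pi / 2)) x'0; under eq_Rintegral do rewrite -sin_cos_shift; move=> ->.
  by rewrite !mulr0 subr0 mulr0.
have -> : euclid (freq xi) = (absz (xi 0 ord0))%:R :> R.
  rewrite /euclid /dotv big_ord_recl big1 ?addr0.
    by rewrite mxE -expr2 sqrtr_sqr -intr_norm natr_absz.
  move=> i _; have := congr1 (fun m : 'rV_n => m 0 i) x'0; rewrite !mxE => ->.
  by rewrite mul0r.
have Hc : \int[mu]_x (psi x * cos ((xi 0 ord0)%:~R * x + theta)) =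
    (absz (xi 0 ord0))%:R * \int[mu]_x (phi x * cos ((xi 0 ord0)%:~R * x + theta)).
  under eq_Rintegral do rewrite int_phase; rewrite H.
  by congr (_ * _); apply: eq_Rintegral => x _; rewrite [in RHS]int_phase.
have Hs : \int[mu]_x (psi x * sin ((xi 0 ord0)%:~R * x + theta)) =
    (absz (xi 0 ord0))%:R * \int[mu]_x (phi x * sin ((xi 0 ord0)%:~R * x + theta)).
  under eq_Rintegral do rewrite sin_cos_shift -addrA int_phase; rewrite H.
  by congr (_ * _); apply: eq_Rintegral => x _; rewrite sin_cos_shift -addrA [in RHS]int_phase.
by rewrite Hc Hs; ring.
Qed.

Lemma absgrad_first_coordinate n (phi psi : RR -> R) (C : R) :
  measurable_fun setT phi -> (forall x, `|phi x| <= C) ->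
  measurable_fun setT psi -> (forall x, `|psi x| <= C) -> circle_absgrad phi psi ->
  is_absgrad (fun x : 'rV[R]_n.+1 => phi (x 0 ord0)) (fun x => psi (x 0 ord0)).
Proof.
move=> mphi phiC mpsi psiC H xi; rewrite /fourier_coef.
have T theta := @torus_absgrad_cos n phi psi C xi theta mphi phiC mpsi psiC H.
have Tc : torus_int (fun x : 'rV[R]_n.+1 => psi (x 0 ord0) * cos (dotv (freq xi) x)) =
  euclid (freq xi) * torus_int (fun x : 'rV[R]_n.+1 => phi (x 0 ord0) * cos (dotv (freq xi) x)).
  rewrite /torus_int; have := T 0.
  under eq_Rintegral do rewrite addr0; move=> T0.
  under eq_Rintegral do rewrite mxE; rewrite T0; congr (_ * _).
  by apply: eq_Rintegral => x _; rewrite addr0 mxE.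
have Ts : torus_int (fun x : 'rV[R]_n.+1 => psi (x 0 ord0) * sin (dotv (freq xi) x)) =
  euclid (freq xi) * torus_int (fun x : 'rV[R]_n.+1 => phi (x 0 ord0) * sin (dotv (freq xi) x)).
  rewrite /torus_int; have := T (- (pi / 2)).
  under eq_Rintegral do rewrite -sin_cos_shift; move=> T0.
  under eq_Rintegral do rewrite mxE; rewrite T0; congr (_ * _).
  by apply: eq_Rintegral => x _; rewrite -sin_cos_shift mxE.
rewrite Tc Ts; apply/eqP; rewrite eq_complex /=.
by apply/andP; split; apply/eqP; ring.
Qed.

End TorusIntegral.

Lemma sin_sub_le (R : realType) (x : R) : 0 <= x -> x - x ^+ 3 / 2 <= sin x.
Proof.
move=> x0.
have [z /[!in_itv]/= /andP[z0 z1] E] := @MVT_segment R (@sin R) (@cos R) 0 x x0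
  (fun z _ => is_derive_sin z) (continuous_subspaceT (@continuous_sin R)).
rewrite sin0 !subr0 in E; rewrite E.
have -> : x - x ^+ 3 / 2 = (1 - x ^+ 2 / 2) * x by rewrite exprS; lra.
rewrite ler_wpM2r //; apply: le_trans (cos_ge z).
rewrite lerD2l lerN2 ler_pM2r ?invr_gt0 //.
by rewrite ler_pXn2r ?nnegrE.
Qed.

Lemma symb_dist (R : realType) (p k : nat) :
  `|symb p k - k%:R| <= k%:R ^+ 3 * (@mesh R p) ^+ 2.
Proof.
have h0 := @mesh_gt0 R p; have hn := @mesh_neq0 R p.
pose y := @mesh R p * k%:R / 2; have y0 : 0 <= y by rewrite /y divr_ge0 // mulr_ge0 // ltW.
have E : k%:R = 2 / mesh p * y :> R by rewrite /y; field.
have s1 := sin_sub_le y0.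
have s2 : sin y <= y by apply: le_trans (ler_norm _) _; rewrite -[leRHS]ger0_norm ?norm_sin_le.
rewrite /symb -/y {1}E -mulrBr normrM (ger0_norm (two_mesh_ge0 p)).
rewrite ler0_norm; last by lra.
apply: (@le_trans _ _ (2 / mesh p * (y ^+ 3 / 2))).
  by rewrite ler_wpM2l ?two_mesh_ge0 //; lra.
have -> : 2 / mesh p * (y ^+ 3 / 2) = (k%:R ^+ 3 * mesh p ^+ 2) / 8 by rewrite /y; field.
have : 0 <= k%:R ^+ 3 * (@mesh R p) ^+ 2 by rewrite mulr_ge0 ?exprn_ge0 // ltW.
by lra.
Qed.

(** * The limit of the lattice operator is the half-Laplacian on the circle *)

Section LimitIntegrals.
Context {R : realType}.
Variable (U : set_system nat).
Context {UU : UltraFilter U}.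
Hypothesis Uoo : \oo `<=` U.
Local Notation RR := (measurableTypeR R).
Local Notation mu := (@circle_measure R).
Local Notation h M := (@mesh R (lat M)).
Implicit Types (a b : @lattice_family R) (t e : R).

Lemma lims_lin r s a b t x : bdd a -> bdd b -> 0 < t ->
  lims U (fun M m i => r * a M m i + s * b M m i) t x = r * lims U a t x + s * lims U b t x.
Proof.
move=> ha hb t0; apply: cvg_lim => //.
by apply: cvgD; apply: cvgMl_tmp; exact: lims_cvg.
Qed.

Lemma lims_mul a b t x : bdd a -> bdd b -> 0 < t ->
  lims U (fun M m i => a M m i * b M m i) t x = lims U a t x * lims U b t x.
Proof. by move=> ha hb t0; apply: cvg_lim => //; apply: cvgM; exact: lims_cvg. Qed.

Lemma lims_bounded a t : bdd a -> 0 < t -> exists C, forall x, `|lims U a t x| <= C.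
Proof.
move=> ha t0; have [C [C0 HC]] := near_bdd Uoo 0 t ha t0; exists C => x.
rewrite -[lims _ _ _ _]subr0.
apply: (ucvg_dist_le (lims_cvg Uoo (x := x) ha t0)) => e e0.
apply: filterS HC => M HC; rewrite subr0.
by apply: le_trans (HC t (idx M x) _) _; rewrite ?lexx // lerDl ltW.
Qed.

Lemma lims_lip a t : bdd a -> 0 < t -> exists C, 0 <= C /\
  forall x y, `|lims U a t y - lims U a t x| <= C * `|y - x|.
Proof.
move=> ha t0; have [C [C0 HC]] := lims_lip_x Uoo t ha t0.
by exists C; split=> // x y; apply: HC; rewrite lexx.
Qed.

Lemma lipschitz_continuous (F : R -> R) C : (forall x y, `|F y - F x| <= C * `|y - x|) ->
  continuous F.
Proof.
move=> FC x; apply/cvgrPdist_le => e e0.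
have C1 : 0 < `|C| + 1 by rewrite ltr_wpDl.
near=> y.
have xy : `|x - y| <= e / (`|C| + 1).
  by near: y; apply: (@cvgr_dist_le _ _ _ (nbhs x) _ id x) => //; rewrite divr_gt0.
apply: le_trans (FC _ _) _; move: xy; rewrite ler_pdivlMr //.
have := ler_norm C; have := normr_ge0 (x - y); nra.
Unshelve. all: by end_near. Qed.

Lemma lims_measurable a t : bdd a -> 0 < t -> measurable_fun [set: RR] (lims U a t).
Proof.
move=> ha t0; have [C [_ HC]] := lims_lip ha t0.
by apply: continuous_measurable_fun; exact: lipschitz_continuous HC.
Qed.

(** Convergence along the ultrafilter is only pointwise, but it is simultaneous at the finitely many
    nodes of one fixed lattice K, and the Lipschitz bounds, uniform in M, propagate it between the
    nodes. *)
Lemma lims_near_uniform a t e : bdd a -> 0 < t -> 0 < e ->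
  \forall M \near U, forall x, 0 <= x < 2 * pi ->
    `|lims U a t x - a M (tdx M t) (idx M x)| <= e.
Proof.
move=> ha t0 e0; have [C1 [C10 HC1]] := lims_lip ha t0.
have [C2 [C20 HC2]] := near_bdd Uoo 1 t ha t0.
pose C := C1 + C2 + 1; have C0 : 0 < C by rewrite /C ltr_wpDl // addr_ge0.
have d0 : 0 < e / (4 * C) by rewrite divr_gt0 // mulr_gt0.
have [K hK] : exists K, h K <= e / (4 * C).
  by have [K _ HK] := near_mesh_le d0; exists K; apply: HK => /=.
pose y (j : 'I_(lat K).+2) := h K * (j : nat)%:R.
have e4 : 0 < e / 4 by rewrite divr_gt0.
near=> M.
have Hy : forall j, `|lims U a t (y j) - a M (tdx M t) (idx M (y j))| <= e / 4.
  near: M; apply: filter_forall => j.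
  have cj := @lims_cvg R U UU Uoo a t (y j) ha t0.
  by move/cvgrPdist_le: cj; exact.
have HM : forall s i, t <= s <= t -> `|iter 1 dif (a M (tdx M s)) i| <= C2 by near: M.
have hM : h M <= e / (4 * C) by near: M; exact: near_mesh.
move=> x x02; have /andP[x1 x2] := idx_itv K x02; set j := idx K x in x1 x2.
have xy : `|x - y j| <= e / (4 * C).
  by rewrite ger0_norm ?subr_ge0 // lerBlDl; apply: le_trans (ltW x2) _; rewrite lerD2l.
have L1 := HC1 (y j) x.
have L2 := @lattice_lip R M (a M (tdx M t)) C2 (y j) x (fun i => HM t i (ltac:(by rewrite lexx))).
have H1 : C1 * `|x - y j| <= C1 * (e / (4 * C)) by rewrite ler_wpM2l.
have H2 : C2 * (`|x - y j| + h M) <= C2 * (e / (4 * C) + e / (4 * C)) by rewrite ler_wpM2l // lerD.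
have E : C * (e / (4 * C)) = e / 4 by field; rewrite gt_eqF.
have := Hy j; move: L1 L2 H1 H2 E (ltW d0).
set d := e / (4 * C); set u := lims U a t x; set v := lims U a t (y j).
set u' := a M _ (idx M x); set v' := a M _ (idx M (y j)) => L1 L2 H1 H2 E d0' Hj.
have -> : u - u' = (u - v) + (v - v') - (u' - v') by ring.
apply: le_trans (ler_normB _ _) _; apply: le_trans (lerD (ler_normD _ _) (lexx _)) _.
have := le_trans L1 H1; have := le_trans L2 H2; move: E; rewrite /C; nra.
Unshelve. all: by end_near. Qed.

Lemma riemann_cvg (F : RR -> R) (b : forall M, 'I_(lat M).+2 -> R) (C : R) :
  measurable_fun setT F -> (forall x, `|F x| <= C) ->
  (forall e, 0 < e -> \forall M \near U, forall x, 0 <= x < 2 * pi ->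
    `|F x - b M (idx M x)| <= e) ->
  (fun M => h M * \sum_i b M i) @ U --> \int[mu]_x F x.
Proof.
move=> mF FC H; apply/cvgrPdist_le => e e0; have p0 := @pi_gt0 R.
have e1 : 0 < e / (2 * pi) by rewrite divr_gt0 // mulr_gt0.
apply: filterS (H _ e1) => M HM.
apply: le_trans (riemann_sum mF FC HM) _.
by rewrite mulrC divfK // gt_eqF // mulr_gt0.
Qed.

Lemma lims_cos_cvg a t (k : nat) theta : bdd a -> 0 < t ->
  (fun M => ip (a M (tdx M t)) (fun i => cos (theta + h M * (k * i)%:R))) @ U -->
  \int[mu]_x (lims U a t x * cos (k%:R * x + theta)).
Proof.
move=> ha t0; have [C HC] := lims_bounded ha t0.
have C0 : 0 <= C by apply: le_trans (HC 0).
apply: (@riemann_cvg (fun x => lims U a t x * cos (k%:R * x + theta))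
  (fun M i => a M (tdx M t) i * cos (theta + h M * (k * i)%:R)) C).
- apply: measurable_funM; first exact: lims_measurable.
  by apply: measurable_cosT; apply: measurable_funD => //; exact: measurable_funM.
- by move=> x; rewrite normrM -[C]mulr1 ler_pM // cos_max.
move=> e e0; have e2 : 0 < e / 2 by rewrite divr_gt0.
have e3 : 0 < e / 2 / (C * k%:R + 1) by rewrite divr_gt0 // ltr_wpDl // mulr_ge0.
near=> M.
have H1 : forall x, 0 <= x < 2 * pi -> `|lims U a t x - a M (tdx M t) (idx M x)| <= e / 2.
  by near: M; exact: lims_near_uniform.
have hM : h M <= e / 2 / (C * k%:R + 1) by near: M; exact: near_mesh.
move=> x x02.
have -> : lims U a t x * cos (k%:R * x + theta) -
    a M (tdx M t) (idx M x) * cos (theta + h M * (k * idx M x)%:R) =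
  lims U a t x * (cos (k%:R * x + theta) - cos (theta + h M * (k * idx M x)%:R)) +
  (lims U a t x - a M (tdx M t) (idx M x)) * cos (theta + h M * (k * idx M x)%:R) by ring.
apply: le_trans (ler_normD _ _) _; rewrite !normrM.
have b1 := ler_pM (normr_ge0 _) (normr_ge0 _) (HC x) (cos_affine_lattice M k theta x02).
have b2 := ler_pM (normr_ge0 _) (normr_ge0 _) (H1 x x02) (cos_max (theta + h M * (k * idx M x)%:R)).
have b3 : C * (k%:R * h M) <= e / 2.
  move: hM; rewrite ler_pdivlMr ?ltr_wpDl ?mulr_ge0 // => hM.
  have := @mesh_gt0 R (lat M); lra.
lra.
Unshelve. all: by end_near. Qed.

Lemma symb_cvg (k : nat) : (fun M => symb (lat M) k) @ U --> (k%:R : R).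
Proof.
apply/cvgrPdist_le => e e0; have e1 : 0 < e / (k%:R ^+ 3 + 1).
  by rewrite divr_gt0 // ltr_wpDl // exprn_ge0.
near=> M.
have hM : h M <= e / (k%:R ^+ 3 + 1) by near: M; exact: near_mesh.
rewrite distrC; apply: le_trans (symb_dist _ _ _) _.
have k0 : 0 <= k%:R ^+ 3 :> R by rewrite exprn_ge0.
have h0 := @mesh_gt0 R (lat M); have h1 := @mesh_lat_le1 R M.
move: hM; rewrite ler_pdivlMr ?ltr_wpDl // => hM.
have : h M ^+ 2 <= h M by rewrite expr2 ler_piMr // ltW.
nra.
Unshelve. all: by end_near. Qed.

(** On the lattice [labs] is moved by symmetry onto the cosine, which is an eigenfunction with
    eigenvalue [symb]; for a fixed frequency this eigenvalue tends to k as the mesh vanishes. *)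
Lemma lims_absgrad a t : bdd a -> 0 < t ->
  circle_absgrad (lims U a t) (lims U (fun M m => labs (a M m)) t).
Proof.
move=> ha t0 k theta.
have c1 := @lims_cos_cvg _ _ k theta ha t0.
have c2 := @lims_cos_cvg _ _ k theta (bdd_labs ha) t0.
apply: (cvg_unique _ c2) => //; apply: cvg_trans (cvgM (symb_cvg (k := k)) c1).
apply: near_eq_cvg.
have : \forall M \near U, (k < (lat M).+2)%N.
  apply: Uoo; exists k => // M /= kM; rewrite lat_size.
  apply: (leq_ltn_trans kM); apply: (leq_trans (ltn_expl _ (isT : (1 < 4)%N))); exact: leq_pmull.
apply: filterS => M kM.
rewrite labs_sym labs_cos // -[LHS]/(symb (lat M) k * ip (a M (tdx M t)) _).
by rewrite /ip mulrCA; congr (_ * _); rewrite mulr_sumr; apply: eq_bigr => i _; ring.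
Qed.

End LimitIntegrals.

(** * The limit datum *)

Section Profile.
Context {R : realType}.
Local Notation RR := (measurableTypeR R).
Implicit Types (x y : R) (i j k n M : nat).

Lemma tent_eq0 i x : (tent i x == 0) = (1 <= 4 ^+ i * `|sin (x / 2)|).
Proof.
rewrite /tent /Num.max; case: ltP => H; rewrite ?eqxx.
  by rewrite gt_eqF //; apply/esym/negbTE; rewrite -ltNge -subr_gt0.
by apply/esym; rewrite -subr_le0.
Qed.

Lemma tent_eq0_le i k x : (i <= k)%N -> tent i x = 0 -> tent k x = 0.
Proof.
move=> ik /eqP; rewrite tent_eq0 => H; apply/eqP; rewrite tent_eq0.
by apply: le_trans H _; rewrite ler_wpM2r // ler_eXn2l // ltr1n.
Qed.

(** The supports are nested, so at each point the sum stops growing at the first vanishing tent. *)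
Lemma tents_stable n k x : (n <= k)%N -> tent n x = 0 -> tents k x = tents n x.
Proof.
move=> nk tn; rewrite /tents -(subnKC nk) big_split_ord /= [X in _ + X]big1 ?addr0 // => i _.
by rewrite (tent_eq0_le _ tn) ?mul0r // leq_addr.
Qed.

(** An index at which the tent at x has vanished: with k the integer part of 1 / |sin (x / 2)|, k +
    1 <= 4^k. *)
Definition tent_stop x : nat := Num.truncn (`|sin (x / 2)|^-1).

Lemma tent_stopP x : sin (x / 2) != 0 -> tent (tent_stop x) x = 0.
Proof.
move=> s0; apply/eqP; rewrite tent_eq0.
have sp : 0 < `|sin (x / 2)| by rewrite normr_gt0.
rewrite -ler_pdivrMr // mul1r.
have i0 : 0 <= `|sin (x / 2)|^-1 by rewrite invr_ge0.
have /andP[_ /ltW H] := truncn_itv i0; apply: le_trans H _.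
by rewrite -natrX ler_nat; exact: ltn_expl.
Qed.

(* The pointwise limit of [data], except where [sin (x / 2) = 0]: there
   [0^-1 = 0] gives [tent_stop x = 0] and the value [0]. *)
Definition profile x : R := 1 / 100 * sin (tents (tent_stop x) x).

Lemma profile_data M x : tent M.+1 x = 0 -> profile x = data M x.
Proof.
move=> t0; rewrite /profile /data; congr (_ * sin _).
have s0 : sin (x / 2) != 0.
  apply/eqP => s0; move/eqP: t0; rewrite tent_eq0 s0 normr0 mulr0.
  by rewrite ler10.
have t1 := tent_stopP s0; have [H|/ltnW H] := leqP (tent_stop x) M.+1.
  by rewrite (tents_stable H t1).
by rewrite (tents_stable H t0).
Qed.

Lemma profile_le x : `|profile x| <= 1 / 100.
Proof. by rewrite /profile normrM ger0_norm // ler_piMr // sin_max. Qed.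

Lemma profileD2pi x : profile (x + 2 * pi) = profile x.
Proof.
rewrite /profile tentsD2pi; congr (_ * sin (tents _ _)); rewrite /tent_stop.
by rewrite (_ : (x + 2 * pi) / 2 = x / 2 + pi) ?sinDpi ?normrN //; field.
Qed.

Lemma data_dist_le M j x : (j <= M)%N ->
  (data M x - data j x) ^+ 2 <= (tent j.+1 x != 0)%:R.
Proof.
move=> jM; have [t0|_] := eqVneq (tent j.+1 x) 0.
  by rewrite /data (@tents_stable j.+1 M.+1) // subrr expr0n.
have := data_le M x; have := data_le j x; rewrite !ler_norml => /andP[a b] /andP[c d].
by rewrite /=; nra.
Qed.

(** The difference lives on the support of tent j+1. Its indicator is discontinuous, but twice the
    wider tent j dominates it and has an integral accessible through Riemann sums. *)
Lemma profile_dist_le j x : (profile x - data j x) ^+ 2 <= 2 * tent j x.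
Proof.
have [t0|t0] := eqVneq (tent j.+1 x) 0.
  by rewrite (profile_data t0) subrr expr0n mulr_ge0 // tent_ge0.
have t1 : 1 / 2 <= tent j x.
  move: t0; rewrite tent_eq0 -ltNge exprS -mulrA => t0; rewrite /tent le_max.
  by apply/orP; right; lra.
have := profile_le x; have := data_le j x; rewrite !ler_norml => /andP[a b] /andP[c d].
by nra.
Qed.

Lemma tents_lipschitz n : exists2 C, 0 <= C & forall x y, `|tents n y - tents n x| <= C * `|y - x|.
Proof.
elim: n => [|n [C C0 HC]].
  by exists 0 => // x y; rewrite /tents !big_ord0 subrr normr0 mul0r.
exists (C + 4 ^+ n); first by rewrite addr_ge0 ?exprn_ge0.
move=> x y; rewrite /tents !big_ord_recr /= -/(tents n x) -/(tents n y).
rewrite opprD addrACA mulrDl; apply: le_trans (ler_normD _ _) _; apply: lerD => //.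
rewrite -mulrBl normrM.
have i1 : `|n.+1%:R^-1| <= 1 :> R by rewrite ger0_norm ?invr_ge0 // invf_le1 ?ltr0n // ler1n.
have T := tent_lipschitz n y x.
apply: (@le_trans _ _ (`|tent n y - tent n x| * 1)); first by rewrite ler_wpM2l.
rewrite mulr1; apply: le_trans T _; rewrite ler_wpM2r //.
have : 0 <= 4 ^+ n :> R by rewrite exprn_ge0.
lra.
Qed.

Lemma data_lipschitz M : exists2 C, 0 <= C & forall x y, `|data M y - data M x| <= C * `|y - x|.
Proof.
have [C C0 HC] := tents_lipschitz M.+1; exists C => // x y.
rewrite /data -mulrBr normrM ger0_norm //.
apply: (@le_trans _ _ `|sin (tents M.+1 y) - sin (tents M.+1 x)|).
  by rewrite ler_piMl //; lra.
exact: le_trans (sin_lipschitz _ _) _.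
Qed.

Lemma data_measurable M : measurable_fun [set: RR] (data M : RR -> R).
Proof.
have [C _ HC] := data_lipschitz M.
by apply: continuous_measurable_fun; exact: lipschitz_continuous HC.
Qed.

Lemma tent_measurable i : measurable_fun [set: RR] (tent i : RR -> R).
Proof.
by apply: continuous_measurable_fun; apply: lipschitz_continuous => x y; exact: tent_lipschitz.
Qed.

Lemma profile_measurable : measurable_fun [set: RR] (profile : RR -> R).
Proof.
(* Where sin (x / 2) = 0 the sequence [data] need not converge; the factor 1 - tent vanishes there,
   in agreement with the default value 0 of [profile], and is eventually 1 elsewhere. *)
apply: (@measurable_fun_cvg _ _ _ setT (fun M (x : RR) => data M x * (1 - tent M.+1 x))).
  move=> M; apply: measurable_funM; first exact: data_measurable.
  by apply: measurable_funB => //; exact: tent_measurable.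
move=> x _; apply/cvgrPdist_le => e e0; have [s0|s0] := eqVneq (sin (x / 2)) 0.
  have P0 : profile x = 0.
    by rewrite /profile /tent_stop s0 normr0 invr0 truncn0 /tents big_ord0 sin0 mulr0.
  near=> M; rewrite P0 /tent s0 normr0 mulr0 subr0.
  by rewrite (_ : Num.max 0 1 = 1) ?subrr ?mulr0 ?subrr ?normr0 ?(ltW e0) //; apply/max_idPr.
exists (tent_stop x) => // M /= HM.
have t0 : tent M.+1 x = 0 by apply: tent_eq0_le (tent_stopP s0); exact: leqW.
by rewrite (profile_data t0) t0 subr0 mulr1 subrr normr0 ltW.
Unshelve. all: by end_near. Qed.

Lemma harmonic_unbounded (B : R) : exists n, B <= \sum_(i < n) (i.+1%:R : R)^-1.
Proof.
apply: contrapT => H; apply: (@dvg_harmonic R); apply: nondecreasing_is_cvgn.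
  by apply: nondecreasing_series => n _ _; exact: harmonic_ge0.
exists B => _ [n _ <-]; rewrite /series /= big_mkord.
have [/ltW //|Bn] := ltP (\sum_(k < n) harmonic k) B.
by case: H; exists n.
Qed.

(** At this point the tents of index below M are at least 3/4, while tent M+1 already vanishes
    ([tent_eq0_away]), so that [profile] and [data M] agree from there up to pi. *)
Lemma tents_near0 M : (3 / 4) * \sum_(i < M) (i.+1%:R : R)^-1 <= tents M.+1 (8 / 4 ^+ M.+1).
Proof.
set y : R := 8 / 4 ^+ M.+1.
rewrite /tents big_ord_recr /= mulr_sumr -[leLHS]addr0; apply: lerD; last first.
  by rewrite divr_ge0 // tent_ge0.
apply: ler_sum => i _; rewrite ler_wpM2r ?invr_ge0 //.
rewrite /tent le_max; apply/orP; right.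
suff : 4 ^+ i * `|sin (y / 2)| <= 1 / 4 by lra.
have y0 : 0 <= y / 2 by rewrite /y divr_ge0 // divr_ge0 // exprn_ge0.
apply: (@le_trans _ _ (4 ^+ i * (y / 2))).
  by rewrite ler_wpM2l ?exprn_ge0 // -[leRHS]ger0_norm // norm_sin_le.
have e0 k : 0 < 4 ^+ k :> R by rewrite exprn_gt0.
have -> : y / 2 = 1 / 4 ^+ M by rewrite /y exprS; field; rewrite gt_eqF.
rewrite mulrA mulr1 ler_pdivrMr //.
suff : 4 ^+ i.+1 <= 4 ^+ M :> R by rewrite exprS; lra.
by rewrite ler_eXn2l // ltr1n.
Qed.

Lemma tent_eq0_away M x : 8 / 4 ^+ M <= x <= pi -> tent M x = 0.
Proof.
move=> /andP[x1 x2]; apply/eqP; rewrite tent_eq0.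
have e0 : 0 < 4 ^+ M :> R by rewrite exprn_gt0.
have x0 : 0 <= x by apply: le_trans x1; rewrite divr_ge0 // ltW.
have s := @sin_ge R (x / 2) _; have s1 : x / 2 / 4 <= sin (x / 2) by apply: s; lra.
move: x1; rewrite ler_pdivrMr // => x1.
apply: (@le_trans _ _ (4 ^+ M * sin (x / 2))); last by rewrite ler_wpM2l ?(ltW e0) // ler_norm.
apply: (@le_trans _ _ (4 ^+ M * (x / 2 / 4))); last by rewrite ler_wpM2l ?(ltW e0).
lra.
Qed.

(* The tent sums are continuous away from [0] and unbounded near [0], so by the
   intermediate value theorem they take every large value near [0]. *)
Lemma profile_oscillates (s d : R) : `|s| = 1 -> 0 < d -> exists a b, [/\ 0 < a, a < b, b <= d &
  forall x, a <= x < b -> 1 / 200 <= s * profile x].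
Proof.
move=> s1 d0; have p0 := @pi_gt0 R.
wlog d1 : d d0 / d <= 1.
  move=> H; have [|d1] := leP d 1; first exact: H.
  have [a [b [a0 ab b1 Hab]]] := H 1 ltr01 (lexx _).
  by exists a, b; split=> //; apply: le_trans b1 (ltW d1).
have dpi : d <= pi by have := @pihalf_ge1 R; lra.
pose D := d / 2; have D0 : 0 < D by rewrite divr_gt0.
have eK k : 0 < 4 ^+ k :> R by rewrite exprn_gt0.
have [K HK] : exists K, 8 / 4 ^+ K <= D.
  exists (Num.truncn (8 / D)); rewrite ler_pdivrMr // mulrC -ler_pdivrMr //.
  have /andP[_ /ltW H] := truncn_itv (ltW (divr_gt0 (ltr0n _ 8) D0)).
  apply: le_trans H _; rewrite -natrX ler_nat; exact: ltn_expl.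
have tD : tent K D = 0 by apply: tent_eq0_away; rewrite HK /=; rewrite /D; lra.
have s2 : s ^+ 2 = 1 by rewrite -[s ^+ 2]real_normK ?num_real // s1 expr1n.
(* A level v above the value of the sum at D, where the sine has the prescribed extreme value s. *)
have [v [vB sv]] : exists v, tents K D <= v /\ sin v = s.
  pose n := Num.truncn `|tents K D|.
  have /andP[_ nB] := truncn_itv (normr_ge0 (tents K D)); rewrite -/n in nB.
  exists (s * (pi / 2) + (pi *+ 2) *+ n.+1); split; last first.
    rewrite (periodicn (@sinD2pi R)).
    have [s0|s0] := leP 0 s.
      by move: s1; rewrite ger0_norm // => ->; rewrite mul1r sin_pihalf.
    move: s1; rewrite ltr0_norm // => s1; have -> : s = -1 by rewrite -[s]opprK s1.
    by rewrite mulN1r sinN sin_pihalf.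
  have : - (pi / 2) <= s * (pi / 2).
    rewrite -mulN1r ler_wpM2r ?divr_ge0 ?(ltW p0) //.
    by move: (ler_norm (- s)); rewrite normrN s1; lra.
  have n1 : 1 <= n.+1%:R :> R by rewrite ler1n.
  have := ler_norm (tents K D); have := @pihalf_ge1 R.
  rewrite -[(pi *+ 2) *+ _]mulr_natl; have -> : pi *+ 2 = 2 * pi :> R by rewrite mulr_natl.
  by move: nB n1; set N : R := n.+1%:R; nra.
(* The factor 4/3 offsets the 3/4 of [tents_near0]: the sum at y then exceeds v, and the
   intermediate value theorem applies on [y, D]. *)
have [M0 HM0] := harmonic_unbounded (4 / 3 * v).
pose M := maxn M0 K.
have HM : 4 / 3 * v <= \sum_(i < M) (i.+1%:R : R)^-1.
  apply: le_trans HM0 _; rewrite /M -(subnKC (leq_maxl M0 K)) big_split_ord /= lerDl.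
  by apply: sumr_ge0 => i _; rewrite invr_ge0.
pose y : R := 8 / 4 ^+ M.+1.
have KM : (K <= M.+1)%N by apply: leqW; exact: leq_maxr.
have yD : y <= D.
  by apply: le_trans HK; rewrite ler_pM2l // lef_pV2 ?posrE // ler_eXn2l // ltr1n.
have y0 : 0 < y by rewrite divr_gt0.
have vy : v <= tents M.+1 y by apply: le_trans (tents_near0 M); lra.
have vD : tents M.+1 D <= v by rewrite (tents_stable KM tD).
have [L _ HL] := tents_lipschitz M.+1.
have cont : {within `[y, D], continuous (tents M.+1)}.
  by apply: continuous_subspaceT; exact: lipschitz_continuous HL.
have [|c /[!in_itv]/= /andP[yc cD] cv] := IVT (v := v) yD cont.
  by rewrite ge_min vD orbT /= le_max vy.
have [L1 L10 HL1] := data_lipschitz M.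
have L11 : 0 < 200 * (L1 + 1) by lra.
(* On an interval of this length [data M] varies by at most 1/200, half of its extreme value
   1/100. *)
pose e := Num.min D (1 / (200 * (L1 + 1))).
have e0 : 0 < e by rewrite lt_min D0 divr_gt0.
have eD : e <= D by rewrite ge_min lexx.
have eL : L1 * e <= 1 / 200.
  have : e <= 1 / (200 * (L1 + 1)) by rewrite ge_min lexx orbT.
  by rewrite ler_pdivlMr // => H; lra.
exists c, (c + e); split; [exact: lt_le_trans y0 yc|by rewrite ltrDl|rewrite /D in eD cD; lra|].
move=> x /andP[cx xe].
have -> : profile x = data M x.
  apply: profile_data; apply: tent_eq0_away; rewrite -/y (le_trans yc cx) /=.
  by rewrite /D in eD cD; lra.
have dc : s * data M c = 1 / 100.
  by rewrite /data cv sv mulrCA -expr2 s2 mulr1.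
have H : `|s * (data M x - data M c)| <= 1 / 200.
  rewrite normrM s1 [leLHS]mul1r; apply: le_trans (HL1 c x) _; apply: le_trans eL.
  by rewrite ler_wpM2l // ger0_norm ?subr_ge0 // lerBlDl ltW.
by move: H; rewrite mulrBr dc ler_norml => /andP[H _]; lra.
Qed.

End Profile.

(** * Attainment of the datum *)

Section InitialLimit.
Context {R : realType}.
Variable (U : set_system nat).
Context {UU : UltraFilter U}.
Hypothesis Uoo : \oo `<=` U.
Local Notation RR := (measurableTypeR R).
Local Notation mu := (@circle_measure R).
Local Notation h M := (@mesh R (lat M)).
Local Notation tau M := (@time_step R (lat M)).
Local Notation V := (lims U (@traj R)).
Implicit Types (t e : R) (x y : R).

Lemma lims_traj_le t x : 0 < t -> `|V t x| <= 1 / 100.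
Proof. by move=> t0; apply: lims_norm_le => //; [exact: bdd_traj|move=> M m i; exact: traj_le]. Qed.

Lemma sqr_diff_le (a b c d r : R) : `|a| <= 1 / 100 -> `|b| <= 1 / 100 -> `|c| <= 1 / 100 -> `|d| <= 1 / 100 ->
  `|a - c| <= r -> `|b - d| <= r -> `|(a - b) ^+ 2 - (c - d) ^+ 2| <= r.
Proof.
move=> a1 b1 c1 d1 ac bd.
have -> : (a - b) ^+ 2 - (c - d) ^+ 2 = ((a - c) - (b - d)) * ((a - b) + (c - d)) by ring.
rewrite normrM.
have e1 : `|(a - c) - (b - d)| <= 2 * r by apply: le_trans (ler_normB _ _) _; lra.
have e2 : `|(a - b) + (c - d)| <= 1 / 2.
  apply: le_trans (ler_normD _ _) _; apply: le_trans (lerD (ler_normB _ _) (ler_normB _ _)) _.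
  by lra.
apply: le_trans (ler_pM (normr_ge0 _) (normr_ge0 _) e1 e2) _.
lra.
Qed.

Lemma sampled_lattice (F : R -> R) C M x : 0 <= x < 2 * pi ->
  (forall x y, `|F y - F x| <= C * `|y - x|) ->
  `|F x - F (h M * (idx M x : nat)%:R)| <= `|C| * h M.
Proof.
move=> x02 FC; have /andP[a1 a2] := idx_itv M x02.
apply: le_trans (FC _ _) _; apply: (@le_trans _ _ (`|C| * `|x - h M * (idx M x : nat)%:R|)).
  by rewrite ler_wpM2r // ler_norm.
by rewrite ler_wpM2l // ger0_norm ?subr_ge0 // lerBlDl ltW.
Qed.

Lemma tent_Rintegral_le j : \int[mu]_x tent j x <= 32 / 4 ^+ j :> R.
Proof.
set I := Rintegral _ _ _.
refine (@ucvg_le R U UU (fun M => h M * \sum_(i < (lat M).+2) tent j (h M * (i : nat)%:R)) I _ _ _).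
  apply: (@riemann_cvg R U UU (tent j) (fun M i => tent j (h M * (i : nat)%:R)) 1).
  - exact: tent_measurable.
  - by move=> x; rewrite ger0_norm ?tent_ge0 // tent_le1.
  move=> e e0; have C0 : 0 < `|4 ^+ j / 2| + 1 :> R by rewrite ltr_wpDl.
  have e1 : 0 < e / (`|4 ^+ j / 2| + 1) by rewrite divr_gt0.
  near=> M.
  have hM : h M <= e / (`|4 ^+ j / 2| + 1) by near: M; exact: near_mesh.
  move=> x x02; apply: le_trans (sampled_lattice M x02 (fun x y => tent_lipschitz j y x)) _.
  have := @mesh_gt0 R (lat M); move: hM; rewrite ler_pdivlMr //; lra.
move=> e e0; apply: Uoo; exists j => // M /= jM.
have S := @tent_support R _ M (lat_size M) j jM.
apply: (@le_trans _ _ (32 / 4 ^+ j)); last by rewrite lerDl ltW.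
apply: le_trans S; rewrite ler_pM2l ?mesh_gt0 //; apply: ler_sum => i _.
by have [->|_] := eqVneq (tent j (h M * (i : nat)%:R)) 0; rewrite ?tent_le1.
Unshelve. all: by end_near. Qed.

(** The comparison is with a fixed [data j], which is Lipschitz and can be sampled, unlike
    [profile]. The drift from [data M] contributes 8 t; [data M] and [data j] differ only on the
    support of tent j+1, which contributes the rest. *)
Lemma traj_data_l2 M j t : 0 <= t -> (j < M)%N ->
  h M * \sum_i (traj M (tdx M t) i - data j (h M * (i : nat)%:R)) ^+ 2 <= 8 * t + 64 / 4 ^+ j.+1.
Proof.
move=> t0 jM; have h0 := @mesh_gt0 R (lat M); have /andP[t1 t2] := tdx_itv M t0.
have D := traj_l2_drift (@trajS R M) (fun k => data_le M _) (@traj_energy0 R M) (tdx M t).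
rewrite nrm_sqr /ip in D.
have S := @tent_support R _ M (lat_size M) j.+1 jM.
apply: (@le_trans _ _ (h M * \sum_i (2 * ((traj M (tdx M t) i - traj M 0%N i) * (traj M (tdx M t) i - traj M 0%N i)) +
   2 * (tent j.+1 (h M * (i : nat)%:R) != 0 :> R)%:R))).
  rewrite ler_pM2l //; apply: ler_sum => i _.
  have := data_dist_le (h M * (i : nat)%:R) (ltnW jM).
  have -> : data M (h M * (i : nat)%:R) = traj M 0%N i by [].
  set a := traj M (tdx M t) i; set b := traj M 0%N i; set c := data j _; set z := _%:R => H.
  have := sqr_ge0 ((a - b) - (b - c)); nra.
rewrite big_split /= -!mulr_sumr mulrDr; lra.
Qed.

Lemma lims_traj_data_l2 t j : 0 < t -> \int[mu]_x (V t x - data j x) ^+ 2 <= 8 * t + 64 / 4 ^+ j.+1.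
Proof.
move=> t0; have b := bdd_traj (R := R).
have [C C0 HC] := data_lipschitz (R := R) j.
set I := Rintegral _ _ _.
refine (@ucvg_le R U UU (fun M => h M * \sum_i (traj M (tdx M t) i - data j (h M * (i : nat)%:R)) ^+ 2) I _ _ _).
  apply: (@riemann_cvg R U UU (fun x => (V t x - data j x) ^+ 2)
    (fun M i => (traj M (tdx M t) i - data j (h M * (i : nat)%:R)) ^+ 2) 1).
  - apply: measurable_funX; apply: measurable_funB; first exact: lims_measurable.
    exact: data_measurable.
  - move=> x; rewrite ger0_norm ?sqr_ge0 //; have := lims_traj_le x t0; have := data_le j x.
    by rewrite !ler_norml => /andP[? ?] /andP[? ?]; nra.
  move=> e e0; have e1 : 0 < e / (`|C| + 1) by rewrite divr_gt0 // ltr_wpDl.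
  near=> M.
  have hM : h M <= e / (`|C| + 1) by near: M; exact: near_mesh.
  have H1 : forall x, 0 <= x < 2 * pi -> `|V t x - traj M (tdx M t) (idx M x)| <= e.
    by near: M; exact: lims_near_uniform.
  move=> x x02; apply: sqr_diff_le; rewrite ?lims_traj_le ?data_le ?traj_le // ?H1 //.
  apply: le_trans (sampled_lattice M x02 HC) _.
  have := @mesh_gt0 R (lat M); move: hM; rewrite ler_pdivlMr ?ltr_wpDl //; lra.
move=> e e0; apply: Uoo; exists j.+1 => // M /= jM.
by apply: le_trans (traj_data_l2 (ltW t0) jM) _; rewrite lerDl ltW.
Unshelve. all: by end_near. Qed.

Lemma sqr_dist_integrable (F G : RR -> R) : measurable_fun setT F -> measurable_fun setT G ->
  (forall x, `|F x| <= 1 / 100) -> (forall x, `|G x| <= 1 / 100) ->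
  mu.-integrable setT (EFin \o (fun x => (F x - G x) ^+ 2)).
Proof.
move=> mF mG Fb Gb; apply: (bounded_integrable (circle_measure_lty (R := R)) (C := 1)) => //.
  by apply: measurable_funX; apply: measurable_funB.
move=> x; rewrite ger0_norm ?sqr_ge0 //; have := Fb x; have := Gb x.
by rewrite !ler_norml => /andP[? ?] /andP[? ?]; nra.
Qed.

Lemma lims_traj_profile_l2 t : 0 < t -> \int[mu]_x (V t x - profile x) ^+ 2 <= 16 * t.
Proof.
move=> t0; apply/ler_addgt0Pr => e e0.
(* The two errors are at most 2 times 64 / 4^j and 4 times 32 / 4^j, together 256 / 4^j. *)
have [j Hj] : exists j, 256 / 4 ^+ j <= e.
  exists (Num.truncn (256 / e)); rewrite ler_pdivrMr ?exprn_gt0 // mulrC -ler_pdivrMr //.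
  have /andP[_ /ltW H] := truncn_itv (ltW (divr_gt0 (ltr0n _ 256) e0)).
  apply: le_trans H _; rewrite -natrX ler_nat; exact: ltn_expl.
have b := bdd_traj (R := R); have fin := circle_measure_lty (R := R).
have mV := @lims_measurable R U UU Uoo _ _ b t0.
have I0 := sqr_dist_integrable mV (data_measurable j) (fun x => lims_traj_le x t0) (data_le j).
have It : mu.-integrable setT (EFin \o (tent j : RR -> R)).
  apply: (@bounded_integrable _ _ _ mu fin _ 1) => //; first exact: tent_measurable.
  by move=> x; rewrite ger0_norm ?tent_ge0 // tent_le1.
have I1 : mu.-integrable setT (EFin \o (fun x => 2 * (V t x - data j x) ^+ 2)).
  exact: (integrableZl (mu := mu) measurableT 2 I0).
have I2 : mu.-integrable setT (EFin \o (fun x => 4 * tent j x)).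
  exact: (integrableZl (mu := mu) measurableT 4 It).
apply: (@le_trans _ _ (\int[mu]_x (2 * (V t x - data j x) ^+ 2 + 4 * tent j x))).
  apply: le_Rintegral => //.
  - exact: (sqr_dist_integrable mV profile_measurable (fun x => lims_traj_le x t0) profile_le).
  - exact: (integrableD _ I1 I2).
  move=> x _; have := profile_dist_le j x; have := sqr_ge0 ((V t x - data j x) + (profile x - data j x)).
  by nra.
rewrite RintegralD // !RintegralZl //.
have := lims_traj_data_l2 j t0; have := tent_Rintegral_le j.
have q : 64 / 4 ^+ j.+1 <= 64 / 4 ^+ j :> R.
  by rewrite ler_pM2l // lef_pV2 ?posrE ?exprn_gt0 // ler_eXn2l // ltr1n.
move: Hj q; lra.
Qed.

End InitialLimit.

(** * From L^2 convergence to weak-star convergence *)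

Section BoundedConvergence.
Context d (T : measurableType d) {R : realType} (mu : {measure set T -> \bar R}).
Hypothesis mufin : (mu setT < +oo)%E.
Implicit Types (f g w phi : T -> R).

Lemma bounded_in_Loo f (C : R) : measurable_fun setT f -> (forall x, `|f x| <= C) ->
  f \in Lfun mu +oo%E.
Proof.
move=> mf fC; apply/andP; split; rewrite inE //=.
rewrite /finite_norm unlock /Lnorm; case: ifPn => // _.
apply: (@le_lt_trans _ _ C%:E); last exact: ltry.
by apply/ess_supP; apply: nearW => x /=; rewrite lee_fin.
Qed.

Lemma Lnorm2_le f (C K : R) : measurable_fun setT f -> (forall x, `|f x| <= C) ->
  \int[mu]_x (f x ^+ 2) <= K -> ('N[mu]_2%:E[(fun x => (f x)%:E)] <= (Num.sqrt K)%:E)%E.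
Proof.
move=> mf fC fK.
have I : mu.-integrable setT (EFin \o (fun x => f x ^+ 2)).
  apply: (@bounded_integrable _ _ _ mu mufin _ (C ^+ 2)) => //.
    exact: measurable_funX.
  move=> x; rewrite normrX ler_pXn2r ?nnegrE //; exact: le_trans (fC x).
have K0 : 0 <= \int[mu]_x (f x ^+ 2) by apply: Rintegral_ge0 => x _; exact: sqr_ge0.
rewrite unlock /Lnorm.
have -> : (\int[mu]_x (`|(f x)%:E| `^ 2) = (\int[mu]_x (f x ^+ 2))%:E)%E.
  rewrite /Rintegral fineK ?integrable_fin_num //.
  apply: eq_integral => x _ /=.
  by rewrite powR_mulrn // real_normK ?num_real.
rewrite poweR_EFin lee_fin -powR12_sqrt; last exact: le_trans fK.
by apply: ge0_ler_powR => //; rewrite nnegrE //; exact: le_trans fK.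
Qed.

Definition tail (k : nat) phi : T -> R := fun x => Num.max 0 (`|phi x| - k%:R).

Lemma tail_ge0 k phi x : 0 <= tail k phi x.
Proof. by rewrite /tail le_max lexx. Qed.

Lemma tail_split k phi x : `|phi x| <= k%:R + tail k phi x.
Proof. by rewrite addrC -lerBlDr /tail le_max lexx orbT. Qed.

Lemma tail_le k phi x : tail k phi x <= `|phi x|.
Proof. by rewrite /tail ge_max normr_ge0 /= gerBl. Qed.

Lemma tail_measurable k phi : measurable_fun setT phi -> measurable_fun setT (tail k phi).
Proof.
move=> mphi; apply: measurable_maxr => //; apply: measurable_funB => //.
exact: measurableT_comp.
Qed.

Lemma tail_integrable k phi : mu.-integrable setT (EFin \o phi) ->
  mu.-integrable setT (EFin \o tail k phi).
Proof.
move=> iphi; have mphi : measurable_fun setT phi by apply/measurable_EFinP; exact: measurable_int iphi.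
apply: le_integrable iphi => //; first by apply/measurable_EFinP; exact: tail_measurable.
by move=> x _ /=; rewrite lee_fin ger0_norm ?tail_ge0 // tail_le.
Qed.

Lemma tail_cvg phi : mu.-integrable setT (EFin \o phi) ->
  (fun k => \int[mu]_x tail k phi x) @ \oo --> (0 : R).
Proof.
move=> iphi; have mphi : measurable_fun setT phi by apply/measurable_EFinP; exact: measurable_int iphi.
have m1 k : measurable_fun setT (EFin \o tail k phi).
  by apply/measurable_EFinP; exact: tail_measurable.
have c1 : {ae mu, forall x, setT x -> (fun k => (EFin \o tail k phi) x) @ \oo --> 0%E}.
  apply: aeW => x _; apply: cvg_near_cst; exists (Num.truncn `|phi x|).+1 => // k /= hk.
  congr _%:E; rewrite /tail; apply/max_idPl; rewrite subr_le0.
  have /andP[_ /ltW H] := truncn_itv (normr_ge0 (phi x)).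
  by apply: le_trans H _; rewrite ler_nat.
have b1 : {ae mu, forall x k, setT x -> (`|(EFin \o tail k phi) x| <= (abse \o (EFin \o phi)) x)%E}.
  by apply: aeW => x k _ /=; rewrite lee_fin ger0_norm ?tail_ge0 // tail_le.
have [_ _ H] := @dominated_convergence _ T R mu setT measurableT
  (fun k => EFin \o tail k phi) (cst 0%E) (abse \o (EFin \o phi)) m1 (measurable_cst _) c1
  (integrable_abse iphi) b1.
rewrite integral0 in H; have := fine_cvg H.
by apply.
Qed.

(** The test function is only integrable, so |phi| is split into a part at most k and a tail. The
    tail meets the uniform bound on w and g; the bounded part meets the L^2 distance. *)
Lemma weak_limit_of_l2 (S : Type) (F : set_system S) {FF : Filter F} (w : S -> T -> R) g phi (C : R) :
  mu.-integrable setT (EFin \o phi) -> measurable_fun setT g -> (forall x, `|g x| <= C) ->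
  (\forall t \near F, measurable_fun setT (w t) /\ forall x, `|w t x| <= C) ->
  (forall e, 0 < e -> \forall t \near F, \int[mu]_x ((w t x - g x) ^+ 2) <= e) ->
  (fun t => \int[mu]_x (w t x * phi x)) @ F --> \int[mu]_x (g x * phi x).
Proof.
move=> iphi mg gC wC H; apply/cvgrPdist_le => e e0.
have mphi : measurable_fun setT phi by apply/measurable_EFinP; exact: measurable_int iphi.
have C0 : 0 < `|C| + 1 by rewrite ltr_wpDl.
have T0 : 0 < fine (mu setT) + 1 by rewrite ltr_wpDl // fine_ge0.
have e1 : 0 < e / 3 / (2 * (`|C| + 1)) by rewrite !divr_gt0 // mulr_gt0.
have [k Hk] : exists k, \int[mu]_x tail k phi x <= e / 3 / (2 * (`|C| + 1)).
  have [k _ HK] := cvgr_le _ (tail_cvg iphi) _ e1; exists k; exact: (HK k (leqnn k)).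
(* With b = k^2 / a one has z k <= a + b z^2, so that only the integral of z^2 is needed; the three
   contributions are e / 3 each. *)
pose a := e / 3 / (fine (mu setT) + 1); have a0 : 0 < a by rewrite !divr_gt0.
pose b := k%:R ^+ 2 / a; have b0 : 0 <= b by rewrite divr_ge0 ?exprn_ge0 // ltW.
have b1 : 0 < b + 1 by rewrite ltr_wpDl.
have e2 : 0 < e / 3 / (b + 1) by rewrite !divr_gt0.
near=> t.
have [mw wC'] : measurable_fun setT (w t) /\ forall x, `|w t x| <= C by near: t.
have Ht : \int[mu]_x ((w t x - g x) ^+ 2) <= e / 3 / (b + 1) by near: t; exact: H.
have im f : measurable_fun setT f -> (forall x, `|f x| <= C) -> mu.-integrable setT (EFin \o (fun x => f x * phi x)).
  move=> mf fC; apply: (@le_integrable _ _ _ mu setT measurableT _ (EFin \o (fun x => C * `|phi x|))).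
  - by apply/measurable_EFinP; apply: measurable_funM.
  - move=> x _ /=; rewrite lee_fin normrM [leRHS]ger0_norm ?ler_wpM2r //.
    by rewrite mulr_ge0 //; exact: le_trans (fC x).
  - have := integrable_abse iphi; move/(integrableZl (mu := mu) measurableT C); exact.
rewrite -RintegralB //; [|exact: im|exact: im].
have iB : mu.-integrable setT (EFin \o (fun x => g x * phi x - w t x * phi x)).
  exact: (integrableB measurableT (im _ mg gC) (im _ mw wC')).
apply: le_trans (le_normr_Rintegral measurableT iB) _.
have d2 : forall x, `|w t x - g x| <= 2 * (`|C| + 1).
  move=> x; apply: le_trans (ler_normB _ _) _; have := wC' x; have := gC x; have := ler_norm C; lra.
have I0 : mu.-integrable setT (EFin \o (fun x : T => a)) by apply: (@bounded_integrable _ _ _ mu mufin _ `|a|).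
have I1 : mu.-integrable setT (EFin \o (fun x => (w t x - g x) ^+ 2)).
  apply: (@bounded_integrable _ _ _ mu mufin _ ((2 * (`|C| + 1)) ^+ 2)) => //.
    by apply: measurable_funX; apply: measurable_funB.
  by move=> x; rewrite normrX ler_pXn2r ?nnegrE // mulr_ge0 // ltW.
have I1b := integrableZl (mu := mu) measurableT b I1.
have I2 := tail_integrable k iphi.
have I2b := integrableZl (mu := mu) measurableT (2 * (`|C| + 1)) I2.
apply: (@le_trans _ _ (\int[mu]_x (a + b * (w t x - g x) ^+ 2 + 2 * (`|C| + 1) * tail k phi x))).
  apply: le_Rintegral => //.
  - exact: integrable_abse iB.
  - by have := integrableD measurableT (integrableD measurableT I0 I1b) I2b.
  move=> x _; rewrite -mulrBl normrM distrC.
  have q := tail_split k phi x; have q0 := tail_ge0 k phi x.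
  set z := `|w t x - g x|.
  have z2 : (w t x - g x) ^+ 2 = z ^+ 2 by rewrite real_normK ?num_real.
  have z0 : 0 <= z by exact: normr_ge0.
  have zC : z <= 2 * (`|C| + 1) by exact: d2.
  apply: (@le_trans _ _ (z * (k%:R + tail k phi x))); first by rewrite ler_wpM2l.
  rewrite mulrDr; apply: lerD; last by rewrite ler_wpM2r.
  rewrite z2 /b -subr_ge0.
  have -> : a + k%:R ^+ 2 / a * z ^+ 2 - z * k%:R = ((a - z * k%:R / 2) ^+ 2 + 3 / 4 * (z * k%:R) ^+ 2) / a.
    by field; rewrite gt_eqF.
  apply: divr_ge0; last exact: ltW.
  by apply: addr_ge0; rewrite ?sqr_ge0 // mulr_ge0 // sqr_ge0.
rewrite RintegralD //; last by exact: (integrableD measurableT I0 I1b).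
have -> : \int[mu]_x (a + b * (w t x - g x) ^+ 2) = a * fine (mu setT) + b * \int[mu]_x ((w t x - g x) ^+ 2).
  rewrite (RintegralD (f1 := fun=> a) measurableT I0 I1b) (RintegralZl b measurableT I1).
  by rewrite Rintegral_cst.
rewrite (RintegralZl _ measurableT I2).
have p1 : a * fine (mu setT) <= e / 3.
  rewrite /a -mulrA ler_piMr ?divr_ge0 ?(ltW e0) // mulrC ler_pdivrMr // mul1r lerDl.
  by [].
have p2 : b * \int[mu]_x (w t x - g x) ^+ 2 <= e / 3.
  apply: (@le_trans _ _ (b * (e / 3 / (b + 1)))); first by rewrite ler_wpM2l.
  rewrite mulrCA ler_piMr ?divr_ge0 ?(ltW e0) // ler_pdivrMr // mul1r lerDl.
  by [].
have p3 : 2 * (`|C| + 1) * \int[mu]_x tail k phi x <= e / 3.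
  by move: Hk; rewrite ler_pdivlMr ?mulr_gt0 // mulrC.
by apply: le_trans (lerD (lerD p1 p2) p3) _; lra.
Unshelve. all: by end_near. Qed.

End BoundedConvergence.

(** * Functions of the first coordinate on the torus *)

Section FirstCoordinate.
Context {R : realType} (n : nat).
Local Notation RR := (measurableTypeR R).
Local Notation mu := (@circle_measure R).
Local Notation tor := (@torus_measure R).
Implicit Types (F G : RR -> R) (A B : set RR).

Lemma first_measurable F : measurable_fun setT F ->
  measurable_fun setT (fun x : n.+1.-tuple RR => F (tnth x ord0)).
Proof. by move=> mF; apply: (measurableT_comp mF); exact: measurable_tnth. Qed.

Lemma first_Rintegral F (C : R) : measurable_fun setT F -> (forall x, `|F x| <= C) ->
  \int[tor n.+1]_x F (tnth x ord0) = \int[mu]_x F x * fine (tor n setT).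
Proof.
move=> mF FC.
rewrite (@torus_Rintegral_prod R n (fun x => F (tnth x ord0)) F (fun=> 1) C C 1) //.
- by rewrite Rintegral_cst // mul1r.
- exact: first_measurable.
- by move=> x; rewrite normr1.
- by move=> x y; rewrite tnth0 mulr1.
Qed.

Definition box m B : set (m.-tuple RR) := [set x | forall i, B (tnth x i)].

Lemma box_measurable m B : measurable B -> measurable (@box m B).
Proof.
move=> mB; rewrite (_ : box B = \bigcap_(i in [set: 'I_m]) ((@tnth m RR ^~ i) @^-1` B)).
  apply: fin_bigcap_measurable => // i _.
  by rewrite -[_ @^-1` _]setTI; apply: measurable_tnth.
by apply/seteqP; split => x H i => [_|]; apply: H.
Qed.

Definition boxes m A B : set (m.+1.-tuple RR) :=
  [set x | A (tnth x ord0) /\ forall i, B (tnth x (lift ord0 i))].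

Lemma boxes_measurable m A B : measurable A -> measurable B -> measurable (@boxes m A B).
Proof.
move=> mA mB; rewrite (_ : boxes A B = ((@tnth m.+1 RR ^~ ord0) @^-1` A) `&`
    \bigcap_(i in [set: 'I_m]) ((@tnth m.+1 RR ^~ (lift ord0 i)) @^-1` B)).
  apply: measurableI; first by rewrite -[_ @^-1` _]setTI; apply: measurable_tnth.
  apply: fin_bigcap_measurable => // i _.
  by rewrite -[_ @^-1` _]setTI; apply: measurable_tnth.
by apply/seteqP; split => x /= [H1 H2]; split => // i; [move=> _|]; apply: H2.
Qed.

Lemma boxes_measure m A B : measurable A -> measurable B ->
  tor m.+1 (boxes A B) = (mu A * tor m (@box m B))%E.
Proof.
move=> mA mB.
rewrite -[LHS]/((mu \x tor m)%E (@tuple_cons R m @^-1` boxes A B)).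
rewrite (_ : _ @^-1` _ = A `*` @box m B); first by rewrite product_measure1E //; exact: box_measurable.
apply/seteqP; split => -[x y] /= [H1 H2]; split.
- by move: H1; rewrite tnth0.
- by move=> i; have := H2 i; rewrite tnthS.
- by rewrite tnth0.
- by move=> i; rewrite tnthS.
Qed.

Lemma box_gt0 m B : measurable B -> (0 < mu B)%E -> (0 < tor m (@box m B))%E.
Proof.
move=> mB B0; elim: m => [|m IHm].
  rewrite (_ : box B = setT); last by apply/seteqP; split => // x _ [].
  by rewrite -[tor 0 _]/(\d_ ([tuple] : 0.-tuple RR) setT) diracT lte01.
rewrite (_ : box B = boxes B B); first by rewrite boxes_measure // mule_gt0.
apply/seteqP; split => x /=; first by move=> H; split=> [|i]; exact: H.
by move=> [H1 H2] i; case: (unliftP ord0 i) => [j ->|->].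
Qed.

Lemma boxes_gt0 m A B : measurable A -> measurable B -> (0 < mu A)%E -> (0 < mu B)%E ->
  (0 < tor m.+1 (boxes A B))%E.
Proof. by move=> mA mB A0 B0; rewrite boxes_measure // mule_gt0 //; exact: box_gt0. Qed.

Lemma circle_itv_gt0 (a b : R) : 0 <= a -> a < b -> b <= 2 * pi -> (0 < mu `[a, b[%classic)%E.
Proof. by move=> a0 ab b2; rewrite circle_itv ?(ltW ab) // lte_fin subr_gt0. Qed.

Lemma first_periodic (F : R -> R) : (forall x, F (x + 2 * pi) = F x) ->
  torus_periodic (fun y : 'rV[R]_n.+1 => F (y 0 ord0)).
Proof.
move=> Fp k y; rewrite !mxE.
have P (m : nat) x : F (x + 2 * pi * m%:R) = F x.
  elim: m x => [|m IHm] x; first by rewrite mulr0 addr0.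
  have -> : 2 * pi * m.+1%:R = 2 * pi * m%:R + 2 * pi :> R by rewrite -natr1; ring.
  by rewrite addrA Fp IHm.
case: (k 0 ord0) => m; first exact: P.
by rewrite NegzE mulrNz -[LHS](P m.+1) mulrN subrK.
Qed.

Definition blowup (y : 'rV[R]_n.+1) : R := - (1 + profile (y 0 ord0)).

Lemma blowup_periodic : torus_periodic blowup.
Proof. by apply: (@first_periodic (fun x => - (1 + profile x))) => x; rewrite profileD2pi. Qed.

Lemma blowup_measurable : measurable_fun setT (fun x : n.+1.-tuple RR => blowup (torus_pt x)).
Proof.
rewrite (_ : (fun x => _) = fun x : n.+1.-tuple RR => - (1 + profile (tnth x ord0))).
  apply: measurableT_comp => //; apply: measurable_funD => //.
  by apply: first_measurable; exact: profile_measurable.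
by apply/funext => x; rewrite /blowup mxE.
Qed.

Lemma blowup_le (y : 'rV[R]_n.+1) : `|blowup y| <= 2.
Proof.
rewrite /blowup normrN; have := profile_le (y 0 ord0).
by rewrite !ler_norml => /andP[? ?]; apply/andP; split; lra.
Qed.

Lemma blowup_in_Loo : in_Lp +oo%E blowup.
Proof. exact: (@bounded_in_Loo _ _ R (tor n.+1) _ 2 blowup_measurable (fun x => blowup_le _)). Qed.

(** Arbitrarily close to 0 there are boxes of positive measure on which [profile] is at least 1/200,
    and others on which it is at most -1/200. Each contains a point where g equals [blowup]; these
    two values of g are 1/100 apart, although both lie within 1/400 of g(0). *)
Lemma blowup_not_ae_continuous : ~ ae_continuous blowup.
Proof.
move=> [g [_ gcont [N [mN N0 NE]]]]; have p1 := @pihalf_ge1 R.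
have /cvgrPdist_lt /(_ (1 / 400)) := gcont 0.
have e0 : 0 < 1 / 400 :> R by lra.
move=> /(_ e0) /nbhs_ballP [r /= r0 Hr].
pose q := Num.min 1 (r / 2).
have q0 : 0 < q by rewrite lt_min ltr01 divr_gt0.
have q1 : q <= 1 by rewrite ge_min lexx.
have qr : q < r by apply: (@le_lt_trans _ _ (r / 2)); [rewrite ge_min lexx orbT|lra].
have mI (a b : R) : measurable (`[a, b[%classic : set RR) by exact: measurable_itv.
have key (s : R) : `|s| = 1 -> exists x : n.+1.-tuple RR,
    [/\ `|g (torus_pt x) - g 0| < 1 / 400, blowup (torus_pt x) = g (torus_pt x) &
        1 / 200 <= s * profile (torus_pt x 0 ord0)].
  move=> s1; have [a [b [a0 ab bq Hab]]] := profile_oscillates s1 q0.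
  (* The remaining coordinates range over [0, q), so that the whole box lies in the ball of radius r
     about 0. *)
  have pos : (0 < tor n.+1 (boxes `[a, b[%classic `[0%R, q[%classic))%E.
    by apply: boxes_gt0 => //; apply: circle_itv_gt0 => //; [exact: ltW|lra|lra].
  have : ~ (boxes `[a, b[%classic `[0%R, q[%classic `<=` N).
    move=> sub; move: pos; rewrite ltNge => /negP; apply.
    rewrite -N0; apply: le_measure => //; rewrite ?inE //.
    exact: boxes_measurable.
  move/existsNP => [x /not_implyP[[xA xB] xN]].
  exists x; split.
  - rewrite distrC; apply: Hr; split=> // i j; rewrite !mxE /ball /= sub0r normrN.
    have [->|[j' ->]] : j = ord0 \/ exists j', j = lift ord0 j'.
      by case: (unliftP ord0 j) => [j' ->|->]; [right; exists j'|left].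
      move: xA; rewrite /= in_itv /= => /andP[c1 c2].
      rewrite ger0_norm; last exact: le_trans (ltW a0) c1.
      by apply: lt_trans c2 _; apply: le_lt_trans bq qr.
    have := xB j'; rewrite /= in_itv /= => /andP[c1 c2].
    by rewrite ger0_norm //; apply: lt_trans c2 qr.
  - by apply: contrapT => H; apply: xN; exact: NE.
  - by rewrite mxE; apply: Hab; move: xA; rewrite /= in_itv.
have [|x [x1 x2 x3]] := key 1; first by rewrite normr1.
have [|y [y1 y2 y3]] := key (-1); first by rewrite normrN1.
clear N0; move: x1 y1; rewrite -x2 -y2 /blowup !ltr_norml => /andP[? ?] /andP[? ?]; lra.
Qed.

Lemma first_Rintegral_sqr_le F G (C K : R) : measurable_fun setT F -> measurable_fun setT G ->
  (forall x, `|F x| <= C) -> (forall x, `|G x| <= C) ->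
  \int[mu]_x (F x - G x) ^+ 2 <= K ->
  \int[tor n.+1]_x (F (tnth x ord0) - G (tnth x ord0)) ^+ 2 <= K * fine (tor n setT).
Proof.
move=> mF mG FC GC FG.
rewrite (@first_Rintegral (fun x => (F x - G x) ^+ 2) ((2 * C) ^+ 2)).
- by rewrite ler_wpM2r // fine_ge0.
- by apply: measurable_funX; apply: measurable_funB.
- move=> x; have C0 : 0 <= C by apply: le_trans (FC x).
  rewrite normrX ler_pXn2r ?nnegrE ?mulr_ge0 //.
  by apply: le_trans (ler_normB _ _) _; have := FC x; have := GC x; lra.
Qed.

End FirstCoordinate.

(** * The solution *)

Section ReversedFamily.
Context {R : realType}.
Implicit Types (a b : @lattice_family R).

Lemma good_cst (c : R) : good (fun M m i => c).
Proof.
have E p j : iter j dif (fun _ : 'I_p.+2 => c) = fun=> if j is 0%N then c else 0.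
  elim: j => [//|j IH]; rewrite iterS IH; apply/funext => i; rewrite /dif.
  by rewrite subrr mul0r.
have b1 : bdd (fun M m i => c).
  move=> j d T d0; exists `|c|; split=> // M m i _; rewrite E.
  by case: j => [|j] //; rewrite normr0.
split=> //; apply: bdd_ext (bdd_lin 0 0 b1 b1) => M m i.
by rewrite /tq subrr !mul0r addr0.
Qed.

(** This is - U on the lattice, still in forward time; [reversed] turns time round afterwards. It is
    written as a linear combination to match [good_lin] and [lims_lin]. *)
Definition rev_traj : lattice_family := fun M m i => -1 * 1 + -1 * @traj R M m i.

Arguments rev_traj M m i : clear implicits.

Lemma good_rev : good rev_traj.
Proof. exact: (good_lin (-1) (-1) (good_cst 1) (good_traj (R := R))). Qed.

Lemma tq_rev M m i : tq rev_traj M m i = - rhs (traj M m) i.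
Proof. by rewrite -tq_traj /tq /rev_traj -mulNr; congr (_ / _); ring. Qed.

Lemma good_tq_rev : good (tq rev_traj).
Proof.
apply: good_ext (good_lin (-1) 0 (good_rhs_traj (R := R)) (good_cst 0)) => M m i.
by rewrite tq_rev; ring.
Qed.

(** The scheme satisfies the equation exactly, with the time quotient negated for the reversal, so
    that no consistency error has to be estimated in the limit. *)
Lemma rev_equation M m i :
  - tq rev_traj M m i - rev_traj M m i * labs (rev_traj M m) i +
    labs (fun i => rev_traj M m i * rev_traj M m i) i = 0.
Proof.
rewrite tq_rev opprK.
have -> : labs (rev_traj M m) = fun x => - labs (traj M m) x.
  rewrite (labs_lin (-1) (-1) (fun=> 1) (traj M m)) labs_cst.
  by apply/funext => x; ring.
have -> : labs (fun i => rev_traj M m i * rev_traj M m i) =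
    fun x => 2 * labs (traj M m) x + labs (fun i => traj M m i * traj M m i) x.
  have -> : (fun i => rev_traj M m i * rev_traj M m i) =
      (fun i => 1 * (1 * 1 + 2 * traj M m i) + 1 * (traj M m i * traj M m i)).
    by apply/funext => x; rewrite /rev_traj; ring.
  rewrite labs_lin (labs_lin 1 2 (fun=> 1) (traj M m)) labs_cst.
  by apply/funext => x; ring.
by rewrite /rev_traj /rhs /quad; ring.
Qed.

End ReversedFamily.

Arguments rev_traj {R} M m i.

Section FirstCoordinateCalculus.
Context {R : realType} (n : nat).
Local Notation V := 'rV[R]_n.+1.
Implicit Types (F : R -> R).

Lemma first_continuous F : continuous F -> continuous (fun y : V => F (y 0 ord0)).
Proof.
move=> Fc y; apply: (@continuous_comp V R R (fun y : V => y 0 ord0) F); last exact: Fc.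
exact: coord_continuous.
Qed.

(** The factor k accommodates iterated partial derivatives, which keep the form of a constant times
    a function of x_0. *)
Lemma first_derive F F' (C k : R) (i : 'I_n.+1) (y : V) :
  (forall x z, `|F z - F x - (z - x) * F' x| <= C * (z - x) ^+ 2) ->
  derivable (fun y : V => k * F (y 0 ord0)) y (delta_mx 0 i) /\
  'D_(delta_mx 0 i) (fun y : V => k * F (y 0 ord0)) y = (k * (ord0 == i)%:R) * F' (y 0 ord0).
Proof.
move=> H; set L := _ * F' _.
suff : (fun h : R => h^-1 *: (k * F ((h *: (delta_mx 0 i : V) + y) 0 ord0) - k * F (y 0 ord0))) @ 0^' --> L.
  by move=> cL; split; [apply: (cvgP L)|apply: cvg_lim].
have C0 : 0 < `|k| * `|C| + 1 by rewrite ltr_wpDl // mulr_ge0.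
apply/cvgrPdist_le => e e0; have e1 : 0 < e / (`|k| * `|C| + 1) by rewrite divr_gt0.
near=> h.
have h0 : h != 0 by near: h; exact: nbhs_dnbhs_neq.
have hs : `|h| <= e / (`|k| * `|C| + 1).
  by near: h; exact: dnbhs0_le.
set x := y 0 ord0; rewrite !mxE ?eqxx /= -/x.
set s : R := (ord0 == i)%:R in L *.
have s1 : s ^+ 2 <= 1 by rewrite /s; case: eqP; rewrite ?expr1n // expr0n.
have T := H x (h * s + x); rewrite addrK in T.
have -> : L - h^-1 *: (k * F (h * s + x) - k * F x) =
   - (h^-1 * k) * (F (h * s + x) - F x - h * s * F' x).
  by rewrite /L /GRing.scale /=; field.
rewrite normrM normrN normrM.
apply: (@le_trans _ _ (`|h^-1| * `|k| * (C * (h * s) ^+ 2))); first by rewrite ler_wpM2l // mulr_ge0.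
have h2 : h ^+ 2 = `|h| ^+ 2 by rewrite real_normK ?num_real.
rewrite exprMn h2 normfV.
have hp : 0 < `|h| by rewrite normr_gt0.
have -> : `|h|^-1 * `|k| * (C * (`|h| ^+ 2 * s ^+ 2)) = `|h| * (`|k| * (C * s ^+ 2)).
  by field; rewrite gt_eqF.
have : `|k| * (C * s ^+ 2) <= `|k| * `|C|.
  rewrite ler_wpM2l //; apply: (@le_trans _ _ (`|C| * s ^+ 2)).
    by rewrite ler_wpM2r ?sqr_ge0 // ler_norm.
  by rewrite ler_piMr.
move: hs; rewrite ler_pdivlMr // => hs hk.
apply: le_trans hs; rewrite ler_wpM2l //; apply: le_trans hk _; by rewrite lerDl.
Unshelve. all: by end_near. Qed.

End FirstCoordinateCalculus.

Section Solution.
Context {R : realType} (n : nat).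
Variable (U : set_system nat).
Context {UU : UltraFilter U}.
Hypothesis Uoo : \oo `<=` U.
Variable T : R.
Hypothesis T0 : 0 < T.
Local Notation V := 'rV[R]_n.+1.
Implicit Types (a b : @lattice_family R) (t x : R) (y : V).

Lemma lims_ext a b t x : (forall M m i, a M m i = b M m i) -> lims U a t x = lims U b t x.
Proof. by move=> ab; rewrite /lims; congr ulim; apply/funext => M; exact: ab. Qed.

Definition reversed a t y : R := lims U a (T - t) (y 0 ord0).

Lemma reversed_periodic a t : torus_periodic (reversed a t).
Proof. by apply: first_periodic => x; exact: lims_periodic. Qed.

Lemma reversed_slab a : good a -> continuous_on_slab T (reversed a).
Proof.
move=> ga; apply/subspace_continuousP => -[t y] /= /andP[t0 tT].
(* The bounds hold only away from time 0 of the forward problem, that is from t = T; near t the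
   remaining time stays above d. *)
pose d := (T - t) / 2; have d0 : 0 < d by rewrite divr_gt0 // subr_gt0.
have [C1 [C10 H1]] := lims_lip_t Uoo T ga d0.
have [C2 [C20 H2]] := lims_lip_x Uoo T ga.1 d0.
apply/cvgrPdist_le => e e0.
have C0 : 0 < C1 + C2 + 1 by rewrite ltr_wpDl // addr_ge0.
have e1 : 0 < e / (C1 + C2 + 1) by rewrite divr_gt0.
have c1 : (fun p : R * V => p.1) @ within [set p : R * V | 0 <= p.1 < T] (nbhs (t, y)) --> t.
  by apply: cvg_within_filter; exact: cvg_fst.
have c2 : (fun p : R * V => p.2 0 ord0) @ within [set p : R * V | 0 <= p.1 < T] (nbhs (t, y)) --> y 0 ord0.
  apply: cvg_within_filter.
  apply: (@cvg_comp _ _ _ snd (fun z : V => z 0 ord0) _ (nbhs y)); first exact: cvg_snd.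
  exact: coord_continuous.
near=> p.
have p0 : 0 <= p.1 < T by near: p; exact: withinT.
have pt1 : `|t - p.1| <= d by near: p; move/cvgrPdist_le: c1; exact.
have pt2 : `|t - p.1| <= e / (C1 + C2 + 1) by near: p; move/cvgrPdist_le: c1; exact.
have py : `|y 0 ord0 - p.2 0 ord0| <= e / (C1 + C2 + 1) by near: p; move/cvgrPdist_le: c2; exact.
have /andP[p1 p2] := p0.
have ds : d <= T - p.1 <= T by move: pt1; rewrite ler_norml /d => /andP[? ?]; apply/andP; split; lra.
have dt : d <= T - t <= T by rewrite /d; apply/andP; split; lra.
rewrite /reversed.
have -> : lims U a (T - t) (y 0 ord0) - lims U a (T - p.1) (p.2 0 ord0) =
  (lims U a (T - t) (y 0 ord0) - lims U a (T - p.1) (y 0 ord0)) +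
  (lims U a (T - p.1) (y 0 ord0) - lims U a (T - p.1) (p.2 0 ord0)) by ring.
apply: le_trans (ler_normD _ _) _.
have b1 := H1 _ _ (y 0 ord0) ds dt; have b2 := H2 _ (p.2 0 ord0) (y 0 ord0) ds.
have E : T - t - (T - p.1) = - (t - p.1) by ring.
rewrite E normrN in b1; apply: le_trans (lerD b1 b2) _.
move: pt2 py; rewrite !ler_pdivlMr // => pt2 py.
set r1 := `|t - _| in pt2 *; set r2 := `|_ - p.2 0 ord0| in py *.
apply: (@le_trans _ _ (C1 * (e / (C1 + C2 + 1)) + C2 * (e / (C1 + C2 + 1)))).
  by apply: lerD; rewrite ler_wpM2l // ler_pdivlMr.
rewrite -mulrDl mulrCA ler_piMr ?(ltW e0) // ler_pdivrMr // mul1r lerDl.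
by [].
Unshelve. all: by end_near. Qed.

Lemma reversed_dZ a c t i y : bdd a -> t < T ->
  derivable (fun y => c * reversed a t y) y (delta_mx 0 i) /\
  'D_(delta_mx 0 i) (fun y => c * reversed a t y) y =
    c * (ord0 == i)%:R * reversed (fun M m => dif (a M m)) t y.
Proof.
move=> ha tT; have s0 : 0 < T - t by rewrite subr_gt0.
have [C [C0 HC]] := lims_taylor_x Uoo (T - t) ha s0.
by apply: first_derive => x z; apply: HC; rewrite lexx.
Qed.

Lemma reversed_dx a t i y : bdd a -> t < T ->
  derivable (reversed a t) y (delta_mx 0 i) /\
  'D_(delta_mx 0 i) (reversed a t) y = (ord0 == i)%:R * reversed (fun M m => dif (a M m)) t y.
Proof.
move=> ha tT; have := reversed_dZ 1 i y ha tT; rewrite mul1r (_ : (fun y => _) = reversed a t) //.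
by apply/funext => z; rewrite mul1r.
Qed.

Lemma reversed_dt a : good a -> good (tq a) ->
  is_time_derivative T (reversed a) (reversed (fun M m i => - tq a M m i)).
Proof.
move=> ga gq t y /andP[t0 tT].
have bN : lims U (fun M m i => - tq a M m i) (T - t) (y 0 ord0) = - lims U (tq a) (T - t) (y 0 ord0).
  have := @lims_lin R U UU Uoo (-1) 0 (tq a) (tq a) (T - t) (y 0 ord0) gq.1 gq.1 _.
  rewrite mulN1r mul0r addr0 => <-; last by rewrite subr_gt0.
  by apply: lims_ext => M m i; ring.
rewrite /reversed bN.
pose d := (T - t) / 2; have d0 : 0 < d by rewrite divr_gt0 // subr_gt0.
have [C [C0 HC]] := lims_taylor_t Uoo T ga gq d0.
have C1 : 0 < C + 1 by rewrite ltr_wpDl.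
apply/cvgrPdist_le => e e0; have e1 : 0 < e / (C + 1) by rewrite divr_gt0.
have idt : id @ within `[0, T[%classic (dnbhs t) --> t.
  by apply: cvg_within_filter; exact: cvg_within.
near=> s.
have s01 : s \in `[0, T[ by near: s; exact: withinT.
have st : s != t by near: s; apply: cvg_within; apply: withinT.
have ts1 : `|t - s| <= d by near: s; move/cvgrPdist_le: idt; exact.
have ts2 : `|t - s| <= e / (C + 1) by near: s; move/cvgrPdist_le: idt; exact.
move: s01; rewrite in_itv /= => /andP[s0 sT].
have dt : d <= T - t <= T by rewrite /d; apply/andP; split; lra.
have ds : d <= T - s <= T by move: ts1; rewrite ler_norml /d => /andP[? ?]; apply/andP; split; lra.
have := HC _ _ (y 0 ord0) dt ds.
set A := lims U a (T - s) _; set B := lims U a (T - t) _; set D := lims U (tq a) _ _.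
have -> : T - s - (T - t) = t - s by ring.
move=> H; have ts0 : t - s != 0 by rewrite subr_eq0 eq_sym.
have st0 : s - t != 0 by rewrite subr_eq0.
have -> : - D - (s - t)^-1 * (A - B) = (t - s)^-1 * (A - B - (t - s) * D).
  by field; rewrite ts0 st0.
have tsp : 0 < `|t - s| by rewrite normr_gt0.
rewrite normrM normfV mulrC ler_pdivrMr //; apply: le_trans H _.
rewrite -[(t - s) ^+ 2]real_normK ?num_real // expr2 mulrA ler_pM2r //.
by move: ts2; rewrite ler_pdivlMr //; lra.
Unshelve. all: by end_near. Qed.

Lemma reversed_absgrad a t : bdd a -> t < T ->
  is_absgrad (reversed a t) (reversed (fun M m => labs (a M m)) t).
Proof.
move=> ha tT; have s0 : 0 < T - t by rewrite subr_gt0.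
have hl := bdd_labs ha.
have [C1 H1] := lims_bounded Uoo ha s0; have [C2 H2] := lims_bounded Uoo hl s0.
apply: (@absgrad_first_coordinate R n (lims U a (T - t)) (lims U (fun M m => labs (a M m)) (T - t)) (Num.max C1 C2)).
- exact: lims_measurable.
- by move=> x; rewrite le_max H1.
- exact: lims_measurable.
- by move=> x; rewrite le_max H2 orbT.
- exact: lims_absgrad.
Qed.

Lemma reversed_mul a b t y : bdd a -> bdd b -> t < T ->
  reversed (fun M m i => a M m i * b M m i) t y = reversed a t y * reversed b t y.
Proof. by move=> ha hb tT; apply: lims_mul; rewrite // subr_gt0. Qed.

Lemma reversed_smooth a t : bdd a -> t < T -> smooth (reversed a t).
Proof.
move=> ha tT s; have s0 : 0 < T - t by rewrite subr_gt0.
have hb k : bdd (fun M m => iter k dif (a M m)) by elim: k => [//|k IH]; exact: (bdd_dif IH).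
have [c ->] : exists c, partials s (reversed a t) =
    fun y => c * reversed (fun M m => iter (size s) dif (a M m)) t y.
  elim: s => [|i s [c IH]]; first by exists 1; apply/funext => y; rewrite mul1r.
  exists (c * (ord0 == i)%:R); apply/funext => y; rewrite /= -/(partials s _) IH.
  by have [_ ->] := reversed_dZ c i y (hb (size s)) tT.
split; last by move=> i y; have [] := reversed_dZ c i y (hb (size s)) tT.
have [L [_ HL]] := lims_lip Uoo (hb (size s)) s0.
apply: (@first_continuous R n (fun x => c * lims U (fun M m => iter (size s) dif (a M m)) (T - t) x)).
move=> x; apply: cvgMl_tmp; exact: (lipschitz_continuous HL).
Qed.

End Solution.

Lemma Lfun1_integrable d (T : measurableType d) (R : realType) (mu : {measure set T -> \bar R})
    (f : T -> R) : f \in Lfun mu 1%E -> mu.-integrable setT (EFin \o f).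
Proof.
move=> fL; have mf : measurable_fun setT f := set_mem (sub_Lfun_mfun fL).
have : finite_norm mu 1%E f := set_mem (sub_Lfun_finLfun fL).
rewrite /finite_norm Lnorm1 => f1.
by apply/integrableP; split=> //; exact/measurable_EFinP.
Qed.

Section BlowupLimit.
Context {R : realType} (n : nat).
Variable (U : set_system nat).
Context {UU : UltraFilter U}.
Hypothesis Uoo : \oo `<=` U.
Variable T : R.
Hypothesis T0 : 0 < T.
Local Notation V := 'rV[R]_n.+1.
Local Notation tor := (@torus_measure R).
Local Notation RR := (measurableTypeR R).
Local Notation u := (reversed (n := n) U T rev_traj).
Implicit Types (t : R) (y : V).

Lemma lims_cst (c t x : R) : lims U (fun M m i => c) t x = c.
Proof. by apply: cvg_lim => //; exact: cvg_cst. Qed.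

Lemma rev_lims t x : 0 < t -> lims U rev_traj t x = - (1 + lims U traj t x).
Proof.
move=> t0; rewrite (@lims_lin R U UU Uoo (-1) (-1) (fun M m i => 1) (@traj R)) //.
- by rewrite lims_cst; ring.
- exact: (good_cst 1).1.
- exact: bdd_traj.
Qed.

Lemma rev_lims_le t x : 0 < t -> `|lims U rev_traj t x| <= 2.
Proof.
move=> t0; rewrite rev_lims // normrN; have := @lims_traj_le R U UU Uoo t x t0.
by rewrite !ler_norml => /andP[? ?]; apply/andP; split; lra.
Qed.

Lemma reversed_lt0 t y : t < T -> u t y < 0.
Proof.
move=> tT; rewrite /reversed rev_lims ?subr_gt0 //.
have s0 : 0 < T - t by rewrite subr_gt0.
by have := @lims_traj_le R U UU Uoo _ (y 0 ord0) s0; rewrite ler_norml => /andP[? ?]; lra.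
Qed.

Lemma reversed_measurable t : t < T ->
  measurable_fun setT (fun x : n.+1.-tuple RR => u t (torus_pt x)).
Proof.
move=> tT; have s0 : 0 < T - t by rewrite subr_gt0.
rewrite (_ : (fun x => _) = fun x : n.+1.-tuple RR => lims U rev_traj (T - t) (tnth x ord0)).
  apply: first_measurable; apply: lims_measurable => //; exact: good_rev.1.
by apply/funext => x; rewrite /reversed mxE.
Qed.

Lemma reversed_l2 t : t < T ->
  \int[tor n.+1]_x (u t (torus_pt x) - blowup (torus_pt x)) ^+ 2 <=
    16 * fine (tor n setT) * (T - t).
Proof.
move=> tT; have s0 : 0 < T - t by rewrite subr_gt0.
have -> : 16 * fine (tor n setT) * (T - t) = (16 * (T - t)) * fine (tor n setT) by ring.
have E x : (u t (torus_pt x) - blowup (torus_pt x)) ^+ 2 =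
    (lims U rev_traj (T - t) (tnth x ord0) - - (1 + profile (tnth x ord0))) ^+ 2.
  by rewrite /reversed /blowup mxE.
under eq_Rintegral do rewrite E.
apply: (@first_Rintegral_sqr_le R n (lims U rev_traj (T - t)) (fun x => - (1 + profile x)) 2).
- by apply: lims_measurable => //; exact: good_rev.1.
- apply: measurableT_comp => //; apply: measurable_funD => //; exact: profile_measurable.
- by move=> x; exact: rev_lims_le.
- move=> x; rewrite normrN; have := profile_le x.
  by rewrite !ler_norml => /andP[? ?]; apply/andP; split; lra.
have E2 x : (lims U rev_traj (T - t) x - - (1 + profile x)) ^+ 2 =
    (lims U traj (T - t) x - profile x) ^+ 2 by rewrite rev_lims //; ring.
by under eq_Rintegral do rewrite E2; exact: lims_traj_profile_l2.
Qed.

Lemma near_left_lt : \forall t \near T^'-, t < T.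
Proof. exact: nbhs_left_lt. Qed.

Lemma reversed_l2_bound_cvg : (fun t => 16 * fine (tor n setT) * (T - t)) @ T^'- --> (0 : R).
Proof.
rewrite -[X in _ --> X](mulr0 (16 * fine (tor n setT))); apply: cvgMl_tmp.
rewrite -[X in _ --> X](subrr T); apply: cvgB; first exact: cvg_cst.
by apply: cvg_at_left_filter; exact: cvg_id.
Qed.

Lemma reversed_L2_limit : L2_limit_left u T (@blowup R n).
Proof.
rewrite /L2_limit_left; set N := fun t => _.
have up : \forall t \near T^'-,
    (0 <= N t <= (Num.sqrt (16 * fine (tor n setT) * (T - t)))%:E)%E.
  near=> t; have tT : t < T by near: t; exact: near_left_lt.
  rewrite /N Lnorm_ge0 /=.
  apply: (@Lnorm2_le _ _ R (tor n.+1) (torus_fin n.+1) _ 4).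
  - by apply: measurable_funB; [exact: reversed_measurable|exact: blowup_measurable].
  - move=> x; apply: le_trans (ler_normB _ _) _.
    have := blowup_le (torus_pt x : V); have := @rev_lims_le (T - t) ((torus_pt x : V) 0 ord0).
    rewrite subr_gt0 => /(_ tT); rewrite /reversed; lra.
  - exact: reversed_l2.
apply: (squeeze_cvge up); first exact: cvg_cst.
apply: cvg_EFin; first exact: nearW.
rewrite -[X in _ --> X]/(0 : R) -sqrtr0.
apply: (@cvg_comp _ _ _ (fun t => 16 * fine (tor n setT) * (T - t)) Num.sqrt _ (nbhs 0)).
  exact: reversed_l2_bound_cvg.
exact: sqrt_continuous.
Unshelve. all: by end_near. Qed.

Lemma reversed_weakstar_limit : weakstar_limit_left u T (@blowup R n).
Proof.
move=> phi phi1.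
apply: (@weak_limit_of_l2 _ _ R (tor n.+1) (torus_fin n.+1) R T^'- _
  (fun t x => u t (torus_pt x)) (fun x => blowup (torus_pt x)) phi 2).
- exact: Lfun1_integrable.
- exact: blowup_measurable.
- by move=> x; exact: blowup_le.
- apply: filterS near_left_lt => t tT; split; first exact: reversed_measurable.
  by move=> x; apply: rev_lims_le; rewrite subr_gt0.
move=> e e0; near=> t.
have tT : t < T by near: t; exact: near_left_lt.
apply: le_trans (reversed_l2 tT) _; near: t.
exact: (cvgr_le _ reversed_l2_bound_cvg).
Unshelve. all: by end_near. Qed.

End BlowupLimit.

Theorem corollary2p9 (R : realType) (d : nat) (hd : (1 <= d)%N)
    (tstar : R) (htstar : 0 < tstar) :
  exists (u0 : 'rV[R]_d -> R) (u : R -> 'rV[R]_d -> R) (ustar : 'rV[R]_d -> R),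
    [/\ torus_periodic u0 /\ smooth u0,
        forall x, u0 x < 0,
        classical_solution tstar u0 u,
        [/\ torus_periodic ustar,
            weakstar_limit_left u tstar ustar &
            L2_limit_left u tstar ustar] &
        in_Lp +oo%E ustar /\ ~ ae_continuous ustar].
Proof.
case: d hd => [//|n] _.
have [U [UU Uoo]] := @ultraFilterLemma nat \oo _.
have rev1 := (good_rev (R := R)).1.
pose u := reversed (n := n) U tstar (@rev_traj R).
exists (u 0), u, (@blowup R n); split.
- by split; [exact: reversed_periodic|apply: reversed_smooth].
- by move=> y; exact: reversed_lt0.
- split=> //.
  + by move=> t _; exact: reversed_periodic.
  + by apply: reversed_slab => //; exact: good_rev.
  + move=> i; split=> [t y /andP[_ tT]|]; first by have [] := reversed_dx Uoo i y rev1 tT.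
    have gd := good_dif (good_rev (R := R)); pose c : R := (ord0 == i)%:R.
    have gc := good_lin c 0 gd (good_cst 0).
    (* The partial derivative is identified with the limit of a [good] family, whose continuity is
       already known; the summand 0 * 0 only fits the shape of [good_lin]. *)
    apply: (@subspace_eq_continuous _ _ _ (fun p : R * 'rV[R]_n.+1 => reversed U tstar
      (fun M m i => c * dif (rev_traj M m) i + 0 * 0) p.1 p.2)); last exact: reversed_slab.
    move=> [t y] /set_mem /= /andP[_ tT].
    rewrite -[RHS]/('D_(delta_mx 0 i) (reversed U tstar rev_traj t) y).
    have [_ ->] := reversed_dx Uoo i y rev1 tT.
    rewrite /reversed (@lims_lin R U UU Uoo c 0) ?subr_gt0 //; last exact: (good_cst 0).1.
      by rewrite mul0r addr0.
    exact: gd.1.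
  exists (reversed U tstar (fun M m i => - tq rev_traj M m i)),
    (reversed U tstar (fun M m => labs (rev_traj M m))),
    (reversed U tstar (fun M m => labs (fun i => rev_traj M m i * rev_traj M m i))).
  have gr := good_rev (R := R); have gl := good_labs gr; have gl2 := good_labs (good_mul gr gr).
  have gt : good (fun M m i => - tq (@rev_traj R) M m i).
    apply: good_ext (good_lin (-1) 0 (good_tq_rev (R := R)) (good_cst 0)) => M m i.
    by ring.
  split.
  + by apply: reversed_dt => //; exact: good_tq_rev.
  + move=> t /andP[t0 tT]; split; try exact: reversed_periodic.
      exact: reversed_absgrad.
    rewrite (_ : (fun x => _) = reversed U tstar (fun M m i => rev_traj M m i * rev_traj M m i) t).
      by apply: (reversed_absgrad Uoo) => //; exact: (good_mul gr gr).1.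
    by apply/funext => y; rewrite reversed_mul // expr2.
  + exact: reversed_slab.
  + by split; exact: reversed_slab.
  move=> t y /andP[t0 tT]; have s0 : 0 < tstar - t by rewrite subr_gt0.
  rewrite -/(u t y) -reversed_mul //; last exact: gl.1.
  have gm := good_mul gr gl.
  (* The three terms are assembled into one limit, that of the left side of [rev_equation], which is
     identically 0. *)
  have L1 := @lims_lin R U UU Uoo 1 (-1) _ _ (tstar - t) (y 0 ord0) gt.1 gm.1 s0.
  have L2 := @lims_lin R U UU Uoo 1 1 _ _ (tstar - t) (y 0 ord0) (good_lin 1 (-1) gt gm).1 gl2.1 s0.
  rewrite L1 !mul1r mulN1r in L2; rewrite /reversed -L2.
  rewrite -(lims_cst (UU := UU) 0 (tstar - t) (y 0 ord0)); apply: lims_ext => M m i.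
  by rewrite !mul1r mulN1r rev_equation.
- split; [exact: blowup_periodic|exact: reversed_weakstar_limit|exact: reversed_L2_limit].
- by split; [exact: blowup_in_Loo|exact: blowup_not_ae_continuous].
Qed.
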